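(* Let $A$ be a right-angled Artin group, given by a fixed presentation with generators $a_1,\dots,a_N$. The conjugacy problem in $A$ can be solved in linear time in the sum of the lengths of the two input words: there is an algorithm which, given two words $w$ and $v$ in the letters $a_1^{\pm 1},\dots,a_N^{\pm 1}$, of lengths $\ell_1$ and $\ell_2$, decides in time $O(\ell_1+\ell_2)$ whether $w$ and $v$ represent conjugate elements of $A$.
   Context: A right-angled Artin group is a group given by a finite presentation in which every relation states that some pair of generators commutes. The group and its presentation are fixed (not part of the input), so the implied constant may depend on them. Running time is measured on a RAM (random access memory) machine. *)

(* Defs.v *)
(* [boolp] is used only to make equality in a presented group a boolean
   relation, so that the quotient is a [groupType]. *)
From HB Require Import structures.
From mathcomp Require Import all_boot.
From mathcomp Require Import boolp.

Set Implicit Arguments.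
Unset Strict Implicit.
Unset Printing Implicit Defensive.

Local Open Scope quotient_scope.

(* (i, false) stands for a_i and (i, true) for a_i^-1. *)
Definition letter (N : nat) : Type := ('I_N * bool)%type.
HB.instance Definition _ N := Choice.on (letter N).

Definition word (N : nat) : Type := seq (letter N).
HB.instance Definition _ N := Choice.on (word N).

Definition letter_inv N (x : letter N) : letter N := (x.1, ~~ x.2).
Definition word_inv N (w : word N) : word N := rev (map (@letter_inv N) w).

Section Presentation.

Variables (N : nat) (R : seq (word N * word N)).

(* A pair (u, v) in R is the relation u = v. *)
Inductive pres_eq : word N -> word N -> Prop :=
| PresRefl u : pres_eq u u
| PresSym u v : pres_eq u v -> pres_eq v u
| PresTrans u v w : pres_eq u v -> pres_eq v w -> pres_eq u w
| PresCat u u' v v' :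
    pres_eq u u' -> pres_eq v v' -> pres_eq (u ++ v) (u' ++ v')
| PresInv x : pres_eq [:: x; letter_inv x] [::]
| PresRel r : r \in R -> pres_eq r.1 r.2.

Definition pres_eqb (u v : word N) : bool := `[< pres_eq u v >].

Lemma pres_eqb_refl : reflexive pres_eqb.
Proof. by move=> u; apply/asboolP; apply: PresRefl. Qed.

Lemma pres_eqb_sym : symmetric pres_eqb.
Proof. by move=> u v; apply/asboolP/asboolP; apply: PresSym. Qed.

Lemma pres_eqb_trans : transitive pres_eqb.
Proof.
move=> v u w /asboolP uv /asboolP vw; apply/asboolP.
exact: PresTrans uv vw.
Qed.

Canonical pres_equiv :=
  EquivRel pres_eqb pres_eqb_refl pres_eqb_sym pres_eqb_trans.

Definition presented_group : Type := {eq_quot pres_equiv}.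
HB.instance Definition _ := Choice.on presented_group.

Definition elt_of (w : word N) : presented_group := \pi_{eq_quot pres_equiv} w.

Lemma elt_ofP (u v : word N) : elt_of u = elt_of v <-> pres_eq u v.
Proof.
split=> [/eqP | uv]; first by rewrite /elt_of piE => /asboolP.
by apply/eqP; rewrite /elt_of piE; apply/asboolP.
Qed.

Lemma elt_of_ind (P : presented_group -> Prop) :
  (forall w, P (elt_of w)) -> forall x, P x.
Proof. by move=> Pw; elim/quotP => w _; apply: Pw. Qed.

Definition pres_one : presented_group := elt_of [::].
Definition pres_mul (x y : presented_group) : presented_group :=
  elt_of (repr x ++ repr y).
Definition pres_inv (x : presented_group) : presented_group :=
  elt_of (word_inv (repr x)).

Lemma letter_invK : involutive (@letter_inv N).
Proof. by case=> i b; rewrite /letter_inv /= negbK. Qed.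

Lemma word_inv_cat (u v : word N) :
  word_inv (u ++ v) = word_inv v ++ word_inv u.
Proof. by rewrite /word_inv map_cat rev_cat. Qed.

Lemma word_invK : involutive (@word_inv N).
Proof.
move=> w; rewrite /word_inv map_rev revK -map_comp map_id_in // => x _.
exact: letter_invK.
Qed.

Lemma pres_eq_catV (w : word N) : pres_eq (w ++ word_inv w) [::].
Proof.
elim: w => [|x w IHw]; first exact: PresRefl.
rewrite -cat1s word_inv_cat -catA (catA w).
apply: PresTrans (PresInv x).
have E := PresCat (PresRefl [:: x]) (PresCat IHw (PresRefl (word_inv [:: x]))).
exact: E.
Qed.

Lemma pres_eq_Vcat (w : word N) : pres_eq (word_inv w ++ w) [::].
Proof. by have := pres_eq_catV (word_inv w); rewrite word_invK. Qed.

Lemma pres_eq_inv (u v : word N) :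
  pres_eq u v -> pres_eq (word_inv u) (word_inv v).
Proof.
move=> uv.
have E1 : pres_eq (word_inv u) (word_inv u ++ (v ++ word_inv v)).
  rewrite -{1}[word_inv u]cats0.
  exact: PresCat (PresRefl _) (PresSym (pres_eq_catV v)).
apply: PresTrans E1 _; rewrite catA.
apply: (@PresTrans _ ([::] ++ word_inv v)); last exact: PresRefl.
apply: PresCat (PresRefl _).
apply: PresTrans (pres_eq_Vcat u).
exact: PresCat (PresRefl _) (PresSym uv).
Qed.

Lemma pres_eq_repr (w : word N) : pres_eq (repr (elt_of w)) w.
Proof. by apply/elt_ofP; rewrite /elt_of reprK. Qed.

Lemma pres_mulE (u v : word N) : pres_mul (elt_of u) (elt_of v) = elt_of (u ++ v).
Proof. by apply/elt_ofP; apply: PresCat; apply: pres_eq_repr. Qed.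

Lemma pres_invE (w : word N) : pres_inv (elt_of w) = elt_of (word_inv w).
Proof. by apply/elt_ofP; apply: pres_eq_inv; apply: pres_eq_repr. Qed.

Lemma pres_mulA : associative pres_mul.
Proof.
by elim/elt_of_ind=> u; elim/elt_of_ind=> v; elim/elt_of_ind=> w;
  rewrite !pres_mulE catA.
Qed.

Lemma pres_mul1 : left_id pres_one pres_mul.
Proof. by elim/elt_of_ind=> u; rewrite pres_mulE. Qed.

Lemma pres_1mul : right_id pres_one pres_mul.
Proof. by elim/elt_of_ind=> u; rewrite pres_mulE cats0. Qed.

Lemma pres_mulV : left_inverse pres_one pres_inv pres_mul.
Proof.
elim/elt_of_ind=> u; rewrite pres_invE pres_mulE.
by apply/elt_ofP; apply: pres_eq_Vcat.
Qed.

Lemma pres_Vmul : right_inverse pres_one pres_inv pres_mul.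
Proof.
elim/elt_of_ind=> u; rewrite pres_invE pres_mulE.
by apply/elt_ofP; apply: pres_eq_catV.
Qed.

HB.instance Definition _ := isGroup.Build presented_group
  pres_mulA pres_mul1 pres_1mul pres_mulV pres_Vmul.

End Presentation.

Definition conjugate (G : groupType) (x y : G) : Prop :=
  exists g : G, (x ^ g)%g = y.

(* A pair (i, j) in C is the relation a_i a_j = a_j a_i. *)
Definition commutation_relations N (C : seq ('I_N * 'I_N)) :
    seq (word N * word N) :=
  [seq ([:: (p.1, false); (p.2, false)], [:: (p.2, false); (p.1, false)])
     | p <- C].

Notation raag C := (presented_group (commutation_relations C)).

(* Uniform-cost RAM of Cook and Reckhow, over natural numbers and hence with
   truncated subtraction: unboundedly many registers X_0, X_1, ..., initially 0,
   and an input tape read sequentially, which yields 0 once exhausted.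
   There is deliberately no multiplication, whose unit cost would be
   unrealistic. *)
Inductive ram_instr : Type :=
| RConst (d k : nat)
| RAdd (d a b : nat)
| RSub (d a b : nat)
| RLoad (d a : nat)
| RStore (a b : nat)
| RRead (d : nat)
| RJumpPos (a l : nat)
| RHalt (answer : bool).

Definition ram_program : Type := seq ram_instr.

Record ram_state : Type := RamState {
  ram_pc : nat;
  ram_mem : nat -> nat;
  ram_input : seq nat
}.

Definition ram_set (m : nat -> nat) (d x : nat) : nat -> nat :=
  fun i => if i == d then x else m i.

(* [None]: the program counter has left the program, and no answer is given. *)
Definition ram_step (P : ram_program) (s : ram_state) :
    option (ram_state + bool) :=
  let: RamState pc m inp := s in
  let next m' inp' := Some (inl (RamState pc.+1 m' inp')) in
  match onth P pc with
  | None => None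
  | Some (RConst d k) => next (ram_set m d k) inp
  | Some (RAdd d a b) => next (ram_set m d (m a + m b)) inp
  | Some (RSub d a b) => next (ram_set m d (m a - m b)) inp
  | Some (RLoad d a) => next (ram_set m d (m (m a))) inp
  | Some (RStore a b) => next (ram_set m (m a) (m b)) inp
  | Some (RRead d) => next (ram_set m d (head 0 inp)) (behead inp)
  | Some (RJumpPos a l) =>
      Some (inl (RamState (if 0 < m a then l else pc.+1) m inp))
  | Some (RHalt b) => Some (inr b)
  end.

(* The answer given within t steps, [None] if there is none. *)
Fixpoint ram_run (P : ram_program) (t : nat) (s : ram_state) : option bool :=
  if t is t'.+1 then
    match ram_step P s with
    | Some (inl s') => ram_run P t' s'
    | Some (inr b) => Some b
    | None => None
    end
  else None.

Definition ram_init (inp : seq nat) : ram_state := RamState 0 (fun=> 0) inp.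

Definition ram_decides_within (P : ram_program) (inp : seq nat) (t : nat)
    (Q : Prop) : Prop :=
  exists b : bool, ram_run P t (ram_init inp) = Some b /\ (b <-> Q).

(* One input symbol per letter; 0 is kept as the end marker of a word. *)
Definition letter_code N (x : letter N) : nat :=
  if x.2 then (x.1).*2.+2 else (x.1).*2.+1.

Definition word_pair_code N (w v : word N) : seq nat :=
  map (@letter_code N) w ++ 0 :: map (@letter_code N) v ++ [:: 0].

(* Main.v *)
(* Letters are written into pilings: for every generator a_j, the sequence of
   the letters that do not commute with a_j.  Multiplication by a letter pops
   or pushes in the boundedly many sequences concerned, which yields reduced
   forms and, working at both ends, cyclically reduced forms in linear time.

   If g^-1 u g = v with u, v cyclically reduced and g reduced, then some first
   letter of g either commutes with u or is the first letter, or the inverse of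
   the last letter, of u: otherwise g^-1 u g would be reduced, hence equal to v
   up to commutations, and v would not be cyclically reduced.  So conjugacy of
   cyclically reduced words is generated by commutations and cyclic rotation,
   and can be tested on each connected component of the support separately.

   On a component, fix a generator a and keep rotating an available first
   letter to the end, choosing a-letters only when no other is available.
   Rotations of letters other than a are strongly confluent and terminate, at a
   pyramid whose only first letters are a-letters, so two conjugate words give,
   after a linear number of rotations, the same periodic sequence of rotated
   letters up to a shift.  Conversely one period of the sequence spells the
   word it starts from.  Whether two periodic sequences are shifts of each other
   is decided by comparing them from a pair of starting points and, at the first
   mismatch, skipping all the starting points passed on the larger side. *)

(* That reduced words are normal forms up to commutation needs an argument: right multiplication by
   a letter is an invertible map on the pilings of reduced words, and commuting letters give
   commuting maps, so the presented group acts there; evaluating at the empty piling then separates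
   reduced words. The linear number of rotations comes from the periodic trace [u^omega], of which
   the greedy outputs form a prefix. Two dependent generators are linearly ordered in it, so one can
   run ahead of the other by at most one period. Along a connected enumeration starting with [a] the
   lead grows by at most one period per place, so an [a]-letter appears among the first [N * size u]
   outputs. The program does not search for components. It contains one block for each connected
   enumeration of generators, a number that depends on the presentation only, and a block is idle
   unless its enumeration is a component of the support. Running time is counted on an intermediate
   machine with deques whose loops occur only at top level. Each loop body is loop-free, so executed
   blocks can be counted, at a cost bounded by the code size. *)
Require Import Defs.
From mathcomp Require Import all_boot zify boolp.

Set Implicit Arguments.
Unset Strict Implicit.
Unset Printing Implicit Defensive.

(** * Traces and pilings *)

Section Trace.
Variables (N : nat) (dep : rel 'I_N).
Hypotheses (dep_refl : reflexive dep) (dep_sym : symmetric dep).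
Implicit Types (x y l : letter N) (u v w r t : word N) (i j : 'I_N).

(* The values are chosen so that two entries of a piling sum to 3 exactly when
   they come from mutually inverse letters; 0 stands for a letter of another
   generator. *)
Definition sgn x : nat := (x.2 : nat).+1.
Definition entry j x : nat := if x.1 == j then sgn x else 0.
Definition pile u j : seq nat := [seq entry j x | x <- u & dep j x.1].
Definition indep x u := all (fun y => ~~ dep x.1 y.1) u.

Inductive trace_eq : word N -> word N -> Prop :=
| TeqRefl u : trace_eq u u
| TeqSwap u x y v : ~~ dep x.1 y.1 -> trace_eq (u ++ x :: y :: v) (u ++ y :: x :: v)
| TeqTrans u v w : trace_eq u v -> trace_eq v w -> trace_eq u w.

Lemma trace_eq_sym u v : trace_eq u v -> trace_eq v u.
Proof.
elim=> {u v} [u|u x y v dxy|u v w _ uv _ vw]; first exact: TeqRefl.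
  by apply: TeqSwap; rewrite dep_sym.
exact: TeqTrans vw uv.
Qed.

Lemma trace_eq_cat2l t u v : trace_eq u v -> trace_eq (t ++ u) (t ++ v).
Proof.
elim=> {u v} [u|u x y v dxy|u v w _ uv _ vw]; first exact: TeqRefl.
  by rewrite !catA; apply: TeqSwap.
exact: TeqTrans uv vw.
Qed.

Lemma trace_eq_cat2r t u v : trace_eq u v -> trace_eq (u ++ t) (v ++ t).
Proof.
elim=> {u v} [u|u x y v dxy|u v w _ uv _ vw]; first exact: TeqRefl.
  by rewrite -!catA; apply: TeqSwap.
exact: TeqTrans uv vw.
Qed.

Lemma trace_eq_cons x u v : trace_eq u v -> trace_eq (x :: u) (x :: v).
Proof. exact: (@trace_eq_cat2l [:: x]). Qed.

Lemma trace_eq_rcons x u v : trace_eq u v -> trace_eq (rcons u x) (rcons v x).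
Proof. by rewrite -!cats1; apply: trace_eq_cat2r. Qed.

Lemma trace_eq_indep x u : indep x u -> trace_eq (x :: u) (rcons u x).
Proof.
elim: u => [|y u IHu] /=; first by move=> _; apply: TeqRefl.
case/andP=> dxy /IHu E; apply: TeqTrans (trace_eq_cons _ E).
exact: (@TeqSwap [::]).
Qed.

Lemma trace_eq_perm u v : trace_eq u v -> perm_eq u v.
Proof.
elim=> {u v} [u|u x y v dxy|u v w _ uv _ vw] //; last exact: perm_trans uv vw.
by rewrite perm_cat2l (perm_catCA [:: x] [:: y] v).
Qed.

Lemma trace_eq_size u v : trace_eq u v -> size u = size v.
Proof. by move/trace_eq_perm/perm_size. Qed.

(** No swap ever involves two letters of pairwise dependent generators, so their order is an
    invariant and the projections agree as words, not merely as traces. *)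
Lemma trace_eq_filter_dep (p : pred 'I_N) u v :
  {in p &, forall i j, dep i j} -> trace_eq u v ->
  [seq x <- u | p x.1] = [seq x <- v | p x.1].
Proof.
move=> dp; elim=> {u v} [u|u x y v dxy|u v w _ -> _ ->] //.
rewrite !filter_cat /=; case px: (p _); case py: (p _) => //.
by rewrite (dp _ _ px py) in dxy.
Qed.

Lemma trace_eq_filter (p : pred 'I_N) u v :
  trace_eq u v -> trace_eq [seq x <- u | p x.1] [seq x <- v | p x.1].
Proof.
elim=> {u v} [u|u x y v dxy|u v w _ uv _ vw]; first exact: TeqRefl.
  rewrite !filter_cat /=; case px: (p _); case py: (p _); try exact: TeqRefl.
  exact: TeqSwap.
exact: TeqTrans uv vw.
Qed.

Lemma pile_cat u v j : pile (u ++ v) j = pile u j ++ pile v j.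
Proof. by rewrite /pile filter_cat map_cat. Qed.

Lemma pile_cons x u j :
  pile (x :: u) j = if dep j x.1 then entry j x :: pile u j else pile u j.
Proof. by rewrite /pile /=; case: ifP. Qed.

Lemma pile_rcons x u j :
  pile (rcons u x) j = if dep j x.1 then rcons (pile u j) (entry j x) else pile u j.
Proof. by rewrite -cats1 pile_cat pile_cons; case: ifP; rewrite ?cats1 ?cats0. Qed.

(** A pile can notice a swap only if it records both letters. Then neither belongs to the generator
    [j], as the letters are independent, and both entries are 0. *)
Lemma trace_eq_pile u v : trace_eq u v -> pile u =1 pile v.
Proof.
move=> uv j; elim: uv => {u v} [u|u x y v dxy|u v w _ -> _ ->] //.
rewrite !pile_cat !pile_cons; case dx: (dep j x.1); case dy: (dep j y.1) => //.
have jx : (x.1 == j) = false by apply: contraNF dxy => /eqP ->.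
have jy : (y.1 == j) = false by apply: contraNF dxy => /eqP ->; rewrite dep_sym.
by rewrite /entry jx jy.
Qed.

Lemma entry_id x : entry x.1 x = sgn x. Proof. by rewrite /entry eqxx. Qed.

Lemma sgn_inj x y : x.1 = y.1 -> sgn x = sgn y -> x = y.
Proof. by case: x y => [i []] [j []] //= ->. Qed.

Lemma entry_sgn j x y : y.1 = j -> entry j x = sgn y -> x = y.
Proof.
move=> yj; rewrite /entry; case: eqP => // xj E; apply: sgn_inj => //.
by rewrite xj.
Qed.

(* [l] can be brought to the front of [u] by commutations. *)
Definition avail l u := head 0 (pile u l.1) == sgn l.

Lemma avail_cons x u : avail x (x :: u).
Proof. by rewrite /avail pile_cons dep_refl entry_id /=. Qed.

Lemma avail_trace_eq l u v : trace_eq u v -> avail l u = avail l v.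
Proof. by move=> uv; rewrite /avail (trace_eq_pile uv). Qed.

Lemma pile_nil j u : pile u j = [::] -> all (fun x => ~~ dep j x.1) u.
Proof. by elim: u => // x u IHu; rewrite pile_cons /=; case: ifP. Qed.

Lemma availP l u : avail l u -> exists u1 u2,
  u = u1 ++ l :: u2 /\ indep l u1.
Proof.
rewrite /avail; elim: u => // x u IHu; rewrite pile_cons.
case: ifP => [d /eqP /= E|nd /IHu [u1 [u2 [-> iu]]]].
  exists [::], u; split=> //; congr (_ :: _).
  exact: (entry_sgn erefl E).
by exists (x :: u1), u2; split; rewrite //= nd.
Qed.

Lemma indep_notin l u : indep l u -> l \notin u.
Proof. by move=> /allP H; apply/negP=> /H; rewrite dep_refl. Qed.

Lemma avail_mem l u : avail l u -> l \in u.
Proof. by move/availP=> [u1 [u2 [-> _]]]; rewrite mem_cat inE eqxx orbT. Qed.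

Lemma rem_cat_cons l u v : l \notin u -> rem l (u ++ l :: v) = u ++ v.
Proof.
elim: u => [|x u IHu] /=; first by rewrite eqxx.
by rewrite inE negb_or eq_sym => /andP[/negPf -> /IHu ->].
Qed.

Lemma avail_rem l u : avail l u -> trace_eq u (l :: rem l u).
Proof.
move/availP=> [u1 [u2 [-> iu]]]; rewrite rem_cat_cons ?indep_notin //.
by rewrite -cat_cons -cat_rcons; apply/trace_eq_cat2r/trace_eq_sym/trace_eq_indep.
Qed.

(** Availability is read off the piles, so the first letter of [u] can also be brought to the front
    of [v]; removing it takes the same heads off both pilings. *)
Lemma pile_trace_eq u v : pile u =1 pile v -> trace_eq u v.
Proof.
elim: u v => [|x u IHu] v E.
  case: v E => [|y v] E; first exact: TeqRefl.
  by have := E y.1; rewrite pile_cons dep_refl.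
have av : avail x v by rewrite /avail -E; apply: avail_cons.
apply: TeqTrans (trace_eq_sym (avail_rem av)); apply: trace_eq_cons; apply: IHu => j.
have := E j; rewrite (trace_eq_pile (avail_rem av)) !pile_cons.
by case: ifP => // _ [].
Qed.

Lemma trace_eq_consK x u v : trace_eq (x :: u) (x :: v) -> trace_eq u v.
Proof.
move/trace_eq_pile=> E; apply: pile_trace_eq => j; have := E j; rewrite !pile_cons.
by case: ifP => // _ [].
Qed.

Lemma trace_eq_catK t u v : trace_eq (t ++ u) (t ++ v) -> trace_eq u v.
Proof. by elim: t => //= x t IHt /trace_eq_consK. Qed.

Lemma pile_rev u j : pile (rev u) j = rev (pile u j).
Proof. by rewrite /pile filter_rev map_rev. Qed.

Lemma trace_eq_rev u v : trace_eq u v -> trace_eq (rev u) (rev v).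
Proof. by move/trace_eq_pile=> E; apply: pile_trace_eq => j; rewrite !pile_rev E. Qed.

Lemma last_pile l u : last 0 (pile u l.1) = sgn l -> exists u', trace_eq u (rcons u' l).
Proof.
move=> E; have: avail l (rev u).
  rewrite /avail pile_rev -E; case/lastP: (pile u l.1) => // s a.
  by rewrite rev_rcons last_rcons.
move/avail_rem/trace_eq_rev; rewrite revK rev_cons => H.
by exists (rev (rem l (rev u))).
Qed.

Lemma head_pile l u : head 0 (pile u l.1) = sgn l -> exists u', trace_eq u (l :: u').
Proof. by move/eqP/avail_rem=> H; exists (rem l u). Qed.

Lemma count_pile u j : count (fun a => 0 < a) (pile u j) = count (fun x => x.1 == j) u.
Proof.
elim: u => // x u IHu; rewrite pile_cons /=; case: ifP => [d|nd] /=; rewrite IHu.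
  by rewrite /entry; case: eqP.
by case: eqP => // xj; rewrite xj dep_refl in nd.
Qed.

Lemma pile_le2 u j : all (fun a => a <= 2) (pile u j).
Proof.
by apply/allP=> a /mapP [x _ ->]; rewrite /entry; case: ifP => // _; rewrite /sgn; case: x.2.
Qed.

Definition rotate_to_end l u := rcons (rem l u) l.

Lemma rotate_to_end_cons l u : rotate_to_end l (l :: u) = rcons u l.
Proof. by rewrite /rotate_to_end /= eqxx. Qed.

Lemma rotate_to_end_trace_eq l u t : avail l u -> trace_eq u (l :: t) -> trace_eq (rotate_to_end l u) (rcons t l).
Proof.
move=> av E; apply: trace_eq_rcons; apply: (@trace_eq_consK l).
exact: TeqTrans (trace_eq_sym (avail_rem av)) E.
Qed.

Lemma trace_eq_rotate_to_end l u v : avail l u -> trace_eq u v -> trace_eq (rotate_to_end l u) (rotate_to_end l v).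
Proof.
move=> av uv; apply: rotate_to_end_trace_eq => //; apply: TeqTrans (uv) _.
by apply: avail_rem; rewrite -(avail_trace_eq _ uv).
Qed.

Lemma rotate_to_end_swap l u : avail l u -> trace_eq (u ++ [:: l]) (l :: rotate_to_end l u).
Proof.
move=> av; apply: TeqTrans (trace_eq_cat2r _ (avail_rem av)) _.
by rewrite cats1; apply: TeqRefl.
Qed.

(** This makes a rotation a bounded number of deque operations. *)
Lemma pile_rotate_to_end l u j : avail l u ->
  pile (rotate_to_end l u) j = if dep j l.1 then rot 1 (pile u j) else pile u j.
Proof.
move=> av; rewrite pile_rcons (trace_eq_pile (avail_rem av)) pile_cons.
by case: ifP; rewrite ?rot1_cons.
Qed.

Lemma avail_inj l l' u : avail l u -> avail l' u -> l.1 = l'.1 -> l = l'.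
Proof. by rewrite /avail => /eqP E /eqP E' i; apply: sgn_inj => //; rewrite -E -E' i. Qed.

Lemma avail2 l l' u : avail l u -> avail l' u -> l != l' ->
  ~~ dep l.1 l'.1 /\ exists q, trace_eq u (l :: l' :: q).
Proof.
move=> av av' ne.
have ni : l.1 != l'.1 by apply: contraNneq ne => /(avail_inj av av') ->.
have nd : ~~ dep l.1 l'.1.
  apply/negP=> d; move: av'; rewrite (avail_trace_eq _ (avail_rem av)) /avail.
  by rewrite pile_cons dep_sym d /entry (negPf ni).
split=> //; exists (rem l' (rem l u)); apply: TeqTrans (avail_rem av) _.
apply/trace_eq_cons/avail_rem; move: av'; rewrite (avail_trace_eq _ (avail_rem av)) /avail.
by rewrite pile_cons dep_sym (negPf nd).
Qed.

(** Two distinct available letters are independent, so both can be put in front together and leave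
    in either order. This is the strong confluence behind [moves_confluent]. *)
Lemma rotate_to_end_diamond l l' u : avail l u -> avail l' u -> l != l' ->
  [/\ avail l' (rotate_to_end l u), avail l (rotate_to_end l' u)
    & trace_eq (rotate_to_end l' (rotate_to_end l u)) (rotate_to_end l (rotate_to_end l' u))].
Proof.
move=> av av' ne; have [nd [q E]] := avail2 av av' ne.
have E' : trace_eq u (l' :: l :: q) by apply: TeqTrans E (@TeqSwap [::] _ _ _ nd).
have A := rotate_to_end_trace_eq av E; have A' := rotate_to_end_trace_eq av' E'.
have B : avail l' (rotate_to_end l u) by rewrite (avail_trace_eq _ A); apply: avail_cons.
have B' : avail l (rotate_to_end l' u) by rewrite (avail_trace_eq _ A'); apply: avail_cons.
split=> //; apply: TeqTrans (rotate_to_end_trace_eq B A) _.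
apply: TeqTrans (trace_eq_sym (rotate_to_end_trace_eq B' A')).
have R2 a b : rcons (rcons q a) b = q ++ [:: a; b] by rewrite -!cats1 -catA.
by rewrite !R2; apply: TeqSwap.
Qed.

Inductive trace_conj : word N -> word N -> Prop :=
| TconjTeq u v : trace_eq u v -> trace_conj u v
| TconjRot x u : trace_conj (x :: u) (rcons u x)
| TconjSym u v : trace_conj u v -> trace_conj v u
| TconjTrans u v w : trace_conj u v -> trace_conj v w -> trace_conj u w.

Lemma trace_conj_refl u : trace_conj u u. Proof. exact/TconjTeq/TeqRefl. Qed.

Lemma trace_conj_perm u v : trace_conj u v -> perm_eq u v.
Proof.
elim=> {u v} [u v|x u|u v _|u v w _ uv _ vw].
- exact: trace_eq_perm.
- by rewrite perm_sym perm_rcons.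
- by rewrite perm_sym.
- exact: perm_trans uv vw.
Qed.

Lemma trace_conj_rotate_to_end l u : avail l u -> trace_conj u (rotate_to_end l u).
Proof. by move=> /avail_rem/TconjTeq E; apply: TconjTrans E (TconjRot _ _). Qed.

Lemma trace_conj_catC u v : trace_conj (u ++ v) (v ++ u).
Proof.
elim: u v => [|x u IHu] v /=; first by rewrite cats0; apply: trace_conj_refl.
apply: TconjTrans (TconjRot _ _) _; rewrite rcons_cat.
by apply: TconjTrans (IHu _) _; rewrite cat_rcons; apply: trace_conj_refl.
Qed.

Lemma trace_conj_filter (p : pred 'I_N) u v : trace_conj u v ->
  trace_conj [seq x <- u | p x.1] [seq x <- v | p x.1].
Proof.
elim=> {u v} [u v /(trace_eq_filter p)|x u|u v _|u v w _ uv _ vw].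
- exact: TconjTeq.
- rewrite filter_rcons /=; case: ifP => _; [exact: TconjRot | exact: trace_conj_refl].
- exact: TconjSym.
- exact: TconjTrans uv vw.
Qed.

(** A rotated letter [x] lands behind [r] and is commuted back through it. The hypothesis on [u]
    passes to [v] since conjugate traces have the same letters. *)
Lemma trace_conj_cat_indep r u v : trace_conj u v -> all (fun x => indep x r) u ->
  trace_conj (u ++ r) (v ++ r).
Proof.
elim=> {u v} [u v uv _|x u|u v uv IH|u v w uv IH1 _ IH2].
- exact/TconjTeq/trace_eq_cat2r.
- case/andP=> xr _; apply: TconjTrans (TconjRot _ _) _; rewrite rcons_cat cat_rcons.
  exact/TconjTeq/trace_eq_cat2l/trace_eq_sym/trace_eq_indep.
- by rewrite -(perm_all _ (trace_conj_perm uv)) => /IH /TconjSym.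
- move=> H; apply: TconjTrans (IH1 H) (IH2 _).
  by rewrite -(perm_all _ (trace_conj_perm uv)).
Qed.

End Trace.

(** * Reduced and cyclically reduced words *)

(** Entries are 0, 1 or 2, so 3 arises only from 1 and 2: inverse letters of one generator with
    nothing in between that blocks their cancellation. *)
Definition good (a b : nat) := a + b != 3.

Lemma sorted_good_cat s t : sorted good s -> sorted good t ->
  last 0 s + head 0 t != 3 -> sorted good (s ++ t).
Proof.
case: s => // a s ss; case: t => [|b t] state; first by rewrite cats0.
by move=> H; rewrite /= cat_path; apply/andP; split=> //; apply/andP.
Qed.

(** The bound on [a] covers the empty [s], where the default 0 enters the sum. *)
Lemma sorted_good_rcons s a : a <= 2 ->
  sorted good (rcons s a) = sorted good s && (last 0 s + a != 3).
Proof.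
move=> a2; case: s => [|b s] /=; first by symmetry; apply/eqP; lia.
by rewrite rcons_path.
Qed.

Definition droplast T (s : seq T) := take (size s).-1 s.

Lemma droplast_rcons T (s : seq T) a : droplast (rcons s a) = s.
Proof. by rewrite /droplast size_rcons -cats1 take_size_cat. Qed.

Section Reduced.
Variables (N : nat) (dep : rel 'I_N).
Hypotheses (dep_refl : reflexive dep) (dep_sym : symmetric dep).
Implicit Types (x y l : letter N) (u v w r t : word N) (i j : 'I_N).
Implicit Types p q : 'I_N -> seq nat.

Notation pile := (pile dep).
Notation trace_eq := (trace_eq dep).
Notation inv := (@letter_inv N).

Lemma sgn_inv l : sgn (inv l) = 3 - sgn l.
Proof. by case: l => i []. Qed.

Lemma sgn_le l : 0 < sgn l <= 2.
Proof. by case: l => i []. Qed.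

Lemma entry_le j l : entry j l <= 2.
Proof. by rewrite /entry; case: ifP => // _; have /andP[] := sgn_le l. Qed.

Definition reduced u := forall j, sorted good (pile u j).
(** [cycle] also compares the last entry with the first. A pile with one entry is compared with
    itself, which is harmless because [a + a] is never 3. *)
Definition cyc_reduced u := forall j, cycle good (pile u j).

Lemma reduced_trace_eq u v : trace_eq u v -> reduced u -> reduced v.
Proof. by move=> uv ru j; rewrite -(trace_eq_pile dep_sym uv). Qed.

Lemma cyc_reduced_trace_eq u v : trace_eq u v -> cyc_reduced u -> cyc_reduced v.
Proof. by move=> uv ru j; rewrite -(trace_eq_pile dep_sym uv). Qed.

Lemma reduced_rcons u l :
  reduced (rcons u l) <-> reduced u /\ last 0 (pile u l.1) != 3 - sgn l.
Proof.
have sl := sgn_le l.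
split=> [H|[ru Hl] j].
  split=> [j|].
    by have := H j; rewrite pile_rcons; case: ifP => // _;
      rewrite sorted_good_rcons ?entry_le // => /andP[].
  have {H} := H l.1; rewrite pile_rcons dep_refl entry_id sorted_good_rcons ?entry_le //.
  by move=> ?; lia.
rewrite pile_rcons; case: ifP => // dj; rewrite sorted_good_rcons ?entry_le // ru /=.
rewrite /entry; case: (l.1 =P j) => [<-|_]; first by move/eqP: Hl => Hl; apply/eqP; lia.
have /allP := pile_le2 dep u j; case: (pile u j) => // a s H.
by have := H _ (mem_last a s) => /=; lia.
Qed.

Lemma reduced_behead l u : reduced (l :: u) -> reduced u.
Proof.
move=> H j; have := H j; rewrite pile_cons; case: ifP => // _.
exact: path_sorted.
Qed.

Lemma cyc_reduced_reduced u : cyc_reduced u -> reduced u.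
Proof.
move=> H j; have := H j; case: (pile u j) => //= a s; rewrite rcons_path.
by case/andP.
Qed.

Lemma cyc_reduced_rot x u : cyc_reduced (x :: u) -> cyc_reduced (rcons u x).
Proof.
move=> H j; have := H j; rewrite pile_cons pile_rcons.
by case: ifP => // _; rewrite -rot1_cons rot_cycle.
Qed.

Lemma cyc_reduced_rotr x u : cyc_reduced (rcons u x) -> cyc_reduced (x :: u).
Proof.
move=> H j; have := H j; rewrite pile_cons pile_rcons.
by case: ifP => // _; rewrite -rot1_cons rot_cycle.
Qed.

Lemma credP u : reduced u ->
  (forall l, head 0 (pile u l.1) = sgn l -> last 0 (pile u l.1) != 3 - sgn l) ->
  cyc_reduced u.
Proof.
move=> ru H j; have := ru j; have := pile_le2 dep u j.
have := fun b => H (j, b); rewrite /=.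
case E: (pile u j) => [|a s] //= Hb s2 ps.
rewrite -[_ && _]/(all (fun a => a <= 2) (a :: s)) in s2.
rewrite rcons_path ps /= /good.
have l2 : last a s <= 2 by move/allP: s2; apply; apply: mem_last.
have a2 : a <= 2 by case/andP: s2.
have := Hb false; have := Hb true; rewrite /sgn /= => H1 H2.
apply/eqP => E3; case: a a2 {E Hb ps s2} H1 H2 l2 E3 => [|[|[|//]]] _ H1 H2 l2 E3; lia.
Qed.

Lemma cyc_reduced_head_last u l : cyc_reduced u -> head 0 (pile u l.1) = sgn l ->
  last 0 (pile u l.1) != 3 - sgn l.
Proof.
have sl := sgn_le l.
move/(_ l.1); case: (pile _ _) => [|a s] //=.
rewrite rcons_path => /andP[_]; rewrite /good => /eqP H ?.
by apply/eqP; lia.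
Qed.

(* Right multiplication by [l], on pilings of reduced words. *)
Definition pile_act l p j :=
  if last 0 (p l.1) == 3 - sgn l then
    if dep j l.1 then droplast (p j) else p j
  else if dep j l.1 then rcons (p j) (entry j l) else p j.

Lemma eq_pile_act l p q : p =1 q -> pile_act l p =1 pile_act l q.
Proof. by move=> pq j; rewrite /pile_act !pq. Qed.

Lemma pile_act_pop l u p : p =1 pile (rcons u (inv l)) -> pile_act l p =1 pile u.
Proof.
move=> E j; rewrite /pile_act !E !pile_rcons dep_refl /= last_rcons /entry /= eqxx sgn_inv eqxx.
by case: (dep _ _); rewrite ?droplast_rcons.
Qed.

Lemma pile_act_push l u p : p =1 pile u -> last 0 (pile u l.1) != 3 - sgn l ->
  pile_act l p =1 pile (rcons u l).
Proof. by move=> E /negPf H j; rewrite /pile_act !E H pile_rcons. Qed.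

Lemma pactP l u : reduced u -> exists v, [/\ reduced v, (pile_act l (pile u) =1 pile v)
  & (trace_eq u (rcons v (inv l)) \/ v = rcons u l)].
Proof.
move=> ru; case: (last 0 (pile u l.1) =P 3 - sgn l) => [E|/eqP ne].
  move: E; rewrite -sgn_inv => /(@last_pile _ _ dep_refl dep_sym (inv l)) [v uv].
  exists v; split; last by left.
    by have /reduced_rcons [] := reduced_trace_eq uv ru.
  by apply: pile_act_pop; apply: trace_eq_pile.
exists (rcons u l); split; last by right.
  exact/reduced_rcons.
exact: pile_act_push.
Qed.

Definition pile_acts p w := foldl (fun p l => pile_act l p) p w.

Lemma eq_pile_acts w p q : p =1 q -> pile_acts p w =1 pile_acts q w.
Proof. by elim: w p q => //= l w IHw p q pq; apply: IHw; apply: eq_pile_act. Qed.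

Lemma pile_acts_cat p u v : pile_acts p (u ++ v) = pile_acts (pile_acts p u) v.
Proof. exact: foldl_cat. Qed.

(** The domain of the action. On an arbitrary family of sequences a pop may remove entries that the
    inverse push does not restore. *)
Definition valid p := exists2 u, reduced u & p =1 pile u.

Lemma valid_pile_act l p : valid p -> valid (pile_act l p).
Proof.
move=> [u ru pu]; have [v [rv pv _]] := pactP l ru.
by exists v => // j; rewrite (eq_pile_act l pu) pv.
Qed.

Lemma valid_pile_acts w p : valid p -> valid (pile_acts p w).
Proof. by elim: w p => //= l w IHw p /(valid_pile_act l); apply: IHw. Qed.

Lemma inv_inv l : inv (inv l) = l. Proof. exact: letter_invK. Qed.

Lemma pile_act_inv l p : valid p -> pile_act (inv l) (pile_act l p) =1 p.
Proof.
move=> [u ru pu] j; rewrite pu.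
have [v [rv pv H]] := pactP l ru.
rewrite (eq_pile_act (inv l) (eq_pile_act l pu)) (eq_pile_act _ pv).
case: H => [uv|->]; last by rewrite (@pile_act_pop (inv l) u) ?inv_inv.
rewrite (trace_eq_pile dep_sym uv); apply: pile_act_push => //.
by have /reduced_rcons [] := reduced_trace_eq uv ru.
Qed.

Lemma last_rcons_indep u x y : ~~ dep x.1 y.1 ->
  last 0 (pile (rcons u x) y.1) = last 0 (pile u y.1).
Proof. by move=> nd; rewrite pile_rcons dep_sym (negPf nd). Qed.

Lemma trace_eq_rcons2 u x y : ~~ dep x.1 y.1 ->
  trace_eq (rcons (rcons u x) y) (rcons (rcons u y) x).
Proof.
move=> nd; have R2 a b : rcons (rcons u a) b = u ++ [:: a; b] by rewrite -!cats1 -catA.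
by rewrite !R2; apply: TeqSwap.
Qed.

Lemma pile_act_comm_aux l m u : reduced u -> ~~ dep l.1 m.1 ->
  exists w, pile_act m (pile_act l (pile u)) =1 pile w /\ pile_act l (pile_act m (pile u)) =1 pile w.
Proof.
move=> ru nd; have nd' : ~~ dep m.1 l.1 by rewrite dep_sym.
have [v [rv pv Hv]] := pactP l ru; have [w [rw pw Hw]] := pactP m ru.
case: Hv => [uv|Ev]; case: Hw => [uw|Ew].
(* Both letters cancel. As [inv l] and [inv m] are independent, [inv m] is still at the end of [v]
   after [inv l] has gone; removing both leaves the common word [t]. *)
- have : last 0 (pile v (inv m).1) = sgn (inv m).
    rewrite /= -(@last_rcons_indep v (inv l) m) // -(trace_eq_pile dep_sym uv).
    by rewrite (trace_eq_pile dep_sym uw) pile_rcons dep_refl last_rcons /entry /= eqxx.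
  move/(last_pile dep_refl dep_sym) => [t vt]; exists t.
  have lt : pile_act m (pile_act l (pile u)) =1 pile t.
    by move=> j; rewrite (eq_pile_act m pv) (eq_pile_act m (trace_eq_pile dep_sym vt)) (@pile_act_pop m t).
  split=> // j; rewrite (eq_pile_act l pw).
  have wt : trace_eq w (rcons t (inv l)).
    have: trace_eq (rcons w (inv m)) (rcons (rcons t (inv l)) (inv m)).
      apply: TeqTrans (trace_eq_sym dep_sym uw) _; apply: TeqTrans uv _.
      apply: TeqTrans (trace_eq_rcons _ vt) _.
      exact: trace_eq_rcons2.
    move/(trace_eq_rev dep_refl dep_sym); rewrite rev_rcons rev_rcons.
    by move=> /(trace_eq_consK dep_refl dep_sym) /(trace_eq_rev dep_refl dep_sym); rewrite !revK.
  by rewrite (eq_pile_act l (trace_eq_pile dep_sym wt)) (@pile_act_pop l t).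
- exists (rcons v m); split=> j.
    rewrite (eq_pile_act m pv); apply: pile_act_push => //.
    rewrite -(@last_rcons_indep v (inv l) m) // -(trace_eq_pile dep_sym uv).
    by rewrite Ew in rw; case/reduced_rcons: rw.
  rewrite (eq_pile_act l pw) Ew; apply: pile_act_pop => i.
  rewrite (trace_eq_pile dep_sym (trace_eq_rcons m uv)).
  by apply: trace_eq_pile => //; apply: trace_eq_rcons2.
- exists (rcons w l); split=> j; last first.
    rewrite (eq_pile_act l pw); apply: pile_act_push => //.
    rewrite -(@last_rcons_indep w (inv m) l) // -(trace_eq_pile dep_sym uw).
    by rewrite Ev in rv; case/reduced_rcons: rv.
  rewrite (eq_pile_act m pv) Ev; apply: pile_act_pop => i.
  rewrite (trace_eq_pile dep_sym (trace_eq_rcons l uw)).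
  by apply: trace_eq_pile => //; apply: trace_eq_rcons2.
- subst v w; exists (rcons (rcons u l) m).
  case/reduced_rcons: rv => _ lv; case/reduced_rcons: rw => _ lw.
  split=> j.
    by rewrite (eq_pile_act m pv); apply: pile_act_push; rewrite ?last_rcons_indep.
  rewrite (eq_pile_act l pw) (@pile_act_push l (rcons u m)) ?last_rcons_indep //.
  by apply: trace_eq_pile => //; apply: trace_eq_rcons2.
Qed.

Lemma pile_act_comm l m p : valid p -> ~~ dep l.1 m.1 ->
  pile_act m (pile_act l p) =1 pile_act l (pile_act m p).
Proof.
move=> [u ru pu] nd j; have [w [E1 E2]] := pile_act_comm_aux ru nd.
by rewrite (eq_pile_act m (eq_pile_act l pu)) (eq_pile_act l (eq_pile_act m pu)) E1 E2.
Qed.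

Lemma pile_acts_reduced u : reduced u -> pile_acts (pile [::]) u =1 pile u.
Proof.
elim/last_ind: u => // u l IHu /reduced_rcons [/IHu E H] j.
by rewrite -cats1 pile_acts_cat /= cats1 (eq_pile_act l E); apply: pile_act_push.
Qed.

Lemma valid_nil : valid (pile [::]).
Proof. by exists [::]. Qed.

Definition entry_inv a := if a == 0 then 0 else 3 - a.

Lemma pile_inv u j : pile (word_inv u) j = rev (map entry_inv (pile u j)).
Proof.
rewrite /word_inv pile_rev; congr rev.
elim: u => // x u IHu; rewrite map_cons !pile_cons IHu /=.
case: ifP => //= _; congr (_ :: _); rewrite /entry_inv /entry /=; case: eqP => //= _.
exact: sgn_inv.
Qed.

(* If the conjugator [g] shares no letter with [u], at either end of [u] or by
   commuting with all of [u], then nothing cancels in [g^-1 u g]; that word is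
   not cyclically reduced. *)
Lemma reduced_conj u g : cyc_reduced u -> reduced g ->
  (forall x, avail dep x g -> [/\ ~~ avail dep x u,
      last 0 (pile u x.1) != 3 - sgn x & ~~ indep dep x u]) ->
  reduced (word_inv g ++ u ++ g).
Proof.
move=> cu rg H j; rewrite !pile_cat pile_inv.
have hg := fun b => H (j, b).
have ep (s : seq nat) : last 0 (rev (map entry_inv s)) = entry_inv (head 0 s).
  by case: s => // a s; rewrite map_cons rev_cons last_rcons.
have sg : sorted good (rev (map entry_inv (pile g j))).
  rewrite rev_sorted sorted_map; have := rg j; have := pile_le2 dep g j.
  move: (pile g j) => s s2 ss; move: ss.
  rewrite (@eq_in_sorted _ [pred a | a <= 2] good (relpre entry_inv (fun z => good^~ z))) //.
  move=> a b; rewrite !inE /good /entry_inv /=.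
  by case: a b => [|[|[|//]]] [|[|[|//]]].
have hgl : head 0 (pile g j) != 0 -> exists b, head 0 (pile g j) = sgn (j, b).
  have := pile_le2 dep g j; case: (pile g j) => [|a s] //= /andP[a2 _].
  case: a a2 => [|[|[|//]]] // _ _; by [exists false | exists true].
(* With an empty pile of [u] the piles of [g^-1] and [g] meet directly. A letter of [j] at the head
   of the latter would be a first letter of [g] that commutes with [u], which [H] excludes. *)
case Eu : (pile u j) => [|a s].
  apply: sorted_good_cat; [exact: sg|exact: rg|rewrite ep /=].
  case h0: (head 0 (pile g j) == 0); first by rewrite (eqP h0).
  have [b E] := hgl (negbT h0); have /eqP A := E.
  have [_ _] := hg b A; rewrite /indep /=.
  by have /pile_nil -> := Eu.
rewrite -Eu.
have cj := cu j.
have su : sorted good (pile u j) := cyc_reduced_reduced cu j.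
(* A head 0, or the default 0 of an empty pile, cannot complete a sum of 3 with an entry that is at
   most 2. *)
case h0: (head 0 (pile g j) == 0).
  apply: sorted_good_cat; first exact: sg.
    apply: sorted_good_cat; [exact: su|exact: rg|].
    rewrite (eqP h0) addn0; have /allP := pile_le2 dep u j.
    by rewrite Eu /= => L; have := L _ (mem_last a s) => /=; lia.
  rewrite ep (eqP h0) /= Eu /=; have := pile_le2 dep u j; rewrite Eu /= => /andP[a2 _].
  by rewrite /entry_inv /=; apply/eqP; lia.
have [b E] := hgl (negbT h0); have /eqP A := E.
have sb := sgn_le (j, b).
have [h1 h2 _] := hg b A; move: h1 h2; rewrite /avail /= => h1 h2.
apply: sorted_good_cat; first exact: sg.
  apply: sorted_good_cat; [exact: su|exact: rg|].
  by rewrite E; move/eqP: h2 => h2; apply/eqP; lia.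
rewrite ep E /entry_inv; have -> : (sgn (j, b) == 0) = false by [].
rewrite Eu in h1 *; move/eqP: h1 => /= h1; rewrite /=; apply/eqP; lia.
Qed.

End Reduced.

(** * Conjugacy in right-angled Artin groups *)

Section RaagConj.
Variables (N : nat) (C : seq ('I_N * 'I_N)).
Implicit Types (x y l : letter N) (u v w r t g : word N) (i j : 'I_N).

(** [C] is not assumed symmetric, and a pair [(i, i)] in it must not make a letter independent of
    itself. *)
Definition raag_dep i j := (i == j) || ((i, j) \notin C) && ((j, i) \notin C).

Lemma raag_dep_refl : reflexive raag_dep.
Proof. by move=> i; rewrite /raag_dep eqxx. Qed.

Lemma raag_dep_sym : symmetric raag_dep.
Proof. by move=> i j; rewrite /raag_dep eq_sym andbC. Qed.

Let dep_refl := raag_dep_refl.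
Let dep_sym := raag_dep_sym.
Notation dep := raag_dep.
Notation pile := (pile dep).
Notation trace_eq := (trace_eq dep).
Notation trace_conj := (trace_conj dep).
Notation reduced := (reduced dep).
Notation cyc_reduced := (cyc_reduced dep).
Notation inv := (@letter_inv N).
Notation elt := (elt_of (commutation_relations C)).

Lemma elt_cat u v : elt (u ++ v) = (elt u * elt v)%g.
Proof. by symmetry; apply: pres_mulE. Qed.

Lemma elt_inv u : elt (word_inv u) = ((elt u)^-1)%g.
Proof. by symmetry; apply: pres_invE. Qed.

Lemma elt_rcons u x : elt (rcons u x) = (elt u * elt [:: x])%g.
Proof. by rewrite -cats1 elt_cat. Qed.

Lemma elt_cons u x : elt (x :: u) = (elt [:: x] * elt u)%g.
Proof. by rewrite -cat1s elt_cat. Qed.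

Lemma elt_letter_inv x : elt [:: inv x] = ((elt [:: x])^-1)%g.
Proof. by rewrite -elt_inv. Qed.

Lemma commute_letters x y : ~~ dep x.1 y.1 -> commute (elt [:: x]) (elt [:: y]).
Proof.
have pos i j : ~~ dep i j -> commute (elt [:: (i, false)]) (elt [:: (j, false)]).
  rewrite /raag_dep negb_or negb_and !negbK => /andP[_ H].
  rewrite /commute -!elt_cat; apply/elt_ofP; case/orP: H => H.
    exact: (@PresRel _ (commutation_relations C) (_, _) (map_f _ H)).
  apply: PresSym; exact: (@PresRel _ (commutation_relations C) (_, _) (map_f _ H)).
have sgl (z : letter N) : elt [:: z] = if z.2 then ((elt [:: (z.1, false)])^-1)%g
                        else elt [:: (z.1, false)].
  by case: z => i []; rewrite //= -elt_letter_inv.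
move/pos=> H; rewrite (sgl x) (sgl y).
case: x.2; case: y.2 => //.
- exact/commuteV/commute_sym/commuteV/commute_sym.
- exact/commute_sym/commuteV/commute_sym.
- exact/commuteV.
Qed.

Lemma elt_trace_eq u v : trace_eq u v -> elt u = elt v.
Proof.
elim=> {u v} [u|u x y v /commute_letters c|u v w _ -> _ ->] //.
rewrite !elt_cat; congr (_ * _)%g.
by rewrite (elt_cons (y :: v)) (elt_cons v y) (elt_cons (x :: v)) (elt_cons v x) !mulgA c.
Qed.

(** The action on valid pilings respects every rule of [pres_eq], so it factors through the
    group. *)
Lemma pres_eq_pile_acts u v : pres_eq (commutation_relations C) u v ->
  forall p, valid dep p -> pile_acts dep p u =1 pile_acts dep p v.
Proof.
elim=> {u v} [u|u v _ IH|u v w _ IH1 _ IH2|u u' v v' _ IH1 _ IH2|x|r rC] p vp j //.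
- by rewrite IH.
- by rewrite IH1 ?IH2.
- rewrite !pile_acts_cat (eq_pile_acts _ _ (IH1 p vp)) IH2 //.
  exact: valid_pile_acts.
- exact: pile_act_inv.
case/mapP: rC => -[a b] ab -> /=.
case: (eqVneq a b) => [->|ne] //; apply: pile_act_comm => //=.
by rewrite /raag_dep (negPf ne) ab.
Qed.

(** A reduced word, acting on the empty piling, produces its own piling, and pilings determine
    traces. *)
Lemma reduced_elt_trace_eq u v : reduced u -> reduced v -> elt u = elt v -> trace_eq u v.
Proof.
move=> ru rv /elt_ofP/pres_eq_pile_acts/(_ _ (valid_nil dep)) E.
apply: pile_trace_eq => // j.
by rewrite -(pile_acts_reduced dep_refl ru) -(pile_acts_reduced dep_refl rv).
Qed.

Lemma pile_act_elt l u : reduced u -> exists v,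
  [/\ reduced v, pile_act dep l (pile u) =1 pile v & elt v = (elt u * elt [:: l])%g].
Proof.
move=> /(pactP dep_refl dep_sym l) [v [rv pv H]]; exists v; split=> //.
case: H => [/elt_trace_eq ->|->]; last by rewrite elt_rcons.
by rewrite elt_rcons elt_letter_inv mulgVK.
Qed.

Lemma pile_acts_elt w : exists v, [/\ reduced v, pile_acts dep (pile [::]) w =1 pile v & elt v = elt w].
Proof.
elim/last_ind: w => [|w l [v [rv pv eval]]]; first by exists [::].
have [t [rt pt et]] := pile_act_elt l rv; exists t; split=> //; last by rewrite et eval elt_rcons.
by move=> j; rewrite -cats1 pile_acts_cat /= (eq_pile_act _ _ pv) pt.
Qed.

Lemma conjugate_refl (G : groupType) (x : G) : conjugate x x.
Proof. by exists 1%g; rewrite conjg1. Qed.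

Lemma conjugate_sym (G : groupType) (x y : G) : conjugate x y -> conjugate y x.
Proof. by case=> g <-; exists (g^-1)%g; rewrite conjgK. Qed.

Lemma conjugate_trans (G : groupType) (y x z : G) :
  conjugate x y -> conjugate y z -> conjugate x z.
Proof. by case=> g <- [h <-]; exists (g * h)%g; rewrite conjgM. Qed.

Lemma trace_conj_conjugate u v : trace_conj u v -> conjugate (elt u) (elt v).
Proof.
elim=> {u v} [u v /elt_trace_eq ->|x u|u v _|u v w _ uv _ vw].
- exact: conjugate_refl.
- by exists (elt [:: x]); rewrite elt_cons elt_rcons /conjg mulgA mulKg.
- exact: conjugate_sym.
- exact: conjugate_trans uv vw.
Qed.

Lemma trace_conj_cyc_reduced u v : trace_conj u v -> cyc_reduced u -> cyc_reduced v.
Proof.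
suff: trace_conj u v -> (cyc_reduced u <-> cyc_reduced v) by move=> H /H [].
elim=> {u v} [u v E|x u|u v _ ->|u v w _ -> _ ->] //.
  by split; apply: cyc_reduced_trace_eq => //; apply: trace_eq_sym.
by split; [apply: cyc_reduced_rot|apply: cyc_reduced_rotr].
Qed.

Lemma conjugate_trace_conj u v : cyc_reduced u -> cyc_reduced v -> conjugate (elt u) (elt v) -> trace_conj u v.
Proof.
move=> cu cv [g0]; elim/elt_of_ind: g0 => w.
have [g [rg _ <-]] := pile_acts_elt w.
have [n] := ubnP (size g); elim: n => // n IHn in u g cu rg *.
case: (boolP (nilp g)) => [/nilP -> _|gn sg E].
  rewrite conjg1 => uv; apply: TconjTeq; apply: reduced_elt_trace_eq => //; exact: cyc_reduced_reduced.
case: (boolP [exists x : 'I_N * bool, avail dep x g &&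
   [|| avail dep x u, last 0 (pile u x.1) == 3 - sgn x | indep dep x u]]).
  case/existsP=> x /andP[xg H].
  have eg := avail_rem dep_refl dep_sym xg.
  (* The letter [x] is peeled off [g]: once conjugation by [x] alone is seen to be a conjugacy of
     traces, the shorter conjugator [rem x g] is left to the induction. *)
  suff [u' [uu' E']] : exists u', trace_conj u u' /\ (elt u ^ elt [:: x])%g = elt u'.
    apply: TconjTrans (uu') _; apply: (IHn u' (rem (x : letter N) g)).
    - exact: trace_conj_cyc_reduced uu' cu.
    - exact: reduced_behead (reduced_trace_eq dep_sym eg rg).
    - have := avail_mem xg; move=> /size_rem ->; move: sg gn; case: (g) => //=.
    - by rewrite -E' -conjgM -elt_cons -(elt_trace_eq eg).
  case/or3P: H => [xu|/eqP xu|xu].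
  - exists (rotate_to_end x u); split; first exact: trace_conj_rotate_to_end.
    rewrite (elt_trace_eq (avail_rem dep_refl dep_sym xu)) elt_cons elt_rcons.
    by rewrite /conjg mulgA mulKg.
  - have [u' uu'] : exists u', trace_eq u (rcons u' (inv x)).
      by apply: last_pile => //; rewrite /= xu sgn_inv.
    exists (inv x :: u'); split.
      exact: TconjTrans (TconjTeq uu') (TconjSym (TconjRot _ _ _)).
    rewrite (elt_trace_eq uu') elt_cons elt_rcons elt_letter_inv /conjg.
    by rewrite mulgVK.
  - exists u; split; first exact: trace_conj_refl.
    by rewrite /conjg -elt_rcons -(elt_trace_eq (trace_eq_indep xu)) elt_cons mulKg.
move=> /existsPn H; exfalso.
have rr : reduced (word_inv g ++ u ++ g).
  apply: reduced_conj => // x xg; have := H x; rewrite xg /= !negb_or => /and3P[? ? ?].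
  by split.
have : trace_eq (word_inv g ++ u ++ g) v.
  apply: reduced_elt_trace_eq => //; first exact: cyc_reduced_reduced.
  by rewrite -E !elt_cat elt_inv.
move=> T; have {T} := cyc_reduced_trace_eq dep_sym (trace_eq_sym dep_sym T) cv.
(* [g^-1 u g] is the same trace as [v], hence cyclically reduced. But it begins with the inverse of
   the last letter [y] of [g] and ends with [y]. *)
case/lastP: g gn {sg E rg H rr} => // g y _ H.
have := @cyc_reduced_head_last _ _ _ (inv y) H; rewrite /= sgn_inv.
have -> : word_inv (rcons g y) ++ u ++ rcons g y = inv y :: rcons (word_inv g ++ u ++ g) y.
  by rewrite /word_inv map_rcons rev_rcons /= -!rcons_cat.
rewrite pile_cons dep_refl pile_rcons dep_refl /= last_rcons entry_id /entry /= eqxx sgn_inv.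
have := sgn_le y => sy /(_ erefl) /eqP; lia.
Qed.

Lemma cyclic_step u l : reduced u -> head 0 (pile u l.1) = sgn l ->
  last 0 (pile u l.1) = 3 - sgn l ->
  exists v, [/\ reduced v, conjugate (elt u) (elt v), size u = (size v).+2 &
    forall j, pile u j = if dep j l.1 then entry j l :: rcons (pile v j) (entry j (inv l))
                         else pile v j].
Proof.
move=> ru /(head_pile dep_refl dep_sym) [t ut] ll.
have sl := sgn_le l.
(* The two ends are different occurrences: an empty pile of [t] would give [sgn l = 3 - sgn l]. *)
have : last 0 (pile t (inv l).1) = sgn (inv l).
  move: ll; rewrite (trace_eq_pile dep_sym ut) pile_cons dep_refl entry_id sgn_inv /=.
  by case: (pile t l.1) => //=; lia.
move/(last_pile dep_refl dep_sym) => [v tv]; exists v.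
have uv := TeqTrans ut (trace_eq_cons l tv).
have rv : reduced v.
  by have /reduced_rcons [] := reduced_behead (reduced_trace_eq dep_sym uv ru).
split=> //.
- exists (elt [:: l]); rewrite (elt_trace_eq uv) elt_cons elt_rcons elt_letter_inv.
  by rewrite /conjg mulgA mulKg mulgVK.
- by rewrite (trace_eq_size uv) /= size_rcons.
- move=> j; rewrite (trace_eq_pile dep_sym uv) pile_cons pile_rcons /=.
  by case: (dep j l.1).
Qed.

End RaagConj.

(** * Greedy rotation of a connected trace *)

(* [s] is an enumeration of a connected set in which every element depends on
   an earlier one. *)
Definition connected N (dep : rel 'I_N) (s : seq 'I_N) : bool :=
  if s is a :: bs then
    uniq s && all (fun k => has (dep (nth a s k)) (take k s)) (iota 1 (size bs))
  else false.

Definition spans N (s : seq 'I_N) (u : word N) : bool :=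
  all (fun x : letter N => x.1 \in s) u && all (fun j => has (fun x : letter N => x.1 == j) u) s.

Section Greedy.
Variables (N : nat) (dep : rel 'I_N).
Hypotheses (dep_refl : reflexive dep) (dep_sym : symmetric dep).
Variables (a : 'I_N) (bs : seq 'I_N).
Hypothesis conn : connected dep (a :: bs).
Implicit Types (x y l : letter N) (u v w p q : word N).

Notation s := (a :: bs).
Notation pile := (pile dep).
Notation trace_eq := (trace_eq dep).
Notation trace_conj := (trace_conj dep).
Notation avail := (avail dep).
Notation spans := (spans s).

(** With [a] placed last, taking the first available letter picks an [a]-letter only if nothing else
    is available. *)
Definition greedy_order : seq (letter N) :=
  [seq ((j, b) : letter N) | j <- rcons bs a, b <- [:: false; true]].
Definition greedy_letter u : letter N := head ((a, false) : letter N) [seq l <- greedy_order | avail l u].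
Definition greedy_step u := rotate_to_end (greedy_letter u) u.
Definition greedy_output k u := greedy_letter (iter k greedy_step u).
Definition greedy_outputs k u := mkseq (fun i => greedy_output i u) k.

Lemma mem_greedy_order l : (l \in greedy_order) = (l.1 \in s).
Proof.
case: l => i b; rewrite /= -(mem_rcons bs a); apply/allpairsP/idP => [[[j c] /= [+ _]]|i_s].
  by move=> js [-> _].
by exists (i, b); split=> //; case: b; rewrite !inE.
Qed.

Lemma greedy_order_cat : greedy_order =
  [seq ((j, b) : letter N) | j <- bs, b <- [:: false; true]] ++ [:: (a, false); (a, true)].
Proof. by rewrite /greedy_order -cats1 allpairs_cat. Qed.

Lemma spans_perm u v : perm_eq u v -> spans u -> spans v.
Proof.
move=> uv /andP[H1 H2]; apply/andP; split; first by rewrite -(perm_all _ uv).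
apply/allP=> j /(allP H2); by rewrite (perm_has _ uv).
Qed.

Lemma spans_in u x : spans u -> x \in u -> x.1 \in s.
Proof. by case/andP=> /allP H _ /H. Qed.

Lemma spans_has u j : spans u -> j \in s -> exists2 x, x \in u & x.1 = j.
Proof. by case/andP=> _ /allP H /H /hasP [x xu /eqP]; exists x. Qed.

Lemma spans_neq0 u : spans u -> 0 < size u.
Proof. by case/spans_has/(_ (mem_head a bs)) => x; case: u. Qed.

Lemma gselP u : spans u -> avail (greedy_letter u) u /\
  ((greedy_letter u).1 = a -> forall l, avail l u -> l.1 = a).
Proof.
move=> su; have: has (fun l => avail l u) greedy_order.
  case: u su => [/spans_neq0//|x u] su; apply/hasP; exists x; last exact: avail_cons.
  by rewrite mem_greedy_order (spans_in su) ?mem_head.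
rewrite /greedy_letter; set A := fun l => avail l u.
move=> hA; split.
  have : head (a, false) (filter A greedy_order) \in filter A greedy_order.
    by move: hA; rewrite has_filter; case: (filter _ _) => // l t _; rewrite mem_head.
  by rewrite mem_filter => /andP[].
have /andP[/andP[abs _] _] := conn.
rewrite greedy_order_cat filter_cat => E l; rewrite -[avail l u]/(A l) => Al.
have : l \in greedy_order by rewrite mem_greedy_order; apply: spans_in su (avail_mem (Al : avail l u)).
rewrite greedy_order_cat mem_cat => /orP[lb|]; last by rewrite !inE => /orP[] /eqP ->.
have lf : l \in filter A [seq ((j, b) : letter N) | j <- bs, b <- [:: false; true]].
  by rewrite mem_filter lb andbT.
move: E lf; case Ef: (filter A _) => [|m t] //= ma _.
have: m \in filter A [seq ((j, b) : letter N) | j <- bs, b <- [:: false; true]].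
  by rewrite Ef mem_head.
rewrite mem_filter => /andP[_ /allpairsP[[j b] /= [jb _ mE]]].
by move: ma abs; rewrite mE /= => <-; rewrite jb.
Qed.

Lemma greedy_letter_trace_eq u v : trace_eq u v -> greedy_letter u = greedy_letter v.
Proof.
by move=> uv; rewrite /greedy_letter; under eq_filter => l do rewrite (avail_trace_eq dep_sym _ uv).
Qed.

Lemma greedy_letter_avail u : spans u -> avail (greedy_letter u) u.
Proof. by case/gselP. Qed.

Lemma greedy_step_trace_eq u v : spans u -> trace_eq u v -> trace_eq (greedy_step u) (greedy_step v).
Proof.
move=> su uv; rewrite /greedy_step -(greedy_letter_trace_eq uv).
by apply: trace_eq_rotate_to_end => //; apply: greedy_letter_avail.
Qed.

Lemma trace_conj_spans u v : trace_conj u v -> spans u -> spans v.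
Proof. by move/trace_conj_perm; apply: spans_perm. Qed.

Lemma spans_rotate_to_end l u : avail l u -> spans u -> spans (rotate_to_end l u).
Proof. by move=> /(trace_conj_rotate_to_end dep_refl dep_sym)/trace_conj_spans. Qed.

Lemma greedy_step_trace_conj u : spans u -> trace_conj u (greedy_step u).
Proof. by move=> su; apply: trace_conj_rotate_to_end => //; apply: greedy_letter_avail. Qed.

Lemma iter_greedy_step_trace_conj k u : spans u -> trace_conj u (iter k greedy_step u).
Proof.
move=> su; elim: k => [|k IHk]; first exact: trace_conj_refl.
by apply: TconjTrans (IHk) (greedy_step_trace_conj _); apply: trace_conj_spans IHk su.
Qed.

Lemma iter_greedy_step_spans k u : spans u -> spans (iter k greedy_step u).
Proof. by move=> su; apply: trace_conj_spans (iter_greedy_step_trace_conj k su) su. Qed.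

Lemma iter_greedy_step_trace_eq k u v : spans u -> trace_eq u v -> trace_eq (iter k greedy_step u) (iter k greedy_step v).
Proof.
move=> su uv; elim: k => //= k IHk; apply: greedy_step_trace_eq => //.
exact: iter_greedy_step_spans.
Qed.

Lemma greedy_outputs_rcons k u : greedy_outputs k.+1 u = rcons (greedy_outputs k u) (greedy_output k u).
Proof. exact: mkseqS. Qed.

Lemma greedy_outputs_cons k u : greedy_outputs k.+1 u = greedy_letter u :: greedy_outputs k (greedy_step u).
Proof.
rewrite /greedy_outputs /mkseq /= -[1]addn0 iotaDl -map_comp; congr (_ :: _).
by apply: eq_map => i /=; rewrite /greedy_output iterSr.
Qed.

(** Each single rotation satisfies [u l = l u'], and these identities are chained. Applied to powers
    of [u], they let the outputs be compared with prefixes of [u^omega]. *)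
Lemma greedy_outputs_swap k u : spans u ->
  trace_eq (u ++ greedy_outputs k u) (greedy_outputs k u ++ iter k greedy_step u).
Proof.
move=> su; elim: k => [|k IHk]; first by rewrite cats0; apply: TeqRefl.
rewrite greedy_outputs_rcons -cats1 catA; apply: TeqTrans (trace_eq_cat2r _ IHk) _.
rewrite -!catA; apply: trace_eq_cat2l; apply: rotate_to_end_swap => //.
exact/greedy_letter_avail/iter_greedy_step_spans.
Qed.

Lemma greedy_outputs_swap_pow k m u : spans u ->
  trace_eq (flatten (nseq m u) ++ greedy_outputs k u)
      (greedy_outputs k u ++ flatten (nseq m (iter k greedy_step u))).
Proof.
move=> su; elim: m => [|m IHm] /=; first by rewrite cats0; apply: TeqRefl.
rewrite -catA; apply: TeqTrans (trace_eq_cat2l _ IHm) _.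
rewrite !catA; exact/trace_eq_cat2r/greedy_outputs_swap.
Qed.

Notation count_gen j u := (count (fun x : letter N => x.1 == j) u).

Lemma count_gen_pow m u j : count_gen j (flatten (nseq m u)) = m * count_gen j u.
Proof. by elim: m => //= m IHm; rewrite count_cat IHm mulSn. Qed.

(* In the periodic trace [u^omega] the letters of [b] and [c] are linearly
   ordered, so a prefix with few [c]'s has few [b]'s. *)
Lemma count_gen_greedy_outputs_dep k m u b c : spans u -> dep b c -> c \in s ->
  count_gen c (greedy_outputs k u) <= m * count_gen c u -> count_gen b (greedy_outputs k u) <= m.+1 * count_gen b u.
Proof.
move=> su bc cs Hc; set X := greedy_outputs k u in Hc *.
pose P := [pred j | (j == b) || (j == c)].
have PP : {in P &, forall i j, dep i j}.
  by move=> i j; rewrite !inE => /orP[] /eqP -> /orP[] /eqP ->;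
    rewrite ?dep_refl ?bc // dep_sym.
have [U [R [cU E0]]] : exists U R : word N,
    (forall j, count_gen j U = m.+1 * count_gen j u) /\ trace_eq (U ++ X) (X ++ R).
  exists (flatten (nseq m.+1 u)), (flatten (nseq m.+1 (iter k greedy_step u))).
  by split=> [j|]; [apply: count_gen_pow|apply: greedy_outputs_swap_pow].
have := trace_eq_filter_dep PP E0; rewrite !filter_cat.
set fX := filter _ X; set fU := filter _ U => E.
have cf j w : P j -> count_gen j [seq x <- w | P x.1] = count_gen j w.
  move=> Pj; rewrite count_filter; apply: eq_count => x.
  by apply: andb_idr => /eqP ->.
have cb w : count_gen b [seq x <- w | P x.1] = count_gen b w by apply: cf; rewrite !inE eqxx.
have cc w : count_gen c [seq x <- w | P x.1] = count_gen c w by apply: cf; rewrite !inE eqxx orbT.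
have c0 : 0 < count_gen c u.
  by have [x xu xc] := spans_has su cs; rewrite -has_count; apply/hasP; exists x => //; apply/eqP.
(* By [E], [fX] and [fU] are prefixes of one word, so one is a prefix of the other. If [fU] were the
   shorter, [fX] would contain the letters of [c] of all [m.+1] periods, more than [Hc] allows. *)
have := cat_take_drop (size fX) fU.
case: (leqP (size fX) (size fU)) => sz.
  have -> : take (size fX) fU = fX.
    by have := congr1 (take (size fX)) E; rewrite takel_cat // => ->; rewrite take_size_cat.
  move=> /(congr1 (count (fun x : letter N => x.1 == b))); rewrite count_cat.
  by rewrite /fX /fU !cb cU => <-; apply: leq_addr.
have E' : fU = take (size fU) fX.
  by rewrite -[LHS](take_size_cat fX (erefl (size fU))) E takel_cat // ltnW.
move=> _; have := cat_take_drop (size fU) fX; rewrite -E'.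
move=> /(congr1 (count (fun x : letter N => x.1 == c))); rewrite count_cat.
rewrite /fX {2}/fU !cc cU => E2; exfalso.
by move: Hc c0; rewrite -E2 mulSn; lia.
Qed.

Lemma size_count_gen u : all (fun x : letter N => x.1 \in s) u -> size u = \sum_(j <- s) count_gen j u.
Proof.
have us : uniq s by case/andP: conn.
elim: u => [_|x u IHu /andP[xs /IHu /= ->]]; first by rewrite big1.
rewrite big_split /= -addn1 addnC; congr (_ + _).
rewrite (bigD1_seq _ xs us) /= eqxx big1_seq ?addn0 // => j /andP[jx _].
by rewrite eq_sym (negPf jx).
Qed.

(** Strong induction along the enumeration: the generator at place [r] depends on an earlier one and
    leads it by at most one period, while [a], at place 0, has not been output at all. *)
Lemma count_gen_greedy_outputs_bound k u r : spans u -> count_gen a (greedy_outputs k u) = 0 -> r < size s ->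
  count_gen (nth a s r) (greedy_outputs k u) <= r * count_gen (nth a s r) u.
Proof.
move=> su a0; have [n] := ubnP r; elim: n r => // n IHn [|r] rn rs; first by rewrite /= a0.
have /andP[_ /allP/(_ r.+1)] := conn.
rewrite mem_iota add1n => /(_ rs) /hasP[c].
rewrite -index_mem size_take rs => ic d.
have ci : index c (take r.+1 s) <= r by rewrite -ltnS.
have cE : nth a s (index c (take r.+1 s)) = c.
  rewrite -(@nth_take r.+1 _ a (index c (take r.+1 s))) // nth_index //.
  by rewrite -index_mem size_take rs.
have cs : c \in s by rewrite -cE mem_nth // (leq_trans ic) // ltnW.
apply: (count_gen_greedy_outputs_dep su d cs).
have := IHn (index c (take r.+1 s)); rewrite cE => H.
apply: leq_trans (H _ _) _.
- by rewrite (leq_trans ic).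
- by rewrite (leq_trans ic) // ltnW.
- by rewrite leq_mul2r ci orbT.
Qed.

Lemma greedy_outputs_noa_size k u : spans u -> count_gen a (greedy_outputs k u) = 0 -> k <= size bs * size u.
Proof.
move=> su a0.
have over : all (fun x : letter N => x.1 \in s) (greedy_outputs k u).
  apply/allP=> x /mapP[i _ ->]; apply: (@spans_in (iter i greedy_step u)).
    exact: iter_greedy_step_spans.
  exact/avail_mem/greedy_letter_avail/iter_greedy_step_spans.
have <- : size (greedy_outputs k u) = k by rewrite size_mkseq.
rewrite (size_count_gen over) (size_count_gen (andP su).1) big_distrr /=.
rewrite !(big_nth a) !big_mkord; apply: leq_sum => r _.
apply: leq_trans (count_gen_greedy_outputs_bound su a0 (ltn_ord r)) _.
by rewrite leq_mul2r -ltnS (ltn_ord r) orbT.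
Qed.

(** * Pyramids and periodicity of the greedy rotation *)

Definition pyramid u := forall l, avail l u -> l.1 = a.

Lemma size_s_le : size s <= N.
Proof.
have us : uniq s by case/andP: conn.
by rewrite -(card_uniqP us) (leq_trans (max_card _)) ?card_ord.
Qed.

(** Outputs without an [a]-letter number at most [size bs * size u], and [size bs] is less than [N].
    When the first [a]-letter is chosen, the greedy rule certifies a pyramid. *)
Lemma pyramid_reached u : spans u -> exists2 k, k < N * size u &
  pyramid (iter k greedy_step u) /\ forall i, i < k -> (greedy_output i u).1 != a.
Proof.
move=> su; have [k]: exists k, (greedy_output k u).1 == a /\ k < N * size u.
  pose K := N * size u; case: (boolP (has (fun l : letter N => l.1 == a) (greedy_outputs K u))).
    case/hasP=> l /mapP[i]; rewrite mem_iota add0n => /andP[_ iK] -> E.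
    by exists i.
  rewrite has_count -eqn0Ngt => /eqP /(greedy_outputs_noa_size su).
  rewrite /K leq_mul2r => H; exfalso.
  have := spans_neq0 su; have := size_s_le; move: H => /= /orP[/eqP ->|] //; lia.
move=> [E kK]; have expr : exists k, (greedy_output k u).1 == a by exists k.
have [m mE mm] := ex_minnP expr; exists m; first exact: leq_ltn_trans (mm _ E) kK.
split=> [l|i im].
  have [_ H] := gselP (iter_greedy_step_spans m su); apply: H; exact/eqP.
by apply/negP=> /mm; rewrite leqNgt im.
Qed.

(* Greedy rotation from a pyramid exhausts one full period before touching the
   next: the next period lies above its own first [a]-letter, and [a]-letters
   are moved only when nothing else is available. *)
Lemma pyramid_prefix p k : spans p -> pyramid p -> k <= size p ->
  exists r, trace_eq p (greedy_outputs k p ++ r).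
Proof.
move=> sp pyr; elim: k => [_|k IHk kp]; first by exists p; apply: TeqRefl.
have [r E] := IHk (ltnW kp); set X := greedy_outputs k p in E.
have sw := greedy_outputs_swap k sp; rewrite -/X in sw.
have stE : trace_eq (iter k greedy_step p) (r ++ X).
  apply: (@trace_eq_catK _ _ dep_refl dep_sym X); apply: TeqTrans (trace_eq_sym dep_sym sw) _.
  by rewrite catA; apply: trace_eq_cat2r.
have sst : spans (iter k greedy_step p) by apply: iter_greedy_step_spans.
have r0 : 0 < size r by have := trace_eq_size E; rewrite size_cat size_mkseq; lia.
set l := greedy_letter (iter k greedy_step p).
have [al la] := gselP sst; rewrite -/l in al la.
suff rl : avail l r.
  exists (rem l r); rewrite greedy_outputs_rcons -/X cat_rcons; apply: TeqTrans E _.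
  exact/trace_eq_cat2l/avail_rem.
have := al; rewrite (avail_trace_eq dep_sym _ stE) {1}/avail pile_cat.
case Er: (pile r l.1) => [|c t] /=; last by move=> /= H; rewrite /avail Er.
(* [r] contributes nothing to this pile, so the entry of [l] stems from [X]; hence [l] is available
   in the pyramid [p] and is an [a]-letter. Then only [a]-letters are available, among them the
   first letter of [r], against the empty pile. *)
move=> H; have pl : l.1 = a.
  apply: pyr; rewrite (avail_trace_eq dep_sym _ E) /avail pile_cat.
  by case: (pile X l.1) H.
case: (r) r0 Er stE => // y r' _ Er stE; exfalso.
have ya : y.1 = a by apply: la => //; rewrite (avail_trace_eq dep_sym _ stE); apply: avail_cons.
by have /pile_nil/andP[] := Er; rewrite pl ya dep_refl.
Qed.

Definition periodic u := trace_eq (greedy_outputs (size u) u) u /\ trace_eq (iter (size u) greedy_step u) u.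

Lemma pyramid_periodic p : spans p -> pyramid p -> periodic p.
Proof.
move=> sp pyr; have [r E] := pyramid_prefix sp pyr (leqnn _).
have r0 : r = [::].
  by have := trace_eq_size E; rewrite size_cat size_mkseq -{1}[size p]addn0 => /addnI; case: (r).
rewrite r0 cats0 in E; split; first exact: trace_eq_sym.
apply: (@trace_eq_catK _ _ dep_refl dep_sym p).
apply: TeqTrans (trace_eq_cat2r _ E) _.
apply: TeqTrans (trace_eq_sym dep_sym (greedy_outputs_swap _ sp)) _.
exact/trace_eq_cat2l/trace_eq_sym.
Qed.

Lemma size_greedy_step u : spans u -> size (greedy_step u) = size u.
Proof. by move/greedy_step_trace_conj/trace_conj_perm/perm_size. Qed.

Lemma size_iter_greedy_step k u : spans u -> size (iter k greedy_step u) = size u.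
Proof. by move/(iter_greedy_step_trace_conj k)/trace_conj_perm/perm_size. Qed.

(** The window of outputs moves by one: its first letter drops out and, the state having returned
    after a period, reappears at the end. That is the rotation performed on [p]. *)
Lemma periodic_greedy_step p : spans p -> periodic p -> periodic (greedy_step p).
Proof.
move=> sp [E1 E2]; rewrite /periodic size_greedy_step //; split; last first.
  rewrite -iterSr iterS; apply: greedy_step_trace_eq => //; exact: iter_greedy_step_spans.
have : greedy_outputs (size p).+1 p = rcons (greedy_outputs (size p) p) (greedy_letter p).
  by rewrite greedy_outputs_rcons /greedy_output (greedy_letter_trace_eq E2).
rewrite greedy_outputs_cons; have := spans_neq0 sp.
case: (size p) E1 => // n; rewrite !greedy_outputs_cons => E1 _ [->].
apply: trace_eq_sym => //; rewrite /greedy_step; apply: rotate_to_end_trace_eq => //; first exact: greedy_letter_avail.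
exact: trace_eq_sym.
Qed.

Lemma periodic_iter k p : spans p -> periodic p -> periodic (iter k greedy_step p).
Proof.
move=> sp pp; elim: k => //= k IHk; apply: periodic_greedy_step => //.
exact: iter_greedy_step_spans.
Qed.

Lemma eventually_periodic k u : spans u -> N * size u <= k -> periodic (iter k greedy_step u).
Proof.
move=> su Hk; have [m mK [pyr _]] := pyramid_reached su.
have -> : k = (k - m) + m by lia.
rewrite iterD; apply: periodic_iter; first exact: iter_greedy_step_spans.
by apply: pyramid_periodic => //; apply: iter_greedy_step_spans.
Qed.

(* [k] moves of letters other than [a] lead from [u] to [p]. *)
Fixpoint moves k u p : Prop :=
  if k is k'.+1 then exists l, [/\ avail l u, l.1 != a & moves k' (rotate_to_end l u) p]
  else trace_eq u p.

Lemma moves_teql k u v p : trace_eq u v -> moves k u p -> moves k v p.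
Proof.
elim: k u v => [|k IHk] u v uv /=; first by apply: TeqTrans; apply: trace_eq_sym.
case=> l [al la H]; exists l; split=> //; first by rewrite -(avail_trace_eq dep_sym _ uv).
by apply: IHk H; apply: trace_eq_rotate_to_end.
Qed.

Lemma moves_cat k m u v w : moves k u v -> moves m v w -> moves (k + m) u w.
Proof.
elim: k u => [|k IHk] u /=; first by move/(trace_eq_sym dep_sym)/moves_teql; apply.
by case=> l [al la H] /(IHk _ H) ?; exists l.
Qed.

(** By the diamond any available letter other than [a] may be moved first, and the number of moves
    to the pyramid does not depend on the choice. *)
Lemma moves_confluent k u p y : pyramid p -> moves k u p -> avail y u -> y.1 != a ->
  exists2 m, k = m.+1 & moves m (rotate_to_end y u) p.
Proof.
move=> pyr; elim: k u => [|k IHk] u /=.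
  by move=> up; rewrite (avail_trace_eq dep_sym _ up) => /pyr ->; rewrite eqxx.
case=> l [al la H] ay ya; case: (eqVneq l y) => [<-|ne]; first by exists k.
have [ayl aly E] := rotate_to_end_diamond dep_refl dep_sym al ay ne.
have [m -> Hm] := IHk _ H ayl ya; exists m.+1 => //=; exists l; split=> //.
exact: moves_teql Hm.
Qed.

Lemma moves_greedy_step k u p : spans u -> pyramid p -> moves k u p -> trace_eq (iter k greedy_step u) p.
Proof.
move=> su pyr; elim: k u su => [|k IHk] u su // H.
have [al la] := gselP su.
have ga : (greedy_letter u).1 != a.
  by case: H => l [lu /negP nla _]; apply/negP=> /eqP /la /(_ l lu) /eqP.
have [m [<-] Hm] := moves_confluent pyr H al ga.
by rewrite iterSr; apply: IHk => //; apply: spans_rotate_to_end.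
Qed.

(** Moves of other letters neither block an available [a]-letter nor interfere with its rotation. *)
Lemma moves_a k u p l : moves k u p -> avail l u -> l.1 = a ->
  avail l p /\ moves k (rotate_to_end l u) (rotate_to_end l p).
Proof.
elim: k u => [|k IHk] u /=.
  by move=> up au _; split; [rewrite -(avail_trace_eq dep_sym _ up)|apply: trace_eq_rotate_to_end].
case=> m [am ma H] al la.
have ne : m != l by apply: contraNneq ma => ->; apply/eqP.
have [alm aml E] := rotate_to_end_diamond dep_refl dep_sym am al ne.
have [lp H'] := IHk _ H alm la; split=> //; exists m; split=> //.
exact: moves_teql H'.
Qed.

Lemma moves_to_pyramid u : spans u ->
  exists k p, [/\ moves k u p, pyramid p & trace_eq (iter k greedy_step u) p].
Proof.
move=> su; have [k _ [pyr H]] := pyramid_reached su.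
exists k, (iter k greedy_step u); split=> //; last exact: TeqRefl.
elim: k u su H {pyr} => [|k IHk] u su H; first exact: TeqRefl.
rewrite iterSr; exists (greedy_letter u); split; [exact: greedy_letter_avail|exact: (H 0)|].
apply: IHk => [|i ik]; first exact/spans_rotate_to_end/su/greedy_letter_avail.
by have := H i.+1 ik; rewrite /greedy_output iterSr.
Qed.

Definition merge u v := exists i j, trace_eq (iter i greedy_step u) (iter j greedy_step v).

Lemma merge_rotate_to_end u l : spans u -> avail l u -> merge u (rotate_to_end l u).
Proof.
move=> su al; have [k [p [H pyr up]]] := moves_to_pyramid su.
(* If [l] is not an [a]-letter, confluence takes both words to the same pyramid [p]. *)
case: (eqVneq l.1 a) => [la|la]; last first.
  have [m _ Hm] := moves_confluent pyr H al la; exists k, m.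
  apply: TeqTrans up (trace_eq_sym dep_sym (moves_greedy_step _ pyr Hm)).
  exact: spans_rotate_to_end.
have [lp Hr] := moves_a H al la.
have sp : spans p by apply: spans_perm (trace_eq_perm up) (iter_greedy_step_spans k su).
have [m [q [Hq pyrq pq]]] := moves_to_pyramid (spans_rotate_to_end lp sp).
(* For an [a]-letter, greedy rotation takes [u] to [p] in [k] steps, rotates [l] there, since [l] is
   the only available letter of the pyramid, and needs [m] more steps to the next pyramid [q]. From
   [rotate_to_end l u] the same [q] is reached without the rotation of [l]. *)
exists (m + k.+1), (k + m).
apply: TeqTrans (trace_eq_sym dep_sym (moves_greedy_step (spans_rotate_to_end al su) pyrq (moves_cat Hr Hq))).
rewrite iterD; apply: TeqTrans pq; apply: iter_greedy_step_trace_eq; first exact: iter_greedy_step_spans.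
rewrite iterS; apply: TeqTrans (greedy_step_trace_eq (iter_greedy_step_spans k su) up) _.
rewrite /greedy_step; have -> : greedy_letter p = l; last exact: TeqRefl.
apply: (@avail_inj _ dep _ _ p) => //; first exact: greedy_letter_avail.
by rewrite la; apply: pyr; apply: greedy_letter_avail.
Qed.

Lemma merge_trans u v w : spans u -> spans v -> spans w -> merge u v -> merge v w -> merge u w.
Proof.
move=> su sv sw [i [j uv]] [k [m vw]]; exists (k + i), (j + m).
rewrite iterD; apply: TeqTrans (iter_greedy_step_trace_eq k _ uv) _; first exact: iter_greedy_step_spans.
rewrite -iterD addnC iterD [iter (j + m) _ _]iterD.
by apply: iter_greedy_step_trace_eq => //; apply: iter_greedy_step_spans.
Qed.

Lemma trace_conj_merge u v : spans u -> trace_conj u v -> merge u v.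
Proof.
move=> su uv; elim: uv su => {u v} [u v uv _|x u su|u v uv IH sv|u v w uv IH1 vw IH2 su].
- by exists 0, 0.
- by rewrite -(rotate_to_end_cons x u); apply: merge_rotate_to_end => //; apply: avail_cons.
- have su := trace_conj_spans (TconjSym uv) sv.
  by have [i [j E]] := IH su; exists j, i; apply: trace_eq_sym.
- have sv := trace_conj_spans uv su; have sw := trace_conj_spans vw sv.
  exact: merge_trans (IH1 su) (IH2 sv).
Qed.

(** Once the two orbits meet, their outputs agree forever; the common delay [N * n] moves this
    agreement into the periodic range. *)
Lemma greedy_shift u v n : spans u -> size u = n -> size v = n -> trace_conj u v ->
  exists i j, forall t, greedy_output (N * n + i + t) u = greedy_output (N * n + j + t) v.
Proof.
move=> su un vn uv; have [i [j E]] := trace_conj_merge su uv.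
exists i, j => t; rewrite /greedy_output; apply: greedy_letter_trace_eq.
rewrite addnAC iterD addnAC [in iter (_ + j) _ _]iterD.
by apply: iter_greedy_step_trace_eq => //; apply: iter_greedy_step_spans.
Qed.

Lemma greedy_output_periodic u n t : spans u -> size u = n ->
  greedy_output (N * n + (t + n)) u = greedy_output (N * n + t) u.
Proof.
move=> su un; rewrite /greedy_output; apply: greedy_letter_trace_eq.
have := eventually_periodic su (leqnn _); rewrite un => /(periodic_iter t).
case=> [|_]; first exact: iter_greedy_step_spans.
rewrite -(iterD t) size_iter_greedy_step // un -iterD.
by rewrite (_ : N * n + (t + n) = n + (t + N * n)) ?(addnC (N * n) t) //; lia.
Qed.

(** In the periodic range [n] consecutive outputs spell the current word up to commutation, so equal
    windows identify the current words. *)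
Lemma greedy_trace_conj u v n i j : spans u -> spans v -> size u = n -> size v = n ->
  (forall t, t < n -> greedy_output (N * n + i + t) u = greedy_output (N * n + j + t) v) -> trace_conj u v.
Proof.
move=> su sv un vn H.
have per w k : spans w -> size w = n ->
    trace_eq (greedy_outputs n (iter (N * n + k) greedy_step w)) (iter (N * n + k) greedy_step w).
  move=> sw wn; have := @eventually_periodic (N * n + k) w sw.
  by rewrite wn => /(_ (leq_addr _ _)) []; rewrite size_iter_greedy_step // wn.
apply: TconjTrans (iter_greedy_step_trace_conj (N * n + i) su) _.
apply: TconjTrans (TconjSym (iter_greedy_step_trace_conj (N * n + j) sv)).
apply/TconjTeq; apply: TeqTrans (trace_eq_sym dep_sym (per u i su un)) _.
have -> : greedy_outputs n (iter (N * n + i) greedy_step u) = greedy_outputs n (iter (N * n + j) greedy_step v).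
  apply: (@eq_from_nth _ (a, false)); rewrite !size_mkseq // => t tn.
  by have := H t tn; rewrite !nth_mkseq // /greedy_output -!iterD [t + (_ + i)]addnC [t + (_ + j)]addnC.
exact: per.
Qed.

End Greedy.

(** * Connected components of the support *)

Section Components.
Variables (N : nat) (dep : rel 'I_N).
Hypotheses (dep_refl : reflexive dep) (dep_sym : symmetric dep).
Implicit Types (x y l : letter N) (u v w : word N) (s : seq 'I_N).

Notation pile := (pile dep).
Notation trace_eq := (trace_eq dep).
Notation trace_conj := (trace_conj dep).

Definition count_gen (j : 'I_N) u := count (fun x : letter N => x.1 == j) u.

Definition restrict s u : word N := [seq x <- u | x.1 \in s].

(** Phrased by counts, which the program keeps in registers, rather than by a word. *)
Definition component s (c : 'I_N -> nat) : bool :=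
  [&& connected dep s, all (fun j => 0 < c j) s &
      [forall j, (j \notin s) ==> has (dep j) s ==> (c j == 0)]].

Lemma eq_component s c c' : c =1 c' -> component s c = component s c'.
Proof.
move=> cc; congr [&& _, _ & _]; first by apply: eq_all => j; rewrite cc.
by apply: eq_forallb => j; rewrite cc.
Qed.

Lemma connected_rcons s j : connected dep s -> j \notin s -> has (dep j) s ->
  connected dep (rcons s j).
Proof.
case: s => // a bs /andP[us /allP H] js dj; rewrite /= -/(rcons bs j); apply/andP; split.
  by rewrite -[_ && _]/(uniq (rcons (a :: bs) j)) rcons_uniq js.
apply/allP=> k; rewrite mem_iota size_rcons add1n ltnS => /andP[k0 ks].
rewrite -[a :: _]/(rcons (a :: bs) j) nth_rcons -cats1.
case: (ltngtP k (size (a :: bs))) => [kb|kb|->]; last by rewrite take_size_cat.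
  by rewrite takel_cat ?(ltnW kb) //; apply: H; rewrite mem_iota add1n k0.
by move: kb ks => /=; lia.
Qed.

(** The enumeration grows from the generator of [x] by dependent generators of the support; having
    no repetitions, it stops at length [N] at the latest. *)
Lemma component_exists u x : x \in u -> exists2 s, x.1 \in s & component s (count_gen^~ u).
Proof.
move=> xu; suff H n s : N - size s < n -> connected dep s ->
    all (fun j => 0 < count_gen j u) s -> x.1 \in s ->
    exists2 s, x.1 \in s & component s (count_gen^~ u).
  apply: (H N [:: x.1]) => //=; rewrite ?inE ?eqxx //.
    by case: N (x.1) => [[]|m _] //; lia.
  by rewrite andbT -has_count; apply/hasP; exists x.
elim: n s => // n IHn s sn cs ps xs.
case: (boolP [forall j, (j \notin s) ==> has (dep j) s ==> (count_gen j u == 0)]) => [H|].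
  by exists s; rewrite // /component cs ps H.
case/forallPn=> j; rewrite !negb_imply => /and3P[js dj cj].
have us : uniq (rcons s j).
  by rewrite rcons_uniq js; case: (s) cs => // a bs /andP[].
have sz : size (rcons s j) <= N.
  by rewrite -(card_uniqP us) (leq_trans (max_card _)) ?card_ord.
apply: (IHn (rcons s j)).
- by move: sz sn; rewrite size_rcons; lia.
- exact: connected_rcons.
- by rewrite all_rcons lt0n cj ps.
- by rewrite mem_rcons inE xs orbT.
Qed.

Lemma count_gen_gt0 j u : (0 < count_gen j u) = has (fun x : letter N => x.1 == j) u.
Proof. by rewrite has_count. Qed.

Lemma count_gen_restrict s u j : count_gen j (restrict s u) = if j \in s then count_gen j u else 0.
Proof.
rewrite /count_gen count_filter; case: ifP => js.
  by apply: eq_count => x; apply: andb_idr => /eqP ->.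
by rewrite (@eq_count _ _ pred0) ?count_pred0 // => x /=; case: eqP => // ->.
Qed.

Lemma component_spans s u : component s (count_gen^~ u) -> spans s (restrict s u).
Proof.
case/and3P=> cs /allP ps _; apply/andP; split; first exact: filter_all.
by apply/allP=> j js; rewrite -count_gen_gt0 count_gen_restrict js ps.
Qed.

Lemma component_dep s u i x : component s (count_gen^~ u) -> x \in u -> i \in s ->
  dep i x.1 -> x.1 \in s.
Proof.
case/and3P=> _ _ /forallP/(_ x.1) H xu is_ d; apply/negPn/negP=> xs.
move: H; rewrite xs /= => /implyP; have -> : has (dep x.1) s.
  by apply/hasP; exists i; rewrite // dep_sym.
move/(_ isT)/eqP=> H; have := count_gen_gt0 x.1 u; rewrite H.
by move/esym/hasPn/(_ x xu); rewrite eqxx.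
Qed.

Lemma pile_restrict s u j : component s (count_gen^~ u) -> j \in s ->
  pile (restrict s u) j = pile u j.
Proof.
move=> cs js; rewrite /pile /restrict -filter_predI; congr map.
apply: eq_in_filter => x xu /=; apply: andb_idr => d.
exact: component_dep cs xu js d.
Qed.

Lemma component_split s u : component s (count_gen^~ u) ->
  trace_eq u (restrict s u ++ [seq x <- u | x.1 \notin s]).
Proof.
move=> cs; have H : {in u &, forall x y, x.1 \in s -> y.1 \notin s -> ~~ dep y.1 x.1}.
  move=> x y xu yu xs ys; apply/negP=> d.
  by rewrite (component_dep cs yu xs) // dep_sym in ys.
elim: u H {cs} => [|x u IHu] H /=; first exact: TeqRefl.
have {}IHu : trace_eq u (restrict s u ++ [seq x <- u | x.1 \notin s]).
  by apply: IHu => y z yu zu; apply: H; rewrite inE ?yu ?zu orbT.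
rewrite /restrict /=; case: ifP => xs /=; first exact: trace_eq_cons.
apply: TeqTrans (trace_eq_cons _ IHu) _; rewrite -cat_cons -cat_rcons.
apply/trace_eq_cat2r/trace_eq_indep/allP=> y; rewrite mem_filter => /andP[ys yu].
by apply: H; rewrite ?inE ?eqxx ?yu ?orbT ?xs.
Qed.

Lemma restrict_notin s s' u : all (fun j => 0 < count_gen j [seq x <- u | x.1 \notin s]) s' ->
  restrict s' [seq x <- u | x.1 \notin s] = restrict s' u.
Proof.
move=> /allP H; rewrite /restrict -filter_predI; apply: eq_filter => x /=.
apply: andb_idr => /H; rewrite count_gen_gt0 => /hasP[y].
by rewrite mem_filter => /andP[ys _] /eqP <-.
Qed.

Lemma count_gen_notin s u j : count_gen j [seq x <- u | x.1 \notin s] = if j \in s then 0 else count_gen j u.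
Proof.
rewrite /count_gen count_filter; case: ifP => js.
  by rewrite (@eq_count _ _ pred0) ?count_pred0 // => x /=; case: eqP => // ->; rewrite js.
by apply: eq_count => x; apply: andb_idr => /eqP ->; rewrite js.
Qed.

(** Equal counts give both words the same components, so a component is split off both and the rests
    are treated by induction. *)
Lemma trace_conj_components u v : (forall j, count_gen j u = count_gen j v) ->
  (forall s, component s (count_gen^~ u) -> trace_conj (restrict s u) (restrict s v)) -> trace_conj u v.
Proof.
have [n] := ubnP (size u); elim: n => // n IHn in u v *.
case: u => [_ E _|x u un E H].
  case: v E => [|y v] E; first exact: trace_conj_refl.
  by have := E y.1; rewrite /count_gen /= eqxx.
have [s xs cs] := @component_exists (x :: u) x (mem_head _ _).
have csv : component s (count_gen^~ v) by rewrite -(eq_component _ E).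
set u' := [seq x <- x :: u | x.1 \notin s]; set v' := [seq x <- v | x.1 \notin s].
have uv' : trace_conj u' v'.
  apply: IHn.
  - rewrite /u' /= xs /=; apply: leq_ltn_trans (_ : size u < n) => //.
    by rewrite size_filter count_size.
  - by move=> j; rewrite !count_gen_notin E.
  move=> s' cs'; have /and3P[cn ps cl] := cs'.
  have ps2 : all (fun j => 0 < count_gen j v') s'.
    by move: ps; rewrite (@eq_all _ _ (fun j => 0 < count_gen j v')) // => j; rewrite !count_gen_notin E.
  rewrite !restrict_notin //; apply: H; apply/and3P; split=> //.
    by apply/allP=> j /(allP ps); rewrite count_gen_notin; case: ifP.
  apply/forallP=> j; apply/implyP=> js'; apply/implyP=> dj.
  have /implyP/(_ js')/implyP/(_ dj) := forallP cl j; rewrite count_gen_notin.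
  (* A component [s'] of the rest is one of the whole word: a generator [j] of [s] depending on some
     [i] of [s'] would violate the closure of [s], as [i] occurs outside [s]. *)
  case: ifP => // js _; case/hasP: dj => i is' d.
  have /(allP ps) := is'; rewrite count_gen_notin; case: ifP => // i_s ci.
  have /and3P[_ _ /forallP/(_ i)/implyP/(_ (negbT i_s))/implyP Hi] := cs.
  have /Hi/eqP c0 : has (dep i) s by apply/hasP; exists j; rewrite // dep_sym.
  by rewrite c0 in ci.
have su := component_split cs; have sv := component_split csv.
apply: TconjTrans (TconjTeq su) _; apply: TconjTrans (TconjSym (TconjTeq sv)).
have ind w : component s (count_gen^~ w) -> all (fun y => indep dep y [seq x <- w | x.1 \notin s]) (restrict s w).
  move=> cw; apply/allP=> y; rewrite mem_filter => /andP[ys yw].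
  apply/allP=> z; rewrite mem_filter => /andP[zs zw]; apply/negP=> d.
  by rewrite (component_dep cw zw ys d) in zs.
apply: TconjTrans (trace_conj_cat_indep dep_sym (H s cs) (ind _ cs)) _.
apply: TconjTrans (trace_conj_catC _ _ _) _; apply: TconjTrans (trace_conj_catC _ _ _).
apply: trace_conj_cat_indep => //.
apply/allP=> y; rewrite mem_filter => /andP[ys yu].
apply/allP=> z; rewrite mem_filter => /andP[zs zv]; apply/negP=> d.
have zu : exists2 z', z' \in (x :: u) & z'.1 = z.1.
  have : 0 < count_gen z.1 (x :: u) by rewrite E count_gen_gt0; apply/hasP; exists z.
  by rewrite count_gen_gt0 => /hasP[z' ? /eqP]; exists z'.
have {zu} [z' z'u zz] := zu.
by move/negP: ys; apply; apply: (component_dep cs yu zs); rewrite dep_sym.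
Qed.

Lemma all_indep_rest s u (x : word N) : component s (count_gen^~ u) -> all (fun y : letter N => y.1 \in s) x ->
  all (fun y => indep dep y [seq z <- u | z.1 \notin s]) x.
Proof.
move=> cs /allP xs; apply/allP=> y /xs ys; apply/allP=> z; rewrite mem_filter.
by case/andP=> zs zu; apply/negP=> d; rewrite (component_dep cs zu ys d) in zs.
Qed.

Lemma pile_all_indep j u : all (fun y => ~~ dep j y.1) u -> pile u j = [::].
Proof. by elim: u => // y u IHu /= /andP[nd /IHu]; rewrite pile_cons (negPf nd). Qed.

(** A supported generator outside [s] depends on nothing in [s], so its pile contains no trace of
    the exchanged part. *)
Lemma replace_component s u (x : word N) : component s (count_gen^~ u) -> trace_conj (restrict s u) x ->
  let u' := x ++ [seq y <- u | y.1 \notin s] in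
  [/\ trace_conj u u', forall j, j \in s -> pile u' j = pile x j &
      forall j, j \notin s -> 0 < count_gen j u -> pile u' j = pile u j].
Proof.
move=> cs ux u'; have us : all (fun y : letter N => y.1 \in s) (restrict s u) by apply: filter_all.
have xs : all (fun y : letter N => y.1 \in s) x by rewrite -(perm_all _ (trace_conj_perm ux)).
have sp := component_split cs.
split=> [|j js|j js cj].
- apply: TconjTrans (TconjTeq sp) _; apply: trace_conj_cat_indep => //.
  exact: all_indep_rest.
- rewrite /u' pile_cat [X in _ ++ X]pile_all_indep ?cats0 //.
  apply/allP=> z; rewrite mem_filter => /andP[zs zu].
  by apply/negP=> d; rewrite (component_dep cs zu js d) in zs.
- have H w : all (fun y : letter N => y.1 \in s) w -> pile w j = [::].
    move=> /allP ws; apply: pile_all_indep; apply/allP=> y /ws ys; apply/negP=> d.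
    have /and3P[_ _ /forallP/(_ j)/implyP/(_ js)/implyP Hj] := cs.
    have /Hj/eqP c0 : has (dep j) s by apply/hasP; exists y.1.
    by rewrite c0 in cj.
  by rewrite (trace_eq_pile dep_sym sp) /u' !pile_cat (H x) ?(H (restrict s u)).
Qed.

End Components.

Arguments count_gen {N} j u.

(** * Shifts of periodic sequences and their lexicographic comparison *)

Section Lex.

Definition lexgt (f g : nat -> nat) :=
  exists k, (forall t, t < k -> f t = g t) /\ g k < f k.

Lemma lexgt_irr f : ~ lexgt f f.
Proof. by case=> k [_]; rewrite ltnn. Qed.

Lemma lexgt_trans g f h : lexgt f g -> lexgt g h -> lexgt f h.
Proof.
move=> [k [fg gk]] [m [gh hm]]; exists (minn k m); split=> [t tk|].
  by rewrite fg ?gh //; lia.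
case: (ltngtP k m) => [km|mk|km].
- by rewrite -gh.
- by rewrite fg.
- by subst m; apply: ltn_trans hm gk.
Qed.

Lemma lexgt_minimal (F : nat -> nat -> nat) n : 0 < n ->
  exists2 m, m < n & forall i, i < n -> ~ lexgt (F m) (F i).
Proof.
case: n => // n _; elim: n => [|n [m mn Hm]].
  by exists 0 => // -[|//] _; apply: lexgt_irr.
have [gt|ngt] : lexgt (F m) (F n.+1) \/ ~ lexgt (F m) (F n.+1).
  exact: EM.
  exists n.+1 => // i; rewrite ltnS leq_eqVlt => /orP[/eqP ->|lt]; first exact: lexgt_irr.
  by move/(lexgt_trans gt); apply: Hm.
exists m; first exact: ltnW.
by move=> i; rewrite ltnS leq_eqVlt => /orP[/eqP ->|] //; apply: Hm.
Qed.

Variables (U V : nat -> nat) (n : nat).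
Hypotheses (n_gt0 : 0 < n) (Uper : forall t, U (t + n) = U t) (Vper : forall t, V (t + n) = V t).

Lemma per_mul (W : nat -> nat) m t : (forall t, W (t + n) = W t) -> W (t + m * n) = W t.
Proof. by move=> per; elim: m => [|m IHm]; rewrite ?addn0 // mulSn (addnC n) addnA per. Qed.

Lemma per_mod (W : nat -> nat) i t : (forall t, W (t + n) = W t) -> W (i + t) = W (i %% n + t).
Proof.
move=> per; rewrite -[RHS](per_mul (i %/ n)) //; congr W.
by have := divn_eq i n; lia.
Qed.

(** If [U] and [V] are shifts of each other, every shift of [V] is a shift of [U], so none lies
    below the least shift of [U]. *)
Lemma shift_not_all_gt i j : (forall t, U (i + t) = V (j + t)) ->
  ~ (forall i', i' < n -> exists j', lexgt (fun t => U (i' + t)) (fun t => V (j' + t))).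
Proof.
move=> UV H.
have [m mn Hm] := lexgt_minimal (fun i t => U (i + t)) n_gt0.
have [j' [k [E lt]]] := H m mn.
(* The place in [U] that corresponds to [j'] in [V]; adding [j] periods keeps the truncated
   subtraction exact. *)
pose d := i + (j' + j * n - j).
have VU t : V (j' + t) = U (d %% n + t).
  rewrite -per_mod // /d -addnA UV -(@per_mul V j (j' + t)) //; congr V; nia.
apply: (Hm (d %% n)); first by rewrite ltn_mod.
by exists k; rewrite -VU; split=> // t /E ->; rewrite VU.
Qed.

End Lex.

(** Starting points below [i] and [j] are discarded with a witness: each exceeds some shift of the
    other sequence. When a whole period is discarded, [shift_not_all_gt] applies. *)
Definition cmp_inv (U V : nat -> nat) i j k :=
  [/\ forall i', i' < i -> exists j', lexgt (fun t => U (i' + t)) (fun t => V (j' + t)),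
      forall j', j' < j -> exists i', lexgt (fun t => V (j' + t)) (fun t => U (i' + t))
    & forall t, t < k -> U (i + t) = V (j + t)].

Lemma cmp_inv_sym U V i j k : cmp_inv U V i j k -> cmp_inv V U j i k.
Proof. by case=> H1 H2 H3; split=> // t /H3. Qed.

(* A mismatch after [k] equal symbols rules out not just [i] but the next [k]
   starting points as well. *)
Lemma cmp_inv_gt (U V : nat -> nat) i j k : cmp_inv U V i j k -> V (j + k) < U (i + k) ->
  cmp_inv U V (i + k).+1 j 0.
Proof.
case=> H1 H2 H3 lt; split=> // i' Hi'.
case: (ltnP i' i) => ii; first exact: H1.
exists (j + (i' - i)), (k - (i' - i)); split=> [t tk|].
  have := H3 (i' - i + t); rewrite !addnA subnKC // => ->//; lia.
have -> : i' + (k - (i' - i)) = i + k by lia.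
by have -> : j + (i' - i) + (k - (i' - i)) = j + k by lia.
Qed.

Lemma cmp_inv_lt (U V : nat -> nat) i j k : cmp_inv U V i j k -> U (i + k) < V (j + k) ->
  cmp_inv U V i (j + k).+1 0.
Proof. by move=> H lt; apply/cmp_inv_sym/(cmp_inv_gt (cmp_inv_sym H) lt). Qed.

Lemma cmp_inv_eq (U V : nat -> nat) i j k : cmp_inv U V i j k -> U (i + k) = V (j + k) ->
  cmp_inv U V i j k.+1.
Proof.
case=> H1 H2 H3 E; split=> // t; rewrite ltnS leq_eqVlt => /orP[/eqP -> //|].
exact: H3.
Qed.

(** * A machine with registers and deques *)

Definition upd (T : eqType) (S : Type) (f : T -> S) (x : T) (v : S) : T -> S :=
  fun y => if y == x then v else f y.

Section Machine.
Variables (rg : countType) (D : finType).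

Record state := St { reg : rg -> nat; deque : D -> seq nat; tape : seq nat }.

Inductive expr := ECst of nat | EReg of rg | EAdd of expr & expr | ESub of expr & expr
  | ESiz of D | EGet of D & expr.

Fixpoint eval e s : nat :=
  match e with
  | ECst k => k
  | EReg r => reg s r
  | EAdd e1 e2 => eval e1 s + eval e2 s
  | ESub e1 e2 => eval e1 s - eval e2 s
  | ESiz d => size (deque s d)
  | EGet d e => nth 0 (deque s d) (eval e s)
  end.

(** Loop-free on purpose: the cost of a command is bounded by the length of its code, and loops are
    left to [item]. *)
Inductive cmd := Skip | Set_ of rg & expr | Push of D & expr | PopB of D | PopF of D
  | Clr of D | Inp of rg | Sq of cmd & cmd | If of expr & cmd & cmd.

Definition set_reg s r v := St (upd (reg s) r v) (deque s) (tape s).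
Definition set_deque s d q := St (reg s) (upd (deque s) d q) (tape s).

Fixpoint denote c s : state :=
  match c with
  | Skip => s
  | Set_ r e => set_reg s r (eval e s)
  | Push d e => set_deque s d (rcons (deque s d) (eval e s))
  | PopB d => set_deque s d (droplast (deque s d))
  | PopF d => set_deque s d (behead (deque s d))
  | Clr d => set_deque s d [::]
  | Inp r => St (upd (reg s) r (head 0 (tape s))) (deque s) (behead (tape s))
  | Sq c1 c2 => denote c2 (denote c1 s)
  | If e c1 c2 => if 0 < eval e s then denote c1 s else denote c2 s
  end.

Inductive item := Blk of cmd | Whl of expr & cmd.

(* The number of steps counts executed blocks, whose cost is bounded. *)
Inductive run : seq item -> state -> nat -> state -> Prop :=
| RunNil s : run [::] s 0 s
| RunBlk c Q s n s' : run Q (denote c s) n s' -> run (Blk c :: Q) s n.+1 s'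
| RunWhl0 e c Q s n s' : eval e s = 0 -> run Q s n s' -> run (Whl e c :: Q) s n.+1 s'
| RunWhlS e c Q s n s' : 0 < eval e s ->
    run (Whl e c :: Q) (denote c s) n s' -> run (Whl e c :: Q) s n.+1 s'.

(* The address modulo 4 tells temporaries, registers, deque bounds and deque
   cells apart; the cells of the different deques are interleaved. *)
Definition tmp_addr k := 4 * k.
Definition reg_addr (r : rg) := 4 * pickle r + 1.
Definition ptr_addr (d : D) (b : bool) := 4 * pickle (d, b) + 2.
Definition cell_addr (d : D) p := 4 * (#|D| * p + enum_rank d) + 3.

Lemma ta_inj k l : (tmp_addr k == tmp_addr l) = (k == l). Proof. by rewrite /tmp_addr; lia. Qed.
Lemma ra_inj r r' : (reg_addr r == reg_addr r') = (r == r').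
Proof.
rewrite -(inj_eq (pcan_inj pickleK) r r') /reg_addr.
by rewrite eqn_add2r eqn_pmul2l.
Qed.
Lemma pa_inj d b d' b' : (ptr_addr d b == ptr_addr d' b') = (d == d') && (b == b').
Proof.
rewrite /ptr_addr eqn_add2r eqn_pmul2l // (inj_eq (pcan_inj pickleK)).
by rewrite xpair_eqE.
Qed.
Lemma ca_inj d p d' p' : (cell_addr d p == cell_addr d' p') = (d == d') && (p == p').
Proof.
have D0 : 0 < #|D| := leq_ltn_trans (leq0n _) (ltn_ord (enum_rank d)).
rewrite /cell_addr eqn_add2r eqn_pmul2l //; apply/eqP/andP => [E|[/eqP -> /eqP ->] //].
have H : enum_rank d = enum_rank d'.
  apply: val_inj => /=; have := congr1 (modn^~ #|D|) E.
  by rewrite /= ![#|D| * _]mulnC !modnMDl !modn_small ?ltn_ord.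
rewrite (enum_rank_inj H) eqxx; split=> //; move: E; rewrite H => /addIn /eqP.
by rewrite eqn_pmul2l.
Qed.
Lemma ta_ra k r : (tmp_addr k == reg_addr r) = false. Proof. by rewrite /tmp_addr /reg_addr; lia. Qed.
Lemma ra_ta k r : (reg_addr r == tmp_addr k) = false. Proof. by rewrite /tmp_addr /reg_addr; lia. Qed.
Lemma ta_pa k d b : (tmp_addr k == ptr_addr d b) = false. Proof. by rewrite /tmp_addr /ptr_addr; lia. Qed.
Lemma pa_ta k d b : (ptr_addr d b == tmp_addr k) = false. Proof. by rewrite /tmp_addr /ptr_addr; lia. Qed.
Lemma ta_ca k d p : (tmp_addr k == cell_addr d p) = false. Proof. by rewrite /tmp_addr /cell_addr; lia. Qed.
Lemma ca_ta k d p : (cell_addr d p == tmp_addr k) = false. Proof. by rewrite /tmp_addr /cell_addr; lia. Qed.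
Lemma ra_pa r d b : (reg_addr r == ptr_addr d b) = false. Proof. by rewrite /reg_addr /ptr_addr; lia. Qed.
Lemma pa_ra r d b : (ptr_addr d b == reg_addr r) = false. Proof. by rewrite /reg_addr /ptr_addr; lia. Qed.
Lemma ra_ca r d p : (reg_addr r == cell_addr d p) = false. Proof. by rewrite /reg_addr /cell_addr; lia. Qed.
Lemma ca_ra r d p : (cell_addr d p == reg_addr r) = false. Proof. by rewrite /reg_addr /cell_addr; lia. Qed.
Lemma pa_ca d b d' p : (ptr_addr d b == cell_addr d' p) = false. Proof. by rewrite /ptr_addr /cell_addr; lia. Qed.
Lemma ca_pa d b d' p : (cell_addr d' p == ptr_addr d b) = false. Proof. by rewrite /ptr_addr /cell_addr; lia. Qed.

Definition addrE := (ta_inj, ra_inj, pa_inj, ca_inj, ta_ra, ra_ta, ta_pa, pa_ta,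
  ta_ca, ca_ta, ra_pa, pa_ra, ra_ca, ca_ra, pa_ca, ca_pa).

(* Cells behind the end of a deque are kept at 0, the value that [EGet] reads
   there. *)
Definition simul s (m : nat -> nat) :=
  [/\ forall r, m (reg_addr r) = reg s r,
      forall d, m (ptr_addr d true) = m (ptr_addr d false) + size (deque s d)
    & forall d i, m (cell_addr d (m (ptr_addr d false) + i)) = nth 0 (deque s d) i].

Fixpoint rsteps P t s s' : Prop :=
  if t is t'.+1 then exists2 s1, ram_step P s = Some (inl s1) & rsteps P t' s1 s'
  else s = s'.

Lemma rsteps_cat P t1 t2 s1 s2 s3 :
  rsteps P t1 s1 s2 -> rsteps P t2 s2 s3 -> rsteps P (t1 + t2) s1 s3.
Proof.
elim: t1 s1 => [|t1 IH] s1 /=; first by move->.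
by case=> s' E H1 H2; exists s' => //; apply: IH.
Qed.

Lemma rsteps_run P t k s s' b : rsteps P t s s' -> ram_run P k s' = Some b ->
  ram_run P (t + k) s = Some b.
Proof. by elim: t s => [|t IH] s /= => [->|[s1 -> /IH]]. Qed.

Lemma ram_run_mono P t k s b : ram_run P t s = Some b -> ram_run P (t + k) s = Some b.
Proof. by elim: t s => [|t IH] s //=; case: ram_step => // -[s1|b'] // /IH. Qed.

Definition code_at (P : ram_program) pc (code : seq ram_instr) :=
  forall i, i < size code -> onth P (pc + i) = onth code i.

Lemma code_at_cat P pc c1 c2 : code_at P pc (c1 ++ c2) -> code_at P pc c1 /\ code_at P (pc + size c1) c2.
Proof.
move=> H; split=> i Hi.
  by rewrite H ?size_cat ?onth_cat ?Hi //; lia.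
by rewrite -addnA H ?size_cat ?onth_cat ?ltn_add2l // ltnNge leq_addr /= addKn.
Qed.

Lemma code_at_cons P pc i c : code_at P pc (i :: c) -> onth P pc = Some i /\ code_at P pc.+1 c.
Proof.
move=> H; split; first by have := H 0 isT; rewrite addn0.
by move=> k Hk; rewrite addSnnS H.
Qed.

Definition plain i :=
  match i with RJumpPos _ _ | RHalt _ | RRead _ => false | _ => true end.

Definition instr_eff (m : nat -> nat) i :=
  match i with
  | RConst d k => ram_set m d k
  | RAdd d a b => ram_set m d (m a + m b)
  | RSub d a b => ram_set m d (m a - m b)
  | RLoad d a => ram_set m d (m (m a))
  | RStore a b => ram_set m (m a) (m b)
  | _ => m
  end.

Definition effect := foldl instr_eff.

Lemma effect_cat m c1 c2 : effect m (c1 ++ c2) = effect (effect m c1) c2.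
Proof. exact: foldl_cat. Qed.

Lemma rsteps_plain P pc m inp code : all plain code -> code_at P pc code ->
  rsteps P (size code) (RamState pc m inp) (RamState (pc + size code) (effect m code) inp).
Proof.
elim: code pc m => [|i code IH] pc m /=; first by rewrite addn0.
case/andP=> pi pcode /code_at_cons [E /(IH _ (instr_eff m i) pcode)]; rewrite addSnnS => H.
by eexists; last exact: H; rewrite E; case: (i) pi.
Qed.

Definition copy d a := [:: RConst d 0; RAdd d d a].

Lemma copyE m d a : a != d -> effect m (copy d a) = ram_set m d (m a).
Proof.
move=> ad; apply: funext => x; rewrite /= /ram_set eqxx (negPf ad) add0n.
by case: eqP.
Qed.

(* Multiplication by the constant number of deques is repeated addition. *)
Definition load_cell_addr (d : D) k :=
  RConst (tmp_addr k.+1) (4 * enum_rank d + 3) ::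
  nseq (4 * #|D|) (RAdd (tmp_addr k.+1) (tmp_addr k.+1) (tmp_addr k)).

Arguments load_cell_addr : simpl never.

Lemma load_cell_addrE m d k : effect m (load_cell_addr d k) = ram_set m (tmp_addr k.+1) (cell_addr d (m (tmp_addr k))).
Proof.
rewrite /load_cell_addr.
have H n v : effect (ram_set m (tmp_addr k.+1) v) (nseq n (RAdd (tmp_addr k.+1) (tmp_addr k.+1) (tmp_addr k)))
    = ram_set m (tmp_addr k.+1) (v + n * m (tmp_addr k)).
  elim: n v => [|n IHn] v; first by rewrite addn0.
  set i := RAdd _ _ _.
  have E1 : instr_eff (ram_set m (tmp_addr k.+1) v) i = ram_set m (tmp_addr k.+1) (v + m (tmp_addr k)).
    apply: funext => x; rewrite /i /= /ram_set eqxx ta_inj.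
    have -> : (k == k.+1) = false by lia.
    by case: eqP.
  rewrite -[LHS]/(effect (instr_eff (ram_set m (tmp_addr k.+1) v) i) (nseq n i)) E1.
  by rewrite IHn mulSn addnA.
rewrite -[LHS]/(effect (ram_set m (tmp_addr k.+1) (4 * enum_rank d + 3)) (nseq _ _)).
by rewrite H /cell_addr; congr ram_set; rewrite mulnDr mulnA addnC addnA.
Qed.

Fixpoint comp_expr e k : seq ram_instr :=
  match e with
  | ECst n => [:: RConst (tmp_addr k) n]
  | EReg r => copy (tmp_addr k) (reg_addr r)
  | EAdd e1 e2 => comp_expr e1 k ++ comp_expr e2 k.+1 ++ [:: RAdd (tmp_addr k) (tmp_addr k) (tmp_addr k.+1)]
  | ESub e1 e2 => comp_expr e1 k ++ comp_expr e2 k.+1 ++ [:: RSub (tmp_addr k) (tmp_addr k) (tmp_addr k.+1)]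
  | ESiz d => [:: RSub (tmp_addr k) (ptr_addr d true) (ptr_addr d false)]
  | EGet d e => comp_expr e k ++ [:: RAdd (tmp_addr k) (tmp_addr k) (ptr_addr d false)] ++ load_cell_addr d k ++
               [:: RLoad (tmp_addr k) (tmp_addr k.+1)]
  end.

Lemma load_cell_addr_plain d k : all plain (load_cell_addr d k).
Proof. by rewrite /load_cell_addr /= all_nseq orbT. Qed.

Lemma comp_expr_plain e k : all plain (comp_expr e k).
Proof.
elim: e k => [n|r|e1 IH1 e2 IH2|e1 IH1 e2 IH2|d|d e IH] k //.
- by rewrite /= !all_cat IH1 IH2.
- by rewrite /= !all_cat IH1 IH2.
- by rewrite /= all_cat IH /= all_cat all_nseq orbT.
Qed.

Lemma simul_frame s m m' : simul s m ->
  (forall a, (forall k, a != tmp_addr k) -> m' a = m a) -> simul s m'.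
Proof.
case=> H1 H2 H3 E; have ra' r : m' (reg_addr r) = m (reg_addr r) by apply: E => k; rewrite addrE.
have pa' d b : m' (ptr_addr d b) = m (ptr_addr d b) by apply: E => k; rewrite addrE.
have ca' d p : m' (cell_addr d p) = m (cell_addr d p) by apply: E => k; rewrite addrE.
by split=> *; rewrite ?ra' ?pa' ?ca'.
Qed.

(** The second clause protects the temporaries below [k], which hold the pending left operands of
    the enclosing expression. *)
Lemma comp_exprP s m e k : simul s m ->
  effect m (comp_expr e k) (tmp_addr k) = eval e s /\
  forall a, (forall l, k <= l -> a != tmp_addr l) -> effect m (comp_expr e k) a = m a.
Proof.
have fr m1 m2 : simul s m1 -> (forall a, (forall l, k <= l -> a != tmp_addr l) -> m2 a = m1 a) -> simul s m2.
  by move=> r1 E; apply: simul_frame r1 _ => a Ha; apply: E => l _; apply: Ha.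
elim: e k m {fr} => [n|r|e1 IH1 e2 IH2|e1 IH1 e2 IH2|d|d e IH] k m rm.
- split=> [|a Ha] /=; rewrite /ram_set ?eqxx //.
  by rewrite (negPf (Ha k (leqnn k))).
- have [H1 H2 H3] := rm.
  rewrite [comp_expr _ _]/(copy _ _) copyE ?addrE //.
  split=> [|a Ha] /=; rewrite /ram_set ?eqxx //.
  by rewrite (negPf (Ha k (leqnn k))).
- have [E1 F1] := IH1 k m rm.
  have rm1 : simul s (effect m (comp_expr e1 k)).
    by apply: simul_frame rm _ => a Ha; apply: F1 => l _; apply: Ha.
  have [E2 F2] := IH2 k.+1 _ rm1.
  rewrite /= !effect_cat /=; split=> [|a Ha]; rewrite /ram_set ?eqxx.
    by rewrite E2 F2 ?E1 // => l kl; rewrite addrE; lia.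
  rewrite (negPf (Ha k (leqnn k))) F2 ?F1 // => l kl; apply: Ha; exact: ltnW.
- have [E1 F1] := IH1 k m rm.
  have rm1 : simul s (effect m (comp_expr e1 k)).
    by apply: simul_frame rm _ => a Ha; apply: F1 => l _; apply: Ha.
  have [E2 F2] := IH2 k.+1 _ rm1.
  rewrite /= !effect_cat /=; split=> [|a Ha]; rewrite /ram_set ?eqxx.
    by rewrite E2 F2 ?E1 // => l kl; rewrite addrE; lia.
  rewrite (negPf (Ha k (leqnn k))) F2 ?F1 // => l kl; apply: Ha; exact: ltnW.
- have [H1 H2 H3] := rm.
  split=> [|a Ha] /=; rewrite /ram_set ?eqxx ?H2 ?addKn //.
  by rewrite (negPf (Ha k (leqnn k))).
- have [E1 F1] := IH k m rm; have [H1 H2 H3] := rm.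
  have Ek : comp_expr (EGet d e) k = (comp_expr e k ++ [:: RAdd (tmp_addr k) (tmp_addr k) (ptr_addr d false)]) ++
      (load_cell_addr d k ++ [:: RLoad (tmp_addr k) (tmp_addr k.+1)]) by rewrite -catA.
  rewrite Ek (effect_cat m) (effect_cat _ (load_cell_addr d k)) load_cell_addrE (effect_cat m) /=.
  have lk : (tmp_addr k == tmp_addr k.+1) = false by rewrite addrE; lia.
  split=> [|a Ha]; rewrite /ram_set ?eqxx.
    rewrite !addrE E1 F1; last by move=> l _; rewrite addrE.
    rewrite F1; last by move=> l _; rewrite addrE.
    by rewrite addnC H3.
  by rewrite (negPf (Ha k (leqnn k))) (negPf (Ha k.+1 (leqnSn k))) F1.
Qed.

End Machine.

(** * Compilation to the RAM *)

Section Compile.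
Variables (rg : countType) (D : finType).
Notation state := (state rg D).
Notation expr := (expr rg D).
Notation cmd := (cmd rg D).
Notation item := (item rg D).
Implicit Types (s : state) (e : expr) (c : cmd) (d : D) (r : rg).

Lemma set_regP s r v m : simul s m -> simul (set_reg s r v) (ram_set m (reg_addr r) v).
Proof.
case=> H1 H2 H3; split=> [r'|d|d i]; rewrite /ram_set /= /upd !addrE //.
by case: eqP.
Qed.

(* Computes min(1, size of [d]) without a jump. *)
Definition nonempty d : seq ram_instr :=
  [:: RSub (tmp_addr 0) (ptr_addr d true) (ptr_addr d false); RConst (tmp_addr 1) 1; RSub (tmp_addr 2) (tmp_addr 0) (tmp_addr 1);
      RSub (tmp_addr 0) (tmp_addr 0) (tmp_addr 2)].

(** [PopB] clears the vacated cell because [simul] demands zeros behind the end. [PopF] and [Clr]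
    only advance the front pointer, since cells in front of it are unconstrained. *)
Definition comp_atomic c : seq ram_instr :=
  match c with
  | Set_ r e => comp_expr e 0 ++ copy (reg_addr r) (tmp_addr 0)
  | Push d e => comp_expr e 0 ++ copy (tmp_addr 1) (ptr_addr d true) ++ load_cell_addr d 1 ++
      [:: RStore (tmp_addr 2) (tmp_addr 0); RConst (tmp_addr 1) 1; RAdd (ptr_addr d true) (ptr_addr d true) (tmp_addr 1)]
  | PopB d => (nonempty d ++ [:: RSub (ptr_addr d true) (ptr_addr d true) (tmp_addr 0)]) ++
      copy (tmp_addr 1) (ptr_addr d true) ++ load_cell_addr d 1 ++ [:: RConst (tmp_addr 0) 0; RStore (tmp_addr 2) (tmp_addr 0)]
  | PopF d => nonempty d ++ [:: RAdd (ptr_addr d false) (ptr_addr d false) (tmp_addr 0)]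
  | Clr d => copy (ptr_addr d false) (ptr_addr d true)
  | _ => [::]
  end.

Lemma simul_tmp s m k v : simul s m -> simul s (ram_set m (tmp_addr k) v).
Proof. by move/simul_frame; apply=> a /(_ k) /negPf E; rewrite /ram_set E. Qed.

Lemma simul_comp_expr s m e k : simul s m -> simul s (effect m (comp_expr e k)).
Proof.
move=> rm; have [_ F] := comp_exprP e k rm; apply: simul_frame rm _ => a Ha.
by apply: F.
Qed.

Lemma nonemptyE s m d : simul s m ->
  effect m (nonempty d) (tmp_addr 0) = (0 < size (deque s d)) /\ simul s (effect m (nonempty d)).
Proof.
move=> rm; split; last by do 4 apply: simul_tmp.
have [_ H2 _] := rm; rewrite /= /ram_set !addrE /= H2 addKn.
by case: (size _) => // n; rewrite /=; lia.
Qed.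

Lemma set_dequeP s d q m m' : simul s m -> (forall r, m' (reg_addr r) = m (reg_addr r)) ->
  (forall d' b, d' != d -> m' (ptr_addr d' b) = m (ptr_addr d' b)) ->
  (forall d' p, d' != d -> m' (cell_addr d' p) = m (cell_addr d' p)) ->
  m' (ptr_addr d true) = m' (ptr_addr d false) + size q ->
  (forall i, m' (cell_addr d (m' (ptr_addr d false) + i)) = nth 0 q i) ->
  simul (set_deque s d q) m'.
Proof.
case=> H1 H2 H3 Er Ep Ec E1 E2; split=> [r|d'|d' i]; rewrite /= /upd ?Er //.
  by case: eqP => [->//|/eqP ne]; rewrite !Ep.
by case: eqP => [->//|/eqP ne]; rewrite Ep // Ec.
Qed.

Lemma size_droplast (T : Type) (q : seq T) : size (droplast q) = (size q).-1.
Proof. by rewrite /droplast size_take; case: (size q) => // n; rewrite ltnS leqnn. Qed.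

Lemma nth_droplast (q : seq nat) i :
  nth 0 (droplast q) i = if i == (size q).-1 then 0 else nth 0 q i.
Proof.
case: (ltngtP i (size q).-1) => H; first by rewrite nth_take.
  by rewrite !nth_default ?size_droplast //; lia.
by rewrite nth_default // size_droplast H.
Qed.

Lemma comp_atomicP s m c : simul s m ->
  if c is (Set_ _ _ | Push _ _ | PopB _ | PopF _ | Clr _) then
    simul (denote c s) (effect m (comp_atomic c))
  else True.
Proof.
move=> rm; case: c => // [r e|d e|d|d|d].
- rewrite /comp_atomic effect_cat copyE ?addrE //.
  have [-> _] := comp_exprP e 0 rm; apply: set_regP; exact: simul_comp_expr.
- rewrite /comp_atomic effect_cat effect_cat copyE ?addrE // effect_cat load_cell_addrE.
  have [E0 _] := comp_exprP e 0 rm; have := simul_comp_expr e 0 rm.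
  move: (effect m (comp_expr e 0)) E0 => {rm}m E0 rm; have [H1 H2 H3] := rm.
  apply: (set_dequeP rm) => [r|d' b ne|d' p ne||i]; rewrite /= /ram_set !addrE /= ?(negPf ne) //.
  + by rewrite ?andbF ?eqxx /= H2 size_rcons addn1 addnS.
  + rewrite ?andbF ?eqxx /= H2 eqn_add2l E0 nth_rcons.
    case: (ltngtP i (size (deque s d))) => H //; rewrite H3 //.
    by rewrite nth_default // ltnW.
- have [E0 rm0] := nonemptyE d rm.
  rewrite /comp_atomic !effect_cat.
  move: (effect m (nonempty d)) E0 rm0 => {rm}m E0 rm; have [H1 H2 H3] := rm.
  rewrite [effect m [:: _]]/= copyE ?addrE // load_cell_addrE.
  apply: (set_dequeP rm) => [r|d' b ne|d' p ne||i]; rewrite /= /ram_set !addrE /= ?(negPf ne) //.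
  + by rewrite ?andbF ?eqxx /= H2 E0 size_droplast; case: (size (deque s d)) => [|n] /=; lia.
  + rewrite ?andbF ?eqxx /= H2 E0 H3 nth_droplast -addnBA; last by case: (size _).
    have -> : size (deque s d) - (0 < size (deque s d)) = (size (deque s d)).-1.
      by case: (size (deque s d)) => [|n] /=; lia.
    by rewrite eqn_add2l.
- have [E0 rm0] := nonemptyE d rm.
  rewrite /comp_atomic !effect_cat.
  move: (effect m (nonempty d)) E0 rm0 => {rm}m E0 rm; have [H1 H2 H3] := rm.
  apply: (set_dequeP rm) => [r|d' b ne|d' p ne||i]; rewrite /= /ram_set !addrE /= ?(negPf ne) //.
  + by rewrite ?andbF ?eqxx /= H2 E0 size_behead; case: (size (deque s d)) => [|n] /=; lia.
  + rewrite ?andbF ?eqxx /= E0 nth_behead -addnA H3.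
    by case: (deque s d) => //=; rewrite ?add1n // !nth_nil.
- rewrite /comp_atomic copyE ?addrE ?andbF //; have [H1 H2 H3] := rm.
  apply: (set_dequeP rm) => [r|d' b ne|d' p ne||i]; rewrite /= /ram_set !addrE /= ?(negPf ne) //.
  + by rewrite ?andbF ?eqxx /= addn0.
  + by rewrite ?andbF ?eqxx /= H2 -addnA H3 !nth_default // leq_addr.
Qed.

Lemma comp_atomic_plain c : all plain (comp_atomic c).
Proof. by case: c => // *; rewrite /comp_atomic !all_cat ?comp_expr_plain ?load_cell_addr_plain. Qed.

(** Jump targets are absolute, whence the argument [pc]. An unconditional jump is obtained by first
    putting 1 into a temporary. *)
Fixpoint comp_cmd pc c : seq ram_instr :=
  match c with
  | Skip => [::]
  | Inp r => [:: RRead (reg_addr r)]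
  | Sq c1 c2 => let k1 := comp_cmd pc c1 in k1 ++ comp_cmd (pc + size k1) c2
  | If e c1 c2 =>
      let p2 := (pc + size (comp_expr e 0)).+1 in
      let k2 := comp_cmd p2 c2 in
      let p1 := (p2 + size k2).+2 in
      let k1 := comp_cmd p1 c1 in
      comp_expr e 0 ++ [:: RJumpPos (tmp_addr 0) p1] ++ k2 ++
        [:: RConst (tmp_addr 0) 1; RJumpPos (tmp_addr 0) (p1 + size k1)] ++ k1
  | _ => comp_atomic c
  end.

Lemma comp_atomic_ok P pc s m c inp : simul (denote c s) (effect m (comp_atomic c)) ->
  code_at P pc (comp_atomic c) -> tape (denote c s) = inp ->
  exists t m', [/\ t <= size (comp_atomic c),
    rsteps P t (RamState pc m inp) (RamState (pc + size (comp_atomic c)) m' (tape (denote c s)))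
    & simul (denote c s) m'].
Proof.
move=> rm Pc Ei; exists (size (comp_atomic c)), (effect m (comp_atomic c)); split=> //.
by rewrite Ei; apply: rsteps_plain => //; apply: comp_atomic_plain.
Qed.

Lemma comp_cmdP P pc s m c : simul s m -> code_at P pc (comp_cmd pc c) ->
  exists t m', [/\ t <= size (comp_cmd pc c),
    rsteps P t (RamState pc m (tape s)) (RamState (pc + size (comp_cmd pc c)) m' (tape (denote c s)))
    & simul (denote c s) m'].
Proof.
elim: c pc s m => [|r e|d e|d|d|d|r|c1 IH1 c2 IH2|e c1 IH1 c2 IH2] pc s m rm Pc.
- by exists 0, m; split; rewrite ?addn0.
- exact: (comp_atomic_ok (comp_atomicP (Set_ r e) rm) Pc).
- exact: (comp_atomic_ok (comp_atomicP (Push d e) rm) Pc).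
- exact: (comp_atomic_ok (comp_atomicP (PopB _ d) rm) Pc).
- exact: (comp_atomic_ok (comp_atomicP (PopF _ d) rm) Pc).
- exact: (comp_atomic_ok (comp_atomicP (Clr _ d) rm) Pc).
- exists 1, (ram_set m (reg_addr r) (head 0 (tape s))); split=> //.
    have /code_at_cons [E _] := Pc.
    by rewrite /= E addn1; eexists.
  have [H1 H2 H3] := rm; have [K1 K2 K3] := set_regP r (head 0 (tape s)) rm.
  by split.
- have /code_at_cat [Pc1 Pc2] := Pc.
  have [t1 [m1 [T1 R1 rm1]]] := IH1 _ _ _ rm Pc1.
  have [t2 [m2 [T2 R2 rm2]]] := IH2 _ _ _ rm1 Pc2.
  exists (t1 + t2), m2; split=> //; first by rewrite /= size_cat leq_add.
  rewrite /= size_cat addnA; exact: rsteps_cat R1 R2.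
move: Pc; rewrite /=; set E := comp_expr e 0; set p2 := (pc + size E).+1.
set k2 := comp_cmd p2 c2; set p1 := (p2 + size k2).+2; set k1 := comp_cmd p1 c1.
move=> /code_at_cat [PE /code_at_cons[PJ /code_at_cat[P2 /code_at_cons[PC /code_at_cons[PJ2 P1]]]]].
have [E0 _] := comp_exprP e 0 rm; have rm0 := simul_comp_expr e 0 rm; rewrite -/E in E0 rm0.
have RE := rsteps_plain m (tape s) (comp_expr_plain e 0) PE; rewrite -/E in RE.
rewrite !size_cat /= !size_cat /=.
case: ifP => ev0.
  have [t [m' [T R rm']]] := IH1 p1 _ _ rm0 P1.
  exists (size E + (1 + t)), m'; split=> //.
    by move: T; rewrite -/k1; lia.
  apply: rsteps_cat RE _; eexists; first by rewrite /ram_step PJ E0 ev0.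
  by move: R; rewrite -/k1 /p1 /p2; congr (rsteps _ _ _ (RamState _ _ _)); lia.
have [t [m' [T R rm']]] := IH2 p2 _ _ rm0 P2.
exists (size E + (1 + (t + 2))), (ram_set m' (tmp_addr 0) 1); split=> //.
- by move: T; rewrite -/k2; lia.
- apply: rsteps_cat RE _; eexists; first by rewrite /ram_step PJ E0 ev0.
  apply: rsteps_cat R _; rewrite -/k2.
  eexists; first by rewrite /ram_step /p2 PC.
  eexists; first by rewrite /ram_step PJ2 /ram_set eqxx.
  by rewrite /= /p1 /p2; congr (RamState _ _ _); lia.
- exact: simul_tmp.
Qed.

Definition comp_item pc (q : item) : seq ram_instr :=
  match q with
  | Blk c => comp_cmd pc c
  | Whl e c =>
      let p1 := (pc + size (comp_expr e 0)).+3 in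
      let k1 := comp_cmd p1 c in
      comp_expr e 0 ++ [:: RJumpPos (tmp_addr 0) p1; RConst (tmp_addr 0) 1;
                     RJumpPos (tmp_addr 0) (p1 + size k1).+2] ++ k1 ++
        [:: RConst (tmp_addr 0) 1; RJumpPos (tmp_addr 0) pc]
  end.

Fixpoint comp_prog pc (Q : seq item) : seq ram_instr :=
  if Q is q :: Q' then let k := comp_item pc q in k ++ comp_prog (pc + size k) Q' else [::].

(** One step of [run] passes through the code of a single item at most once, so it costs at most [B]
    instructions. *)
Lemma comp_progP P B pc Q s n s' m : run Q s n s' -> simul s m -> code_at P pc (comp_prog pc Q) ->
  size (comp_prog pc Q) <= B ->
  exists t m', [/\ t <= n * B,
    rsteps P t (RamState pc m (tape s)) (RamState (pc + size (comp_prog pc Q)) m' (tape s'))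
    & simul s' m'].
Proof.
move=> H; elim: H pc m => {Q s n s'} [s|c Q s n s' _ IH|e c Q s n s' ev0 _ IH|e c Q s n s' ev0 _ IH] pc m rm.
- by exists 0, m; split; rewrite ?addn0.
- move=> /code_at_cat[P1 P2] /=; rewrite size_cat => HB.
  have [t1 [m1 [T1 R1 rm1]]] := comp_cmdP rm P1.
  have [|t2 [m2 [T2 R2 rm2]]] := IH _ _ rm1 P2; first exact: leq_trans (leq_addl _ _) HB.
  exists (t1 + t2), m2; split=> //; first by rewrite mulSn leq_add // (leq_trans T1) // (leq_trans (leq_addr _ _) HB).
  rewrite /= addnA; exact: rsteps_cat R1 R2.
- move=> /code_at_cat[P1 P2] /=; rewrite size_cat => HB.
  have [E0 _] := comp_exprP e 0 rm; have rm0 := simul_comp_expr e 0 rm.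
  have /code_at_cat[PE /code_at_cons[PJ /code_at_cons[PC /code_at_cons[PJ2 _]]]] := P1.
  have RE := rsteps_plain m (tape s) (comp_expr_plain e 0) PE.
  have [|t2 [m2 [T2 R2 rm2]]] := IH _ _ (simul_tmp 0 1 rm0) P2; first exact: leq_trans (leq_addl _ _) HB.
  exists (size (comp_expr e 0) + (3 + t2)), m2; split=> //.
    rewrite mulSn; move: HB; rewrite /= !size_cat /=; lia.
  apply: rsteps_cat RE _; eexists; first by rewrite /ram_step PJ E0 ev0.
  eexists; first by rewrite /ram_step PC.
  eexists; first by rewrite /ram_step PJ2 /ram_set eqxx.
  rewrite addnA; move: R2 => /=; congr (rsteps _ _ (RamState _ _ _) _).
  by rewrite !size_cat /= size_cat /=; lia.
- move=> Pall HB; have /code_at_cat[P1 P2] := Pall.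
  have [E0 _] := comp_exprP e 0 rm; have rm0 := simul_comp_expr e 0 rm.
  have /code_at_cat[PE /code_at_cons[PJ /code_at_cons[PC /code_at_cons[PJ2 /code_at_cat[Pb /code_at_cons[PC3 /code_at_cons[PJ3 _]]]]]]] := P1.
  have RE := rsteps_plain m (tape s) (comp_expr_plain e 0) PE.
  have [t1 [m1 [T1 R1 rm1]]] := comp_cmdP rm0 Pb.
  have [|t2 [m2 [T2 R2 rm2]]] := IH _ _ (simul_tmp 0 1 rm1) Pall; first by [].
  exists (size (comp_expr e 0) + (1 + (t1 + (2 + t2)))), m2; split=> //.
    by rewrite mulSn; move: HB T1 T2; rewrite /= !size_cat /= !size_cat /=; lia.
  apply: rsteps_cat RE _; eexists; first by rewrite /ram_step PJ E0 ev0.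
  apply: rsteps_cat R1 _.
  eexists; first by rewrite /ram_step PC3.
  eexists; first by rewrite /ram_step PJ3 /ram_set eqxx.
  exact: R2.
Qed.

Definition compile (Q : seq item) e : ram_program :=
  let k := comp_prog 0 Q in
  k ++ comp_expr e 0 ++ [:: RJumpPos (tmp_addr 0) (size k + size (comp_expr e 0)).+2; RHalt false; RHalt true].

Definition init_state inp : state := St (fun=> 0) (fun=> [::]) inp.

Lemma compileP Q e inp n s : run Q (init_state inp) n s ->
  ram_run (compile Q e) (n.+1 * size (compile Q e)) (ram_init inp) = Some (0 < eval e s).
Proof.
move=> H; pose P := compile Q e.
have rm : simul (init_state inp) (fun=> 0) by split=> *; rewrite //= nth_nil.
have aP : code_at P 0 P by [].
have /code_at_cat[P1 /code_at_cat[P2 P3]] := aP.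
have [|t [m [T R rm1]]] := @comp_progP P (size P) 0 Q _ n _ _ H rm P1.
  by rewrite /P /compile size_cat leq_addr.
have [E0 _] := comp_exprP e 0 rm1.
have RE := rsteps_plain m (tape s) (comp_expr_plain e 0) P2.
have /code_at_cons[PJ /code_at_cons[PF /code_at_cons[PT _]]] := P3.
rewrite !add0n in R RE PJ PF PT P2.
have R2 := rsteps_cat R RE.
have sz : size P = size (comp_prog 0 Q) + (size (comp_expr e 0) + 3).
  by rewrite /P /compile !size_cat.
(* The 2 stands for the final jump and the halt; the unspent time is absorbed by [ram_run_mono]. *)
have -> : n.+1 * size (compile Q e) = (t + size (comp_expr e 0)) + 2 +
    (n.+1 * size P - (t + size (comp_expr e 0) + 2)).
  by rewrite -/P mulSn subnKC //; lia.
apply: ram_run_mono; apply: rsteps_run R2 _; rewrite /ram_run /ram_step PJ E0.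
by case: ifP => _; rewrite ?PF ?PT.
Qed.

End Compile.

(** * The program: reading and reducing the input *)

Section Runs.
Variables (rg : countType) (D : finType).
Notation state := (state rg D).
Notation expr := (expr rg D).
Notation cmd := (cmd rg D).
Implicit Types (s : state) (e : expr) (c : cmd).

Lemma run_cat (Q1 Q2 : seq (item rg D)) s n1 s1 n2 s2 :
  run Q1 s n1 s1 -> run Q2 s1 n2 s2 -> run (Q1 ++ Q2) s (n1 + n2) s2.
Proof.
elim=> {Q1 s n1 s1} [s|c Q s n s' _ IH|e c Q s n s' ev0 _ IH|e c Q s n s' ev0 _ IH] //= H.
- by apply: RunBlk; apply: IH.
- by apply: RunWhl0 => //; apply: IH.
- by apply: RunWhlS => //; apply: IH.
Qed.

(** The index of the invariant is also the variant of the loop, so its initial value bounds the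
    number of rounds. *)
Lemma run_whl e c (I : nat -> state -> Prop) k s : I k s ->
  (forall k s, I k s -> 0 < eval e s -> exists2 k', k' < k & I k' (denote c s)) ->
  exists n s' k', [/\ run [:: Whl e c] s n s', n <= k.+1, I k' s' & eval e s' = 0].
Proof.
move=> I0 H; have [m] := ubnP k; elim: m => // m IHm in k s I0 * => km.
case: (posnP (eval e s)) => [ev0|evS].
  by exists 1, s, k; split=> //; apply: RunWhl0 => //; apply: RunNil.
have [k' kk Ik'] := H k s I0 evS.
have [|n [s' [k2 [R nk I2 ev0]]]] := IHm _ _ Ik'; first by lia.
exists n.+1, s', k2; split=> //; last by lia.
by apply: RunWhlS.
Qed.

Lemma denoteIf e c1 c2 s : denote (If e c1 c2) s = if 0 < eval e s then denote c1 s else denote c2 s.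
Proof. by []. Qed.

Lemma denoteSq c1 c2 s : denote (Sq c1 c2) s = denote c2 (denote c1 s).
Proof. by []. Qed.

Lemma denoteSet r e s : denote (Set_ r e) s = set_reg s r (eval e s).
Proof. by []. Qed.

(** The absolute difference, from two truncated ones. *)
Definition eneq e1 e2 : expr := EAdd (ESub e1 e2) (ESub e2 e1).
Definition eeq e1 e2 : expr := ESub (ECst _ _ 1) (eneq e1 e2).
Definition efront d : expr := EGet d (ECst _ _ 0).
Definition eback d : expr := EGet d (ESub (ESiz _ d) (ECst _ _ 1)).
Definition emul k e : expr := iter k (EAdd e) (ECst _ _ 0).

Lemma eneqP e1 e2 s : (0 < eval (eneq e1 e2) s) = (eval e1 s != eval e2 s).
Proof. by rewrite /=; lia. Qed.

Lemma eeqP e1 e2 s : (0 < eval (eeq e1 e2) s) = (eval e1 s == eval e2 s).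
Proof. by rewrite /=; lia. Qed.

Lemma efrontE d s : eval (efront d) s = head 0 (deque s d).
Proof. by rewrite /= nth0. Qed.

Lemma ebackE d s : eval (eback d) s = last 0 (deque s d).
Proof. by rewrite /= subn1 nth_last. Qed.

Lemma emulE k e s : eval (emul k e) s = k * eval e s.
Proof. by elim: k => //= k ->; rewrite mulSn. Qed.

Section Lists.
Variables (T : Type) (f : T -> cmd).

Definition bfor (ts : seq T) : cmd := foldr (fun t => Sq (f t)) (Skip _ _) ts.

Definition bcase (test : T -> expr) (c : cmd) (ts : seq T) : cmd :=
  foldr (fun t => If (test t) (f t)) c ts.

Lemma bcaseE test c ts s x0 : let ts' := [seq t <- ts | 0 < eval (test t) s] in
  denote (bcase test c ts) s = if ts' is [::] then denote c s else denote (f (head x0 ts')) s.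
Proof. by elim: ts => //= t ts IH; case: ifP => //= _; rewrite IH. Qed.

End Lists.

Lemma set_reg_id s r : set_reg s r (reg s r) = s.
Proof.
case: s => m q i; congr St; apply: funext => x; rewrite /upd.
by case: eqP => [->|].
Qed.

Lemma set_regK s r v v' : set_reg (set_reg s r v) r v' = set_reg s r v'.
Proof.
by congr St; apply: funext => x; rewrite /= /upd; case: eqP.
Qed.

Lemma clear_ifE T (e : T -> expr) r ts s :
  (forall t v, eval (e t) (set_reg s r v) = eval (e t) s) ->
  denote (bfor (fun t => If (e t) (Set_ r (ECst _ _ 0)) (Skip _ _)) ts) s =
  set_reg s r (if has (fun t => 0 < eval (e t) s) ts then 0 else reg s r).
Proof.
elim: ts s => [|t ts IH] s H; first by rewrite set_reg_id.
rewrite [LHS]/=; case: ifP => et; last by rewrite IH //= et.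
rewrite IH => [|t' v]; last by rewrite set_regK !H.
rewrite set_regK /= et /=; congr set_reg.
by rewrite /upd eqxx; case: ifP.
Qed.

End Runs.

Section Program.
Variables (N : nat) (dep : rel 'I_N).
Hypotheses (dep_refl : reflexive dep) (dep_sym : symmetric dep).
Implicit Types (l : letter N) (u v w x y : word N) (i j : 'I_N) (b : bool).

Definition rg : countType := ((bool * 'I_N) + nat)%type.
Definition deques : finType := ((bool * 'I_N) + bool)%type.
Notation state := (state rg deques).
Notation expr := (expr rg deques).
Notation cmd := (cmd rg deques).
Notation item := (item rg deques).
Implicit Types s : state.

Definition count_reg b j : rg := inl (b, j).
Definition scratch (k : nat) : rg := inr k.
Definition stack b j : deques := inl (b, j).
Definition outq b : deques := inr b.

Lemma cr_inj b j b' j' : (count_reg b j == count_reg b' j') = (b == b') && (j == j').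
Proof. by rewrite /count_reg -xpair_eqE. Qed.
Lemma sr_inj k k' : (scratch k == scratch k') = (k == k'). Proof. by []. Qed.
Lemma cr_sr b j k : (count_reg b j == scratch k) = false. Proof. by []. Qed.
Lemma sr_cr b j k : (scratch k == count_reg b j) = false. Proof. by []. Qed.
Lemma sk_inj b j b' j' : (stack b j == stack b' j') = (b == b') && (j == j').
Proof. by rewrite /stack -xpair_eqE. Qed.
Lemma sk_ot b j b' : (stack b j == outq b') = false. Proof. by []. Qed.
Lemma ot_sk b j b' : (outq b' == stack b j) = false. Proof. by []. Qed.
Lemma ot_inj b b' : (outq b == outq b') = (b == b'). Proof. by []. Qed.
Definition regE := (cr_inj, sr_inj, cr_sr, sr_cr, sk_inj, sk_ot, ot_sk, ot_inj).

(* Current letter, loop condition of the cyclic reduction, answer, size of the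
   component, loop counter of the greedy rotation; then the two starting points,
   the length of the match and the loop condition of the comparison. *)
Definition rx := scratch 0.
Definition rgo := scratch 1.
Definition rok := scratch 2.
Definition rn := scratch 3.
Definition rt := scratch 4.
Definition ri := scratch 5.
Definition rj := scratch 6.
Definition rk := scratch 7.
Definition rc := scratch 8.

Notation cst := (@ECst rg deques).
Notation skip := (@Skip rg deques).
Notation rd r := (@EReg rg deques r).
Notation set := (@Set_ rg deques).
Notation back := (@eback rg deques).

Definition set_stacks s b (p : 'I_N -> seq nat) : state :=
  St (reg s) (fun d => if d is inl (b', j) then if b' == b then p j else deque s d else deque s d)
     (tape s).

(** Without repetitions in [js] each stack is changed once, from its original contents, so the
    updates act as if simultaneous. *)
Lemma denote_bfor_stacks b js (f : 'I_N -> cmd) (g : 'I_N -> seq nat -> seq nat) s :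
  uniq js ->
  (forall j s, denote (f j) s = set_deque s (stack b j) (g j (deque s (stack b j)))) ->
  denote (bfor f js) s =
  set_stacks s b (fun j => if j \in js then g j (deque s (stack b j)) else deque s (stack b j)).
Proof.
move=> + Hf; elim: js s => [|j js IH] s /=.
  move=> _; case: s => m q i; congr St; apply: funext => -[[b' j]|b'] //=.
  by case: eqP => // ->.
case/andP=> jjs ujs; rewrite IH // Hf; congr St; apply: funext => -[[b' j']|b'] //=.
rewrite /upd -/(stack b' j') -/(stack b j) !regE inE !eqxx /=.
case: (b' =P b) => [_|_] //=; case: (j' =P j) => [->|_] //=.
by rewrite (negPf jjs).
Qed.

Definition nbrs l : seq 'I_N := [seq j <- enum 'I_N | dep j l.1].

Lemma mem_nbrs l j : (j \in nbrs l) = dep j l.1.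
Proof. by rewrite mem_filter mem_enum andbT. Qed.

Lemma uniq_nbrs l : uniq (nbrs l).
Proof. by rewrite filter_uniq ?enum_uniq. Qed.

Definition letters : seq (letter N) :=
  [seq ((j, b) : letter N) | j <- enum 'I_N, b <- [:: false; true]].

Lemma mem_letters l : l \in letters.
Proof.
case: l => j b; apply/allpairsP; exists (j, b); split=> //=; first by rewrite mem_enum.
by case: b; rewrite !inE.
Qed.

Definition push b l : cmd :=
  Sq (bfor (fun j => Push (stack b j) (cst (entry j l))) (nbrs l))
     (set (count_reg b l.1) (EAdd (rd (count_reg b l.1)) (cst 1))).

Definition pop b l : cmd :=
  Sq (bfor (fun j => PopB rg (stack b j)) (nbrs l))
     (set (count_reg b l.1) (ESub (rd (count_reg b l.1)) (cst 1))).

Definition popboth b l : cmd :=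
  Sq (bfor (fun j => Sq (PopF rg (stack b j)) (PopB rg (stack b j))) (nbrs l))
     (set (count_reg b l.1) (ESub (rd (count_reg b l.1)) (cst 2))).

Lemma set_dequeK s d q q' : set_deque (set_deque s d q) d q' = set_deque s d q'.
Proof. by congr St; apply: funext => x; rewrite /= /upd; case: eqP. Qed.

Lemma pushE b l s : denote (push b l) s =
  set_reg (set_stacks s b (fun j => if dep j l.1 then rcons (deque s (stack b j)) (entry j l)
                                else deque s (stack b j)))
    (count_reg b l.1) (reg s (count_reg b l.1)).+1.
Proof.
rewrite /push [LHS]/= (denote_bfor_stacks (b := b) (g := fun j q => rcons q (entry j l))) ?uniq_nbrs //.
by rewrite /= addn1; under [in LHS]eq_fun => j do rewrite mem_nbrs.
Qed.

Lemma popE b l s : denote (pop b l) s =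
  set_reg (set_stacks s b (fun j => if dep j l.1 then droplast (deque s (stack b j)) else deque s (stack b j)))
    (count_reg b l.1) (reg s (count_reg b l.1)).-1.
Proof.
rewrite /pop [LHS]/= (denote_bfor_stacks (b := b) (g := fun j q => droplast q)) ?uniq_nbrs //.
by rewrite /= subn1; under [in LHS]eq_fun => j do rewrite mem_nbrs.
Qed.

Lemma popbothE b l s : denote (popboth b l) s =
  set_reg (set_stacks s b (fun j => if dep j l.1 then droplast (behead (deque s (stack b j)))
                                else deque s (stack b j)))
    (count_reg b l.1) (reg s (count_reg b l.1) - 2).
Proof.
rewrite /popboth [LHS]/= (denote_bfor_stacks (b := b) (g := fun j q => droplast (behead q))) ?uniq_nbrs //.
  by under [in LHS]eq_fun => j do rewrite mem_nbrs.
move=> j s'; rewrite /= set_dequeK; congr set_deque.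
by rewrite /upd eqxx.
Qed.

Definition side s b u :=
  (forall j, deque s (stack b j) = pile dep u j) /\ (forall j, reg s (count_reg b j) = count_gen j u).

Definition act b l : cmd :=
  If (eeq (back (stack b l.1)) (cst (3 - sgn l))) (pop b l) (push b l).

Definition read_word b : seq item :=
  [:: Blk (Inp deques rx);
      Whl (rd rx)
        (Sq (bcase (act b) (fun l => eeq (rd rx) (cst (letter_code l))) skip letters)
            (Inp deques rx))].

Lemma stack_set_stacks s b p r (v : nat) b' j :
  deque (set_reg (set_stacks s b p) r v) (stack b' j) = if b' == b then p j else deque s (stack b' j).
Proof. by []. Qed.

Lemma side_other s b p r (v : nat) b' u : b' != b -> (forall j, count_reg b' j != r) ->
  side s b' u -> side (set_reg (set_stacks s b p) r v) b' u.
Proof.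
move=> ne H [H1 H2]; split=> j; rewrite /= ?(negPf ne) -?/(stack b' j) //.
by rewrite /upd (negPf (H j)).
Qed.

Lemma count_gen_rcons j u l : count_gen j (rcons u l) = count_gen j u + (l.1 == j).
Proof. by rewrite /count_gen -cats1 count_cat /= addn0. Qed.

Lemma trace_eq_count_gen j u v : trace_eq dep u v -> count_gen j u = count_gen j v.
Proof. by move/trace_eq_perm/permP; apply. Qed.

Lemma act_step b s u l : reduced dep u -> side s b u -> exists u',
  [/\ reduced dep u', side (denote (act b l) s) b u', size u' <= (size u).+1,
      (trace_eq dep u (rcons u' (letter_inv l)) \/ u' = rcons u l) &
      forall v, side s (~~ b) v -> side (denote (act b l) s) (~~ b) v].
Proof.
move=> ru [s1 s2]; rewrite /act denoteIf eeqP ebackE s1.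
case: ifP => [/eqP E|/negbT ne].
  move: E; rewrite [eval _ _]/= -sgn_inv => /(@last_pile _ _ dep_refl dep_sym (letter_inv l)) [v uv].
  have /reduced_rcons [//|rv _] := reduced_trace_eq dep_sym uv ru.
  exists v; split=> //.
  - rewrite popE; split=> j.
      rewrite stack_set_stacks eqxx s1 (trace_eq_pile dep_sym uv) pile_rcons.
      by case: (dep j l.1); rewrite ?droplast_rcons.
    rewrite /= /upd !regE !s2 eqxx /= !(trace_eq_count_gen _ uv) !count_gen_rcons /= eqxx addn1.
    by case: eqP => [->|/eqP/negPf ne] //; rewrite eq_sym ne addn0.
  - by rewrite (trace_eq_size uv) size_rcons; lia.
  - by left.
  - move=> w; rewrite popE; apply: side_other; first by case: (b).
    by move=> j; rewrite regE; case: (b).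
exists (rcons u l); split.
- exact/reduced_rcons.
- rewrite pushE; split=> j.
    by rewrite stack_set_stacks eqxx s1 pile_rcons.
  rewrite /= /upd !regE !s2 eqxx /= count_gen_rcons.
  by case: eqP => [->|/eqP/negPf ne']; rewrite ?eqxx ?addn1 // eq_sym ne' addn0.
- by rewrite size_rcons.
- by right.
- move=> w; rewrite pushE; apply: side_other; first by case: (b).
  by move=> j; rewrite regE; case: (b).
Qed.

End Program.

Lemma letter_code_inj N : injective (@letter_code N).
Proof.
move=> [i b] [j c]; rewrite /letter_code /= => E.
have [ij bc] : (i : nat) = j /\ b = c by case: b c E => -[]; split=> //; lia.
by rewrite (val_inj ij) bc.
Qed.

Lemma letter_code_gt0 N (x : letter N) : 0 < letter_code x.
Proof. by rewrite /letter_code; case: ifP. Qed.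

Section BCase.
Variables (rg : countType) (D : finType) (T : eqType) (f : T -> cmd rg D).
Implicit Types s : state rg D.

Lemma bcase_only test c ts s x : x \in ts ->
  (forall t, t \in ts -> (0 < eval (test t) s) = (t == x)) ->
  denote (bcase f test c ts) s = denote (f x) s.
Proof.
elim: ts => // t ts IH; rewrite inE => xts H; rewrite [bcase _ _ _ _]/= denoteIf.
rewrite (H t) ?mem_head //; case: (eqVneq t x) => [->//|ne].
apply: IH; last by move=> t' t'ts; apply: H; rewrite inE t'ts orbT.
by case/orP: xts => // /eqP E; rewrite E eqxx in ne.
Qed.

Lemma bcase_cases test c ts s :
  (exists t, [/\ t \in ts, 0 < eval (test t) s & denote (bcase f test c ts) s = denote (f t) s]) \/
  (forall t, t \in ts -> eval (test t) s = 0) /\ denote (bcase f test c ts) s = denote c s.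
Proof.
elim: ts => [|t ts IH]; first by right.
rewrite [bcase _ _ _ _]/= denoteIf; case: ifP => et.
  by left; exists t; split; rewrite ?mem_head.
case: IH => [[t' [t'ts e' E]]|[H E]].
  by left; exists t'; split; rewrite // inE t'ts orbT.
right; split=> // t'; rewrite inE => /orP[/eqP ->|]; last exact: H.
by apply/eqP; rewrite -leqn0 leqNgt et.
Qed.

End BCase.

Section Phases.
Variables (N : nat) (C : seq ('I_N * 'I_N)).
Implicit Types (l : letter N) (u v w x y : word N) (i j : 'I_N) (b : bool).
Let dep_refl := raag_dep_refl C.
Let dep_sym := raag_dep_sym C.
Notation dep := (raag_dep C).
Notation rg := (rg N).
Notation deques := (deques N).
Notation state := (state rg deques).
Notation expr := (expr rg deques).
Notation cmd := (cmd rg deques).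
Notation item := (item rg deques).
Notation cst := (@ECst rg deques).
Notation skip := (@Skip rg deques).
Notation rd r := (@EReg rg deques r).
Notation set := (@Set_ rg deques).
Notation front := (@efront rg deques).
Notation back := (@eback rg deques).
Notation side := (side dep).
Notation act := (act dep).
Notation reduced := (reduced dep).
Notation cyc_reduced := (cyc_reduced dep).
Notation elt := (elt_of (commutation_relations C)).
Notation rx := (rx N).
Notation rgo := (rgo N).
Implicit Types s : state.

Lemma side_eq s s' b u : (forall j, deque s' (stack b j) = deque s (stack b j)) ->
  (forall j, reg s' (count_reg b j) = reg s (count_reg b j)) -> side s b u -> side s' b u.
Proof. by move=> Ed Er [H1 H2]; split=> j; rewrite ?Ed ?Er. Qed.

Lemma tape_act b l s : tape (denote (act b l) s) = tape s.
Proof. by rewrite /act denoteIf; case: ifP; rewrite ?popE ?pushE. Qed.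

Lemma read_wordP b s w rest : tape s = map (@letter_code N) w ++ 0 :: rest ->
  side s b [::] -> exists n s' u,
  [/\ run (read_word dep b) s n s', n <= (size w).+2, tape s' = rest &
   [/\ side s' b u, reduced u, size u <= size w, elt u = elt w &
      forall v, side s (~~ b) v -> side s' (~~ b) v]].
Proof.
move=> ts sd.
(* The tape is one symbol ahead: the first letter of the unread part [w2], or the end marker 0, is
   already in [rx]. *)
pose I k s1 := exists w1 w2 u, [/\ w = w1 ++ w2, k = size w2,
   reg s1 rx = head 0 (map (@letter_code N) w2),
   tape s1 = behead (map (@letter_code N) w2 ++ 0 :: rest) &
   [/\ side s1 b u, reduced u, size u <= size w1, elt u = elt w1 &
      forall v, side s (~~ b) v -> side s1 (~~ b) v]].
have [|k s1 [w1 [w2 [u [Ew Ek Er Et [sd1 ru su eu Ho]]]]] ev0|n [s' [k' [R nk I' ev0]]]] :=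
  @run_whl _ _ (rd rx) (Sq (bcase (act b) (fun l => eeq (rd rx) (cst (letter_code l))) skip (letters N))
            (Inp deques rx)) I (size w) (denote (Inp deques rx) s).
- exists [::], w, [::]; split=> //.
  + by rewrite /= /upd eqxx ts; case: (w).
  + by rewrite /= ts.
- case: w2 Ew Ek Er Et => [|l w2] Ew Ek Er Et; first by rewrite /= Er in ev0.
  exists (size w2); first by rewrite Ek.
  rewrite denoteSq (@bcase_only _ _ _ _ _ _ _ _ l); last first.
  + move=> t _; rewrite eeqP /= Er /=; rewrite eq_sym; exact: inj_eq (@letter_code_inj N) _ _.
  + exact: mem_letters.
  have [u' [ru' sd' su' Hu' Ho']] := act_step dep_refl dep_sym l ru sd1.
  exists (rcons w1 l), w2, u'; split=> //.
  + by rewrite cat_rcons.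
  + by rewrite /= /upd eqxx tape_act Et; case: (w2).
  + by rewrite [LHS]/= tape_act Et.
  + split=> //.
    * by rewrite size_rcons; lia.
    * rewrite elt_rcons -eu; case: Hu' => [/elt_trace_eq ->|->]; last by rewrite elt_rcons.
      by rewrite elt_rcons elt_letter_inv mulgVK.
    * by move=> v0 /Ho /Ho' sv; apply: side_eq sv.
- have [w1 [w2 [u [Ew Ek Er Et [sd1 ru su eu Ho]]]]] := I'.
  have w20 : w2 = [::].
    by case: w2 Er {Ew Ek Et} => // l w2; rewrite /= in ev0; rewrite ev0 /=; have := letter_code_gt0 l; lia.
  rewrite w20 cats0 in Ew Et; exists n.+1, s', u; split=> //.
    exact: RunBlk.
  by rewrite Ew.
Qed.

Definition inv_ends b l : expr :=
  eeq (EAdd (eneq (front (stack b l.1)) (cst (sgn l)))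
            (eneq (back (stack b l.1)) (cst (3 - sgn l)))) (cst 0).

Definition reduce b : seq item :=
  [:: Blk (set rgo (cst 1));
      Whl (rd rgo)
        (bcase (popboth dep b) (inv_ends b) (set rgo (cst 0)) (letters N))].

Lemma reduceP b s u v : side s b u -> reduced u -> side s (~~ b) v ->
  exists n s' u', [/\ run (reduce b) s n s', n <= size u + 3, side s' b u', cyc_reduced u' &
   [/\ conjugate (elt u) (elt u'), size u' <= size u & side s' (~~ b) v]].
Proof.
move=> sd ru sv.
(* A round either shortens the word by two letters or, finding no cancelling ends, clears [rgo]; so
   the size plus [rgo] decreases. *)
pose I k s1 := exists u', [/\ side s1 b u', reduced u', size u' <= size u, conjugate (elt u) (elt u')
  & [/\ side s1 (~~ b) v, k = size u' + reg s1 rgo, reg s1 rgo <= 1 & reg s1 rgo = 0 -> cyc_reduced u']].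
have [|k s1 [u1 [sd1 ru1 su1 cu1 [sv1 Ek Eg Hc]]] ev0|n [s' [k' [R nk I' ev0]]]] :=
  @run_whl _ _ (rd rgo) (bcase (popboth dep b) (inv_ends b) (set rgo (cst 0)) (letters N)) I (size u + 1) (denote (set rgo (cst 1)) s).
- exists u; split=> //.
  + exact: conjugate_refl.
- have T l : (0 < eval (inv_ends b l) s1) =
             (head 0 (pile dep u1 l.1) == sgn l) && (last 0 (pile dep u1 l.1) == 3 - sgn l).
    have [h1 _] := sd1.
    have E1 : (eval (eneq (front (stack b l.1)) (cst (sgn l))) s1 == 0) =
              (head 0 (pile dep u1 l.1) == sgn l).
      by rewrite -[LHS]negbK -lt0n eneqP efrontE h1 negbK.
    have E2 : (eval (eneq (back (stack b l.1)) (cst (3 - sgn l))) s1 == 0) =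
              (last 0 (pile dep u1 l.1) == 3 - sgn l).
      by rewrite -[LHS]negbK -lt0n eneqP ebackE h1 negbK.
    by rewrite /inv_ends eeqP -E1 -E2 -addn_eq0.
  have [[l [_ Tl ->]]|[H ->]] := bcase_cases (popboth dep b) (inv_ends b) (set rgo (cst 0)) (letters N) s1.
    move: Tl; rewrite T => /andP[/eqP hl /eqP ll].
    have [u2 [ru2 cu2 su2 E]] := cyclic_step ru1 hl ll.
    have eg : reg (denote (popboth dep b l) s1) rgo = reg s1 rgo by rewrite popbothE.
    exists (size u2 + reg s1 rgo); first by rewrite Ek su2; lia.
    exists u2; split=> //; first 1 last.
    + by lia.
    + exact: conjugate_trans cu1 cu2.
    + split; rewrite ?eg //; last by move=> g0; move: ev0; rewrite /= g0.
      rewrite popbothE; apply: side_other sv1; first by case: (b).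
      by move=> j; rewrite regE; case: (b).
    have [h1 h2] := sd1; rewrite popbothE; split=> j.
      rewrite stack_set_stacks eqxx h1 E; case: (dep j l.1) => //=.
      by rewrite droplast_rcons.
    have cE i : count_gen i u1 = count_gen i u2 + (if i == l.1 then 2 else 0).
      have sl := sgn_le l.
      rewrite /count_gen -!(count_pile dep_refl) E; case: (eqVneq i l.1) => [->|ne].
        rewrite dep_refl /= -cats1 count_cat /= !entry_id /entry /= eqxx sgn_inv.
        have -> : 0 < 3 - sgn l by lia.
        by lia.
      rewrite /entry /= eq_sym (negPf ne); case: (dep i l.1) => //=.
        by rewrite -cats1 count_cat /= !addn0.
      by rewrite addn0.
    rewrite /= /upd !regE !h2 eqxx /= !cE eqxx.
    by case: eqP => [->|_]; rewrite ?addnK ?addn0.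
  exists (size u1); first by move: ev0; rewrite Ek /=; lia.
  exists u1; split=> //; split=> //.
  + by rewrite /= /upd eqxx addn0.
  + move=> _; apply: credP => // l hl; apply/negP=> ll.
    by have := T l; rewrite hl eqxx ll H ?mem_letters.
- have [u1 [sd1 ru1 su1 cu1 [sv1 Ek Eg Hc]]] := I'.
  exists n.+1, s', u1; split=> //; last by apply: Hc.
    exact: RunBlk.
  by lia.
Qed.

End Phases.

(** * The program: comparing one component *)

Section Blocks.
Variables (N : nat) (dep : rel 'I_N).
Hypotheses (dep_refl : reflexive dep) (dep_sym : symmetric dep).
Implicit Types (l : letter N) (u v w x y : word N) (b : bool) (ss : seq 'I_N).
Notation rg := (rg N).
Notation deques := (deques N).
Notation state := (state rg deques).
Notation expr := (expr rg deques).
Notation cmd := (cmd rg deques).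
Notation item := (item rg deques).
Notation cst := (@ECst rg deques).
Notation skip := (@Skip rg deques).
Notation rd r := (@EReg rg deques r).
Notation set := (@Set_ rg deques).
Notation front := (@efront rg deques).
Notation pile := (pile dep).
Notation outq := (outq N).
Notation rok := (rok N).
Notation rn := (rn N).
Notation rt := (rt N).
Notation ri := (ri N).
Notation rj := (rj N).
Notation rk := (rk N).
Notation rc := (rc N).
Notation code := (@letter_code N).
Implicit Types s : state.

Definition rotate b ss l : cmd :=
  Sq (Push (outq b) (cst (code l)))
     (bfor (fun j => Sq (Push (stack b j) (front (stack b j))) (PopF rg (stack b j)))
           [seq j <- ss | dep j l.1]).

Definition greedy_body b a bs : cmd :=
  Sq (bcase (rotate b (a :: bs)) (fun l => eeq (front (stack b l.1)) (cst (sgn l)))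
            skip (greedy_order a bs))
     (set rt (ESub (rd rt) (cst 1))).

Definition touched b ss (d : deques) : bool :=
  match d with inl (b', j) => (b' == b) && (j \in ss) | inr b' => b' == b end.

Definition gframe b ss s s' :=
  (forall d, ~~ touched b ss d -> deque s' d = deque s d) /\
  (forall r, r != rt -> reg s' r = reg s r).

Lemma gframe_trans b ss s2 s1 s3 : gframe b ss s1 s2 -> gframe b ss s2 s3 -> gframe b ss s1 s3.
Proof.
move=> [A1 A2] [B1 B2]; split=> [d H|r H]; first by rewrite B1 ?A1.
by rewrite B2 ?A2.
Qed.

Definition greedy_state s b ss x (o : seq nat) :=
  (forall j, j \in ss -> deque s (stack b j) = pile x j) /\ deque s (outq b) = o.

Lemma rot1_behead (q : seq nat) : behead (rcons q (head 0 q)) = rot 1 q.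
Proof. by case: q => // a q; rewrite rot1_cons. Qed.

Section Greedy.
Variables (b : bool) (a : 'I_N) (bs : seq 'I_N).
Notation ss := (a :: bs).
Hypothesis conn : connected dep ss.

Lemma rotateE l s : denote (rotate b ss l) s =
  set_stacks (set_deque s (outq b) (rcons (deque s (outq b)) (code l))) b
    (fun j => if (j \in ss) && dep j l.1 then rot 1 (deque s (stack b j)) else deque s (stack b j)).
Proof.
have us : uniq ss by case/andP: conn.
rewrite /rotate denoteSq (denote_bfor_stacks (b := b) (g := fun j q => rot 1 q)) ?filter_uniq //.
  by under [in LHS]eq_fun => j do rewrite mem_filter andbC.
move=> j s'; rewrite denoteSq; have -> : forall s', denote (PopF rg (stack b j)) s' = set_deque s' (stack b j) (behead (deque s' (stack b j))) by [].
rewrite [denote (Push _ _) _]/(set_deque _ _ _) set_dequeK; congr set_deque.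
by rewrite -rot1_behead /= /upd eqxx nth0.
Qed.

Lemma greedy_body_step s x o : spans ss x -> greedy_state s b ss x o ->
  let s' := denote (greedy_body b a bs) s in
  [/\ greedy_state s' b ss (greedy_step dep a bs x) (rcons o (code (greedy_letter dep a bs x))), gframe b ss s s' &
      reg s' rt = (reg s rt).-1].
Proof.
move=> sx [g1 g2] /=.
have -> : denote (bcase (rotate b ss) (fun l => eeq (front (stack b l.1)) (cst (sgn l))) skip
    (greedy_order a bs)) s = denote (rotate b ss (greedy_letter dep a bs x)) s.
  rewrite (bcaseE _ _ _ _ _ ((a, false) : letter N)) /=.
  have -> : [seq t <- greedy_order a bs | 0 < eval (eeq (front (stack b t.1)) (cst (sgn t))) s] =
            [seq t <- greedy_order a bs | avail dep t x].
    apply: eq_in_filter => l; rewrite mem_greedy_order => lss.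
    by rewrite eeqP efrontE g1.
  rewrite /greedy_letter; case E: [seq _ <- _ | _] => [|l t] //.
  have : greedy_letter dep a bs x \in [seq t <- greedy_order a bs | avail dep t x].
    have [av _] := gselP dep_refl conn sx.
    by rewrite mem_filter av mem_greedy_order (spans_in sx (avail_mem av)).
  by rewrite E.
set l := greedy_letter _ _ _ x; have al : avail dep l x by have [] := gselP dep_refl conn sx.
rewrite rotateE; split.
- split=> [j jss|]; last by rewrite /= /upd eqxx g2.
  by rewrite /= eqxx jss /= /greedy_step pile_rotate_to_end // /upd -/(stack b j) ?regE g1.
- split=> [[[b' j]|b'] H|r ne]; last by rewrite /= /upd (negPf ne).
    move: H; rewrite /= /upd /=.
    by case: (b' =P b) => [->|_] //= /negPf ->.
  by move: H; rewrite /= /upd -/(outq b') ot_inj => /negPf ->.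
- by rewrite /= /upd eqxx subn1.
Qed.

Lemma greedy_run s x o : spans ss x -> greedy_state s b ss x o ->
  exists n s', [/\ run [:: Whl (rd rt) (greedy_body b a bs)] s n s', n <= (reg s rt).+1,
    greedy_state s' b ss (iter (reg s rt) (greedy_step dep a bs) x) (o ++ map code (greedy_outputs dep a bs (reg s rt) x)),
    gframe b ss s s' & reg s' rt = 0].
Proof.
move=> sx gx.
pose I k s1 := exists m, [/\ m + k = reg s rt, reg s1 rt = k,
  greedy_state s1 b ss (iter m (greedy_step dep a bs) x) (o ++ map code (greedy_outputs dep a bs m x)) & gframe b ss s s1].
have [|k s1 [m [mk rk1 g1 f1]] ev0|n [s' [k' [R nk [m [mk rk1 g1 f1]] ev0]]]] :=
  @run_whl _ _ (rd rt) (greedy_body b a bs) I (reg s rt) s.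
- by exists 0; split; rewrite ?cats0.
- have sm := iter_greedy_step_spans dep_refl dep_sym conn m sx.
  have [g2 f2 r2] := greedy_body_step sm g1.
  move: ev0; rewrite /= rk1 => k0; exists k.-1; first by rewrite prednK.
  exists m.+1; split; first by lia.
  + by rewrite r2 rk1.
  + by rewrite greedy_outputs_rcons map_rcons -rcons_cat.
  + exact: gframe_trans f1 f2.
exists n, s'; split=> //.
have mE : m = reg s rt by move: ev0; rewrite /= rk1 => k0; lia.
by rewrite -mE.
Qed.

(* The outputs of the first, warm-up loop are not periodic yet and are dropped. *)
Definition greedy_block : seq item :=
  [:: Blk (set rt (emul N (rd rn))); Whl (rd rt) (greedy_body b a bs);
      Blk (Sq (Clr rg (outq b)) (set rt (EAdd (rd rn) (rd rn))));
      Whl (rd rt) (greedy_body b a bs)].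

Lemma gframe_set_rt s (v : nat) : gframe b ss s (set_reg s rt v).
Proof. by split=> // r /negPf ne; rewrite /= /upd ne. Qed.

Lemma gframe_clr s : gframe b ss s (set_deque s (outq b) [::]).
Proof.
split=> // -[[b' j]|b'] //= /negPf ne.
by rewrite /upd -/(outq b') ot_inj ne.
Qed.

(** Two periods are recorded because the comparison reads at [i + k] and [j + k] with all three
    indices below [n]. *)
Lemma greedy_blockP s x n : spans ss x -> (forall j, j \in ss -> deque s (stack b j) = pile x j) ->
  reg s rn = n -> exists m s', [/\ run greedy_block s m s', m <= (N + 2) * n + 4,
    (forall j, j \in ss -> deque s' (stack b j) = pile (iter (n + n + N * n) (greedy_step dep a bs) x) j),
    deque s' (outq b) = [seq code (greedy_output dep a bs (N * n + t) x) | t <- iota 0 (n + n)] &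
    gframe b ss s s'].
Proof.
move=> sx px rnn; pose s1 := denote (set rt (emul N (rd rn))) s.
have rt1 : reg s1 rt = N * n by rewrite /s1 /= /upd eqxx emulE /= rnn.
have f1 : gframe b ss s s1 by apply: gframe_set_rt.
have [n1 [s2 [R1 T1 [g2 _] f2 _]]] := greedy_run sx (conj px erefl : greedy_state s1 b ss x _).
rewrite rt1 in T1 g2.
pose s3 := denote (Sq (Clr rg (outq b)) (set rt (EAdd (rd rn) (rd rn)))) s2.
have rn2 : reg s2 rn = n by rewrite f2.2 // f1.2.
have rt3 : reg s3 rt = n + n by rewrite /s3 /= /upd eqxx /= rn2.
have f3 : gframe b ss s2 s3 by apply: gframe_trans (gframe_clr _) (gframe_set_rt _ _).
have g3 : greedy_state s3 b ss (iter (N * n) (greedy_step dep a bs) x) [::].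
  by split=> //; rewrite /s3 /= /upd eqxx.
have [n2 [s4 [R2 T2 g4 f4 _]]] := greedy_run (iter_greedy_step_spans dep_refl dep_sym conn _ sx) g3.
rewrite rt3 in T2 g4.
exists (1 + (n1 + (1 + n2))), s4; split.
- by apply: RunBlk; apply: run_cat R1 _; apply: RunBlk.
- by nia.
- by case: g4 => g4 _ j /g4; rewrite -iterD.
- case: g4 => _ ->; rewrite cat0s -map_comp; apply: eq_map => t /=.
  by rewrite /greedy_output -iterD addnC.
- exact: gframe_trans (gframe_trans f1 f2) (gframe_trans f3 f4).
Qed.

Lemma greedy_block0 s : reg s rn = 0 ->
  exists s', run greedy_block s 4 s' /\ gframe b [::] s s'.
Proof.
move=> n0; pose s1 := denote (set rt (emul N (rd rn))) s.
have rt1 : reg s1 rt = 0 by rewrite /s1 /= /upd eqxx emulE /= n0 muln0.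
pose s3 := denote (Sq (Clr rg (outq b)) (set rt (EAdd (rd rn) (rd rn)))) s1.
exists s3; split.
  apply: RunBlk; apply: RunWhl0 => //; apply: RunBlk; apply: RunWhl0; last exact: RunNil.
  by rewrite /= /upd eqxx /= n0.
split=> [[[b' j]|b'] H|r /negPf ne] //=; last by rewrite /upd ne.
by move: H; rewrite /= /upd -/(outq b') ot_inj => /negPf ->.
Qed.

End Greedy.

(** * Comparison of two recorded output sequences up to a shift *)

Definition cmp_left : expr := EGet (outq false) (EAdd (rd ri) (rd rk)).
Definition cmp_right : expr := EGet (outq true) (EAdd (rd rj) (rd rk)).
Definition cfail : cmd := Sq (set rc (cst 0)) (set rok (cst 0)).

Definition cmp_body : cmd :=
  If (eneq cmp_left cmp_right)
    (Sq (If (ESub cmp_left cmp_right) (set ri (EAdd (EAdd (rd ri) (rd rk)) (cst 1)))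
                         (set rj (EAdd (EAdd (rd rj) (rd rk)) (cst 1))))
    (Sq (set rk (cst 0))
        (If (ESub (rd rn) (rd ri)) (If (ESub (rd rn) (rd rj)) skip cfail) cfail)))
    (Sq (set rk (EAdd (rd rk) (cst 1)))
        (If (ESub (rd rn) (rd rk)) skip (set rc (cst 0)))).

Definition cmp_init : cmd :=
  Sq (set ri (cst 0)) (Sq (set rj (cst 0)) (Sq (set rk (cst 0)) (set rc (rd rn)))).

Definition cframe s s' := deque s' =1 deque s /\
  forall r, r \notin [:: ri; rj; rk; rc; rok] -> reg s' r = reg s r.

Lemma cframe_trans s2 s1 s3 : cframe s1 s2 -> cframe s2 s3 -> cframe s1 s3.
Proof.
by move=> [A1 A2] [B1 B2]; split=> [d|r H]; rewrite ?B1 ?A1 ?B2 ?A2.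
Qed.

Lemma cframe_set s r (v : nat) : r \in [:: ri; rj; rk; rc; rok] -> cframe s (set_reg s r v).
Proof.
move=> rin; split=> // r' r'n; rewrite /= /upd.
by case: eqP => // E; rewrite E rin in r'n.
Qed.

Section Compare.
Variables (U V : nat -> nat) (n : nat).
Hypotheses (n_gt0 : 0 < n) (Uper : forall t, U (t + n) = U t) (Vper : forall t, V (t + n) = V t).

Definition cmp_st s i j k c o :=
  [/\ reg s ri = i, reg s rj = j, reg s rk = k, reg s rc = c & reg s rok = o].

Definition cmp_found o :=
  (o = 1 /\ exists i j, forall t, t < n -> U (i + t) = V (j + t)) \/
  (o = 0 /\ forall i j, ~ forall t, U (i + t) = V (j + t)).

(** [i + j + k] grows by exactly one even at a mismatch, when the lost [k] is added to one starting
    point. This makes the comparison linear. *)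
Lemma cmp_body_step s i j k c : reg s rn = n ->
  (forall t, t < n + n -> nth 0 (deque s (outq false)) t = U t) ->
  (forall t, t < n + n -> nth 0 (deque s (outq true)) t = V t) ->
  0 < c -> i < n -> j < n -> k < n -> cmp_st s i j k c 1 -> cmp_inv U V i j k ->
  let s' := denote cmp_body s in cframe s s' /\ exists i' j' k' c' o',
   [/\ cmp_st s' i' j' k' c' o', i' + j' + k' = (i + j + k).+1 &
    (c' = 0 /\ cmp_found o') \/
    [/\ 0 < c', i' < n, j' < n & k' < n /\ cmp_inv U V i' j' k' /\ o' = 1]].
Proof.
move=> rnn hU hV c0 iN jN kN [r1 r2 r3 r4 r5] inv.
have eU : eval cmp_left s = U (i + k) by rewrite /= r1 r3 hU //; lia.
have eV : eval cmp_right s = V (j + k) by rewrite /= r2 r3 hV //; lia.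
have n0 : n > 0 by lia.
rewrite /cmp_body denoteIf eneqP eU eV; case: eqP => [E|ne]; rewrite [~~ _]/=.
  pose s1 := set_reg s rk k.+1.
  have -> : denote (Sq (set rk (EAdd (rd rk) (cst 1)))
                 (If (ESub (rd rn) (rd rk)) skip (set rc (cst 0)))) s =
            if 0 < n - k.+1 then s1 else set_reg s1 rc 0.
    by rewrite denoteSq denoteIf /s1 /= r3 addn1 /upd /= rnn.
  have f1 : cframe s s1 by apply: cframe_set.
  have inv1 := cmp_inv_eq inv E.
  case: ifP => kn.
    split=> //; exists i, j, k.+1, c, 1; split; [|lia|right].
      by split; rewrite /= /upd.
    by split=> //; split=> //; lia.
  split; first by apply: cframe_trans f1 (cframe_set _ _ _).
  exists i, j, k.+1, 0, 1; split; [|lia|left].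
    by split; rewrite /= /upd.
  split=> //; left; split=> //; exists i, j => t tn.
  by have [_ _ H] := inv1; apply: H; lia.
pose s1 := if 0 < U (i + k) - V (j + k) then set_reg s ri (i + k).+1 else set_reg s rj (j + k).+1.
pose i' := if 0 < U (i + k) - V (j + k) then (i + k).+1 else i.
pose j' := if 0 < U (i + k) - V (j + k) then j else (j + k).+1.
pose s2 := set_reg s1 rk 0.
pose s3 := set_reg (set_reg s2 rc 0) rok 0.
have f2 : cframe s s2.
  by apply: cframe_trans (cframe_set _ _ _) => //; rewrite /s1; case: ifP => _; apply: cframe_set.
have f3 : cframe s s3.
  by apply: cframe_trans f2 _; apply: cframe_trans (cframe_set _ _ _) (cframe_set _ _ _).
have st2 : cmp_st s2 i' j' 0 c 1.
  by rewrite /i' /j' /s2 /s1; case: ifP => _; split; rewrite /= /upd.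
have st3 : cmp_st s3 i' j' 0 0 0.
  by have [? ? ? ? ?] := st2; split.
have ij : i' + j' + 0 = (i + j + k).+1.
  by rewrite /i' /j'; case: ifP => _; lia.
have inv2 : cmp_inv U V i' j' 0.
  rewrite /i' /j'; case: ifP => lt; first by apply: cmp_inv_gt inv _; lia.
  by apply: cmp_inv_lt inv _; lia.
have -> : denote (Sq (If (ESub cmp_left cmp_right) (set ri (EAdd (EAdd (rd ri) (rd rk)) (cst 1)))
                         (set rj (EAdd (EAdd (rd rj) (rd rk)) (cst 1))))
    (Sq (set rk (cst 0))
        (If (ESub (rd rn) (rd ri)) (If (ESub (rd rn) (rd rj)) skip cfail) cfail))) s =
    if 0 < n - i' then if 0 < n - j' then s2 else s3 else s3.
  have E1 : denote (If (ESub cmp_left cmp_right) (set ri (EAdd (EAdd (rd ri) (rd rk)) (cst 1)))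
                         (set rj (EAdd (EAdd (rd rj) (rd rk)) (cst 1)))) s = s1.
    rewrite denoteIf -[eval (ESub _ _) _]/(eval cmp_left s - eval cmp_right s) eU eV /s1.
    by case: ifP => _; rewrite /= ?r1 ?r2 r3 addn1.
  rewrite denoteSq E1 denoteSq -[denote (set rk _) _]/s2 denoteIf.
  have [a1 a2 _ _ _] := st2.
  have rn2 : reg s2 rn = n by rewrite f2.2.
  rewrite -[eval (ESub (rd rn) (rd ri)) s2]/(reg s2 rn - reg s2 ri) rn2 a1.
  case: ifP => // _; rewrite denoteIf.
  by rewrite -[eval (ESub (rd rn) (rd rj)) s2]/(reg s2 rn - reg s2 rj) rn2 a2.
have [inv2a inv2b _] := inv2.
case: ifP => ii; [case: ifP => jj|].
- split=> //; exists i', j', 0, c, 1; split=> //; right.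
  by split=> //; lia.
(* All starting points of [V] in one period are discarded, so [shift_not_all_gt] applies with the
   two sequences exchanged. *)
- split=> //; exists i', j', 0, 0, 0; split=> //; left; split=> //; right; split=> // i1 j1 sh.
  apply: (@shift_not_all_gt V U n n_gt0 Vper Uper j1 i1) => [t|j2 j2n]; first by rewrite sh.
  by apply: inv2b; lia.
- split=> //; exists i', j', 0, 0, 0; split=> //; left; split=> //; right; split=> // i1 j1 sh.
  apply: (@shift_not_all_gt U V n n_gt0 Uper Vper i1 j1) => [t|i2 i2n]; first by rewrite sh.
  by apply: inv2a; lia.
Qed.

Lemma cmp_run s : reg s rn = n -> reg s rok = 1 ->
  (forall t, t < n + n -> nth 0 (deque s (outq false)) t = U t) ->
  (forall t, t < n + n -> nth 0 (deque s (outq true)) t = V t) ->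
  exists m s', [/\ run [:: Blk cmp_init; Whl (rd rc) cmp_body] s m s', m <= 3 * n + 3,
    cframe s s' & cmp_found (reg s' rok)].
Proof.
move=> rnn ok hU hV; pose s0 := denote cmp_init s.
have f0 : cframe s s0.
  rewrite -[s0]/(set_reg (set_reg (set_reg (set_reg s ri 0) rj 0) rk 0) rc (reg s rn)).
  do 3 (apply: cframe_trans; last exact: cframe_set).
  exact: cframe_set.
pose I k0 s1 := cframe s s1 /\ exists i j k c o, [/\ cmp_st s1 i j k c o,
   k0 + (i + j + k) = 3 * n + 1 &
   (c = 0 /\ cmp_found o) \/
    [/\ 0 < c, i < n, j < n & k < n /\ cmp_inv U V i j k /\ o = 1]].
have [|k0 s1 [f1 [i [j [k [c [o [st1 Ek H]]]]]]] ev0|m [s' [k' [R nk [f1 [i [j [k [c [o [st1 Ek H]]]]]]] ev0]]]] :=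
  @run_whl _ _ (rd rc) cmp_body I (3 * n + 1) s0.
- split=> //; exists 0, 0, 0, n, 1; split; [|by rewrite !addn0|].
    by split; rewrite /s0 /= /upd //= ?rnn ?ok.
  by right; split=> //; split=> //; split.
- have [r1 r2 r3 r4 r5] := st1.
  case: H => [[c0 _]|[c0 iN jN [kN [inv o1]]]]; first by move: ev0; rewrite /= r4 c0.
  rewrite o1 in st1.
  have rn1 : reg s1 rn = n by rewrite f1.2.
  have [t tn|t tn|f2 [i' [j' [k' [c' [o' [st2 E2 H2]]]]]]] := cmp_body_step rn1 _ _ c0 iN jN kN st1 inv.
  + by rewrite f1.1 hU.
  + by rewrite f1.1 hV.
  exists k0.-1; first by lia.
  split; first exact: cframe_trans f1 f2.
  by exists i', j', k', c', o'; split=> //; lia.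
exists m.+1, s'; split=> //; first by apply: RunBlk.
  by lia.
have [r1 r2 r3 r4 r5] := st1; rewrite r5.
by case: H => [[_ //]|[c0 _ _ _]]; move: ev0 c0; rewrite /= r4 => ->.
Qed.

End Compare.

Lemma cmp_run0 s : reg s rn = 0 ->
  exists s', run [:: Blk cmp_init; Whl (rd rc) cmp_body] s 2 s' /\
    (deque s' =1 deque s /\ forall r, r \notin [:: ri; rj; rk; rc] -> reg s' r = reg s r).
Proof.
move=> n0; exists (denote cmp_init s); split.
  by apply: RunBlk; apply: RunWhl0; [rewrite /= /upd /= n0|apply: RunNil].
split=> // r; rewrite !inE !negb_or => /and4P[/negPf h1 /negPf h2 /negPf h3 /negPf h4].
by rewrite /= /upd h1 h2 h3 h4.
Qed.

End Blocks.

(** * The program: all components *)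

Section Components.
Variables (N : nat) (dep : rel 'I_N).
Hypotheses (dep_refl : reflexive dep) (dep_sym : symmetric dep).
Implicit Types (l : letter N) (u v w x y : word N) (b : bool) (ss : seq 'I_N).
Notation rg := (rg N).
Notation deques := (deques N).
Notation state := (state rg deques).
Notation expr := (expr rg deques).
Notation cmd := (cmd rg deques).
Notation item := (item rg deques).
Notation cst := (@ECst rg deques).
Notation skip := (@Skip rg deques).
Notation rd r := (@EReg rg deques r).
Notation set := (@Set_ rg deques).
Notation pile := (pile dep).
Notation trace_conj := (trace_conj dep).
Notation outq := (outq N).
Notation rok := (rok N).
Notation rn := (rn N).
Notation rt := (rt N).
Notation rc := (rc N).
Notation code := (@letter_code N).
Notation component := (component dep).
Implicit Types s : state.

Definition outside ss : seq 'I_N := [seq j <- enum 'I_N | (j \notin ss) && has (dep j) ss].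

Definition total ss : expr := foldr (fun j => EAdd (rd (count_reg false j))) (cst 0) ss.

(* [rn] becomes 0, which disables all subsequent loops, unless the equality of
   the counts was not refuted and [ss] is a component of the support. *)
Definition setup ss : cmd :=
  Sq (set rn (total ss))
  (Sq (bfor (fun j => If (eeq (rd (count_reg false j)) (cst 0)) (set rn (cst 0)) skip) ss)
  (Sq (bfor (fun j => If (rd (count_reg false j)) (set rn (cst 0)) skip) (outside ss))
      (If (rd rok) skip (set rn (cst 0))))).

Lemma totalE ss s : eval (total ss) s = \sum_(j <- ss) reg s (count_reg false j).
Proof. by elim: ss => [|j ss IH]; rewrite ?big_nil // big_cons /= -IH. Qed.

Lemma setupE ss s : connected dep ss -> denote (setup ss) s =
  set_reg s rn (if (0 < reg s rok) && component ss (fun j => reg s (count_reg false j))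
                then \sum_(j <- ss) reg s (count_reg false j) else 0).
Proof.
move=> conn; rewrite /setup denoteSq denoteSet denoteSq clear_ifE //.
rewrite denoteSq clear_ifE // !set_regK.
set h1 := has _ ss; set h2 := has _ (outside ss).
have E1 : all (fun j => 0 < reg s (count_reg false j)) ss = ~~ h1.
  by rewrite /h1 -all_predC; apply: eq_all => j; rewrite /= /upd /=; lia.
have E2 : [forall j, (j \notin ss) ==> has (dep j) ss ==> (reg s (count_reg false j) == 0)] = ~~ h2.
  apply/forallP/hasPn => [H j|H j].
    rewrite mem_filter => /andP[/andP[jss dj] _].
    have /implyP/(_ jss)/implyP/(_ dj)/eqP E := H j.
    by rewrite /= /upd /= E.
  apply/implyP=> jss; apply/implyP=> dj.
  have := H j; rewrite mem_filter jss dj mem_enum => /(_ isT).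
  by rewrite /= /upd /= -leqNgt leqn0.
rewrite denoteIf /component conn E1 E2 /=.
case: ifP => _; rewrite ?set_regK //; congr set_reg.
by rewrite /upd eqxx totalE; case: (h1); case: (h2).
Qed.

Definition component_block (ss : seq 'I_N) : seq item :=
  if ss is a :: bs then
    Blk (setup ss) :: greedy_block dep false a bs ++ greedy_block dep true a bs ++
    [:: Blk (cmp_init N); Whl (rd rc) (cmp_body N)]
  else [::].

(* The stacks need not hold [u] and [v] themselves, only conjugates of them:
   treating a component rotates it. *)
Definition component_inv u v (done : seq (seq 'I_N)) s :=
  (forall j, reg s (count_reg false j) = count_gen j u) /\
  ((reg s rok = 0 /\ ~ trace_conj u v) \/
   [/\ reg s rok = 1, forall j, count_gen j u = count_gen j v,
    exists u' v', [/\ trace_conj u u', trace_conj v v',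
       forall j, 0 < count_gen j u -> deque s (stack false j) = pile u' j &
       forall j, 0 < count_gen j u -> deque s (stack true j) = pile v' j] &
    forall ss, ss \in done -> component ss (count_gen^~ u) -> trace_conj (restrict ss u) (restrict ss v)]).

Lemma size_restrict ss u : uniq ss -> size (restrict ss u) = \sum_(j <- ss) count_gen j u.
Proof.
move=> us; elim: u => [|x u IHu]; first by rewrite big1.
transitivity (\sum_(j <- ss) ((x.1 == j) + count_gen j u)); last by [].
rewrite big_split /= -IHu /restrict /=; case: ifP => xs.
  rewrite (bigD1_seq _ xs us) /= eqxx big1_seq ?addn0 ?add1n // => j /andP[jx _].
  by rewrite eq_sym (negPf jx).
rewrite big1_seq ?add0n // => j /andP[_ jss].
by case: eqP => // E; rewrite E jss in xs.
Qed.

Lemma trace_conj_count_gen j u v : trace_conj u v -> count_gen j u = count_gen j v.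
Proof. by move/trace_conj_perm/permP; apply. Qed.

(** With [rn] at 0 every loop is left at once: 1 step of setup, 4 for each rotation block and 2 for
    the comparison. *)
Lemma component_block_skip u v done ss s : connected dep ss -> component_inv u v done s ->
  (reg s rok = 0 \/ ~~ component ss (count_gen^~ u)) ->
  exists s', run (component_block ss) s 11 s' /\ component_inv u v (ss :: done) s'.
Proof.
move=> conn [c1 H] skip_; case: ss conn skip_ => // a bs conn skip_.
have n0 : reg (denote (setup (a :: bs)) s) rn = 0.
  rewrite setupE //= /upd eqxx; case: ifP => // /andP[ok].
  rewrite (eq_component _ _ c1).
  by case: skip_ => [E|/negPf ->] //; rewrite E in ok.
have [s1 [R1 f1]] := greedy_block0 dep false a bs n0.
have n1 : reg s1 rn = 0 by rewrite f1.2.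
have [s2 [R2 f2]] := greedy_block0 dep true a bs n1.
have n2 : reg s2 rn = 0 by rewrite f2.2.
have [s3 [R3 f3]] := cmp_run0 n2.
exists s3; split; first by apply: RunBlk; apply: (run_cat R1); apply: (run_cat R2).
have fr r : r \notin [:: rn; rt; ri N; rj N; rk N; rc] -> reg s3 r = reg s r.
  rewrite !inE !negb_or => /and5P[h1 h2 h3 h4 /andP[h5 h6]].
  rewrite f3.2 ?inE ?negb_or ?h3 ?h4 ?h5 // f2.2 // f1.2 // setupE //= /upd.
  by rewrite (negPf h1).
have fd b j : deque s3 (stack b j) = deque s (stack b j).
  have nt b' : ~~ touched b' [::] (stack b j) by rewrite /= in_nil andbF.
  by rewrite f3.1 f2.1 // f1.1 // setupE.
split=> [j|]; first by rewrite fr.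
case: H => [[ok nt]|[ok cc [u' [v' [uu' vv' pu pv]]] Hd]]; first by left; rewrite fr.
right; split=> //; first by rewrite fr.
  by exists u', v'; split=> // j cj; rewrite fd; [apply: pu|apply: pv].
move=> ss; rewrite inE => /orP[/eqP -> cs|]; last exact: Hd.
by case: skip_ => [E|/negP nc]; [rewrite E in ok|have := nc cs].
Qed.

Lemma component_block_run u v done ss s : connected dep ss -> component_inv u v done s ->
  reg s rok = 1 -> component ss (count_gen^~ u) ->
  exists m s', [/\ run (component_block ss) s m s', m <= (2 * N + 7) * size u + 12 &
    component_inv u v (ss :: done) s'].
Proof.
case: ss => // a bs conn [c1 [[ok _]|[ok cc [u' [v' [uu' vv' pu pv]]] Hd]] ok' cs].
  by rewrite ok in ok'.
set ss := a :: bs in conn cs *; have us : uniq ss by case/andP: conn.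
set n := \sum_(j <- ss) count_gen j u.
have cu j : count_gen j u' = count_gen j u by rewrite (trace_conj_count_gen j uu').
have cv j : count_gen j v' = count_gen j u by rewrite cc (trace_conj_count_gen j vv').
have csu : component ss (count_gen^~ u') by rewrite (eq_component _ _ cu).
have csv : component ss (count_gen^~ v') by rewrite (eq_component _ _ cv).
set x := restrict ss u'; set y := restrict ss v'.
have sx : size x = n by rewrite size_restrict //; apply: eq_bigr => j _; apply: cu.
have sy : size y = n by rewrite size_restrict //; apply: eq_bigr => j _; apply: cv.
have spx : spans ss x := component_spans csu.
have spy : spans ss y := component_spans csv.
have n_gt0 : 0 < n by rewrite -sx; apply: spans_neq0 spx.
have nle : n <= size u.
  by rewrite /n -(size_restrict u us) size_filter count_size.
have pos j : j \in ss -> 0 < count_gen j u by case/and3P: cs => _ /allP H _ /H.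
pose s0 := denote (setup ss) s.
have s0E : s0 = set_reg s rn n.
  rewrite /s0 setupE // ok (eq_component _ _ c1) cs /=; congr set_reg.
  by apply: eq_bigr => j _; apply: c1.
have n0 : reg s0 rn = n by rewrite s0E /= /upd eqxx.
have px0 j : j \in ss -> deque s0 (stack false j) = pile x j.
  by move=> js; rewrite s0E /= pu ?pos // pile_restrict.
have [m1 [s1 [R1 T1 p1 o1 f1]]] := greedy_blockP dep_refl dep_sym conn spx px0 n0.
have n1 : reg s1 rn = n by rewrite f1.2.
have py1 j : j \in ss -> deque s1 (stack true j) = pile y j.
  by move=> js; rewrite f1.1 // s0E /= pv ?pos // pile_restrict.
have [m2 [s2 [R2 T2 p2 o2 f2]]] := greedy_blockP dep_refl dep_sym conn spy py1 n1.
have n2 : reg s2 rn = n by rewrite f2.2.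
have ok2 : reg s2 rok = 1 by rewrite f2.2 // f1.2 // s0E.
pose U t := code (greedy_output dep a bs (N * n + t) x).
pose V t := code (greedy_output dep a bs (N * n + t) y).
have oU t : t < n + n -> nth 0 (deque s2 (outq false)) t = U t.
  by move=> tn; rewrite f2.1 // o1 (nth_map 0) ?size_iota // nth_iota.
have oV t : t < n + n -> nth 0 (deque s2 (outq true)) t = V t.
  by move=> tn; rewrite o2 (nth_map 0) ?size_iota // nth_iota.
have perU t : U (t + n) = U t by rewrite /U greedy_output_periodic.
have perV t : V (t + n) = V t by rewrite /V greedy_output_periodic.
have [m3 [s3 [R3 T3 f3 found]]] := cmp_run n_gt0 perU perV n2 ok2 oU oV.
(* Setup takes 1 step, each rotation block [(N + 2) * n + 4] and the comparison [3 * n + 3], at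
   most. *)
exists (m1 + (m2 + m3)).+1, s3; split.
- by apply: RunBlk; apply: (run_cat R1); apply: (run_cat R2).
- by nia.
have c3 j : reg s3 (count_reg false j) = count_gen j u.
  by rewrite f3.2 // f2.2 // f1.2 // s0E /= -c1.
split=> //; case: found => [[ok3 [i [j E]]]|[ok3 E]]; last first.
  (* Were [u] and [v] conjugate, so would be their restrictions, and [greedy_shift] would yield a
     shift that the comparison has excluded. *)
  left; split=> // uv; have uv' : trace_conj u' v'.
    exact: TconjTrans (TconjSym uu') (TconjTrans uv vv').
  have [i [j sh]] := greedy_shift dep_refl dep_sym conn spx sx sy
    (trace_conj_filter (fun k => k \in ss) uv').
  by apply: (E i j) => t; rewrite /U /V !addnA sh.
have xy : trace_conj x y.
  apply: (greedy_trace_conj dep_refl dep_sym conn spx spy sx sy (i := i) (j := j)) => t tn.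
  by rewrite -!addnA; apply: letter_code_inj; apply: E.
right; split=> //.
  (* The stacks of the component now hold a rotated word. [replace_component] inserts it into a
     whole word that is still conjugate to the old one and has the same piles at the other supported
     generators. *)
  have tx := iter_greedy_step_trace_conj dep_refl dep_sym conn (n + n + N * n) spx.
  have ty := iter_greedy_step_trace_conj dep_refl dep_sym conn (n + n + N * n) spy.
  have [ru1 ru2 ru3] := replace_component dep_sym csu tx.
  have [rv1 rv2 rv3] := replace_component dep_sym csv ty.
  eexists; eexists; split; first exact: TconjTrans uu' ru1.
  - exact: TconjTrans vv' rv1.
  - move=> k ck; rewrite f3.1 f2.1 //; case: (boolP (k \in ss)) => ks.
      by rewrite p1 // ru2.
    by rewrite f1.1 /= ?ks ?(negPf ks) // s0E /= pu // ru3 // cu.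
  - move=> k ck; rewrite f3.1; case: (boolP (k \in ss)) => ks.
      by rewrite p2 // rv2.
    rewrite f2.1 /= ?ks ?(negPf ks) // f1.1 //= s0E /= pv // rv3 // cv //.
move=> ss'; rewrite inE => /orP[/eqP -> _|]; last exact: Hd.
apply: TconjTrans (trace_conj_filter (fun k => k \in ss) uu') _.
apply: TconjTrans xy _; exact: TconjSym (trace_conj_filter (fun k => k \in ss) vv').
Qed.

Lemma component_blockP u v done ss s : connected dep ss -> component_inv u v done s ->
  exists m s', [/\ run (component_block ss) s m s', m <= (2 * N + 7) * size u + 12 &
    component_inv u v (ss :: done) s'].
Proof.
move=> conn H.
have [ok|/andP[ok cs]] : (reg s rok = 0 \/ ~~ component ss (count_gen^~ u)) \/
    (reg s rok == 1) && component ss (count_gen^~ u).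
  case: H => _ [[ok _]|[ok _ _ _]]; first by left; left.
  by rewrite ok /=; case: component; [right|left; right].
  have [s' [R I']] := component_block_skip conn H ok.
  by exists 11, s'; split=> //; lia.
by apply: component_block_run => //; apply/eqP.
Qed.

Lemma component_blocksP u v sss done s : all (connected dep) sss -> component_inv u v done s ->
  exists m s', [/\ run (flatten [seq component_block ss | ss <- sss]) s m s',
    m <= size sss * ((2 * N + 7) * size u + 12) & component_inv u v (rev sss ++ done) s'].
Proof.
elim: sss done s => [|ss sss IH] done s /=; first by exists 0, s; split=> //; apply: RunNil.
case/andP=> conn call H.
have [m1 [s1 [R1 T1 I1]]] := component_blockP conn H.
have [m2 [s2 [R2 T2 I2]]] := IH _ _ call I1.
exists (m1 + m2), s2; split; first exact: run_cat R1 R2.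
  by rewrite mulSn leq_add.
by rewrite rev_cons cat_rcons.
Qed.

(** Every component is listed, once for each of its connected enumerations; the repetitions only
    affect the constant. *)
Definition connected_seqs : seq (seq 'I_N) :=
  [seq ss <- flatten [seq [seq tval t | t <- enum {: k.-tuple 'I_N}] | k <- iota 0 N.+1]
   | connected dep ss].

Lemma mem_connected_seqs ss : (ss \in connected_seqs) = connected dep ss.
Proof.
rewrite mem_filter; apply: andb_idr => conn.
have us : uniq ss by case: ss conn => // a bs /andP[].
have sz : size ss <= N by rewrite -(card_uniqP us) (leq_trans (max_card _)) ?card_ord.
apply/flattenP; exists [seq tval t | t <- enum {: (size ss).-tuple 'I_N}].
  by apply/mapP; exists (size ss); rewrite // mem_iota.
by apply/mapP; exists (in_tuple ss); rewrite ?mem_enum.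
Qed.

(** Equal counts are necessary for conjugacy, and they allow the later blocks to read the component
    and its size off the first word alone. *)
Definition check : cmd :=
  Sq (set rok (cst 1))
     (bfor (fun j => If (eneq (rd (count_reg false j)) (rd (count_reg true j))) (set rok (cst 0)) skip)
           (enum 'I_N)).

Lemma checkP u v s : side dep s false u -> side dep s true v ->
  component_inv u v [::] (denote check s).
Proof.
move=> [u1 u2] [v1 v2]; rewrite /check denoteSq clear_ifE //.
set h := has _ _; have hE : h = [exists j, count_gen j u != count_gen j v].
  apply/hasP/existsP => [[j _]|[j H]].
    by rewrite eneqP /= /upd /= u2 v2; exists j.
  by exists j; rewrite ?mem_enum // eneqP /= /upd /= u2 v2.
split=> [j|]; first by rewrite /= /upd /= u2.
rewrite /= /upd eqxx hE; case: ifP => [/existsP[j ne]|H].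
  by left; split=> // /(trace_conj_count_gen j) E; rewrite E eqxx in ne.
right; split=> //.
  by move=> j; apply/eqP; apply: contraFT H => ne; apply/existsP; exists j.
by exists u, v; split=> //; apply: trace_conj_refl.
Qed.

Lemma component_inv_ok u v s : component_inv u v (rev connected_seqs ++ [::]) s ->
  (0 < reg s rok) <-> trace_conj u v.
Proof.
case=> _ [[-> H]|[-> cc _ H]]; split=> // _.
apply: trace_conj_components => // ss cs; apply: H => //.
by rewrite cats0 mem_rev mem_connected_seqs; case/and3P: cs.
Qed.

End Components.

Section Main.
Variables (N : nat) (C : seq ('I_N * 'I_N)).
Notation dep := (raag_dep C).

Definition conj_prog : seq (item (rg N) (deques N)) :=
  read_word dep false ++ read_word dep true ++ reduce C false ++ reduce C true ++
  Blk (check N) :: flatten [seq component_block dep ss | ss <- connected_seqs dep].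

End Main.

(* The bound c * (l1 + l2 + 1) is O(l1 + l2), allowing for the constant time
   needed on two empty words. *)
Theorem theorem22 (N : nat) (C : seq ('I_N * 'I_N)) :
  exists (P : ram_program) (c : nat), forall w v : word N,
    ram_decides_within P (word_pair_code w v) (c * (size w + size v).+1)
      (@conjugate (raag C) (elt_of (commutation_relations C) w)
                           (elt_of (commutation_relations C) v)).
Proof.
pose e := @EReg (rg N) (deques N) (rok N); pose P := compile (conj_prog C) e.
have dr := raag_dep_refl C; have ds := raag_dep_sym C.
(* With [L] the total length, reading, reducing, [check] and the final test take at most
   [2 * L + 12] steps, and each block at most [(2 * N + 7) * L + 12]; both are bounded by multiples
   of [L + 1]. *)
exists P, ((14 + size (connected_seqs (raag_dep C)) * (2 * N + 19)) * size P) => w v.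
have sd0 b : side (raag_dep C) (init_state (rg N) (deques N) (word_pair_code w v)) b [::] by [].
have t0 : tape (init_state (rg N) (deques N) (word_pair_code w v)) =
  map (@letter_code N) w ++ 0 :: (map (@letter_code N) v ++ [:: 0]) by [].
have [n1 [s1 [u1 [R1 T1 t1 [sd1 ru1 su1 eu1 o1]]]]] := read_wordP t0 (sd0 false).
have [n2 [s2 [v1 [R2 T2 t2 [sd2 rv1 sv1 ev1 o2]]]]] := read_wordP t1 (o1 _ (sd0 true)).
have [n3 [s3 [u2 [R3 T3 sd3 cu2 [eu2 su2 o3]]]]] := reduceP (o2 _ sd1) ru1 sd2.
have [n4 [s4 [v2 [R4 T4 sd4 cv2 [ev2 sv2 o4]]]]] := reduceP o3 rv1 sd3.
have I0 := checkP o4 sd4.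
have [|n5 [s5 [R5 T5 I5]]] := @component_blocksP _ _ dr ds u2 v2 (connected_seqs (raag_dep C)) [::] _ _ I0.
  by apply/allP=> ss; rewrite mem_connected_seqs.
have R : run (conj_prog C) (init_state _ _ (word_pair_code w v)) (n1 + (n2 + (n3 + (n4 + (1 + n5))))) s5.
  do 4 (apply: run_cat; [eassumption|]).
  exact: RunBlk.
exists (0 < reg s5 (rok N)); split; last first.
  apply: iff_trans (component_inv_ok ds I5) _.
  rewrite -eu1 -ev1; split=> [/trace_conj_conjugate H|H].
    exact: conjugate_trans (conjugate_trans eu2 H) (conjugate_sym ev2).
  apply: conjugate_trace_conj => //.
  exact: conjugate_trans (conjugate_trans (conjugate_sym eu2) H) ev2.
have := compileP e R; set k := _.+1 => RP.
have kb : k <= (14 + size (connected_seqs (raag_dep C)) * (2 * N + 19)) * (size w + size v).+1.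
  have uL : size u2 <= size w + size v by lia.
  have n5b : n5 <= size (connected_seqs (raag_dep C)) * (2 * N + 19) * (size w + size v).+1.
    apply: leq_trans T5 _; rewrite -mulnA leq_mul2l; apply/orP; right.
    rewrite mulnS addnC leq_add //; first by lia.
    by apply: leq_mul => //; lia.
  by rewrite /k mulnDl; lia.
have H : k * size P <= (14 + size (connected_seqs (raag_dep C)) * (2 * N + 19)) * size P *
  (size w + size v).+1 by rewrite mulnAC leq_mul2r kb orbT.
by rewrite -(subnKC H); apply: ram_run_mono.
Qed.
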